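(* Let $w$ be the Faddeeva function and, for $N\in\{0,1,2,\ldots\}$, let $w_N:\mathbb{C}\to\mathbb{C}$ be the approximation to $w$ defined in the context. Let $$C_1 := \frac{2(2e+\sqrt{\pi})}{e^\pi\sqrt{e\pi}\left(1- \exp\left(-2\pi+\sqrt{2\pi}\right)\right)}+ \frac{10\sqrt{2}\,(1+2\pi)}{e^\pi\pi^2} \approx 0.67,$$ $$C_2 := \frac{2\sqrt{2}\,(1+\sqrt{\pi})(2e+\sqrt{\pi})}{e^\pi\sqrt{e}\left(1- \exp\left(-2\pi+\sqrt{2\pi}\right)\right)}+ \frac{10(1+2\pi)(2\pi+\sqrt{2})}{e^\pi\pi^2} \approx 3.97.$$ Then, for every integer $N\geq 0$ and $z=x+\mathrm{i}y$, $$|w(z)-w_{N}(z)|\leq C_1\,e^{-\pi N}\quad \mbox{for all } x,y\in \mathbb{R},$$ and $$\frac{|w(z)-w_{N}(z)|}{|w(z)|}\leq C_2\,\sqrt{N+1}\;e^{-\pi N}\quad \mbox{if } x\in \mathbb{R} \mbox{ and } y\geq 0.$$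
   Context: The complementary error function is $\mathrm{erfc}(z)=\frac{2}{\sqrt{\pi}}\int_z^\infty e^{-t^2}\,dt$ (an entire function of $z\in\mathbb{C}$), and the Faddeeva function is $w(z):=e^{-z^2}\,\mathrm{erfc}(-\mathrm{i}z)$. For $t\in\mathbb{R}$ let $\varphi(t):=t-\lfloor t\rfloor\in[0,1)$. For an integer $N\ge 0$ let $h:=\sqrt{\pi/(N+1)}$, $t_k:=(k+1/2)h$, $\tau_k:=kh$, and $$w_N^{\mathrm{M}}(z):=\frac{2\mathrm{i}hz}{\pi}\sum_{k=0}^N\frac{e^{-t_k^2}}{z^2-t_k^2},\qquad w_N^{\mathrm{MM}}(z):=\frac{2e^{-z^2}}{1+e^{-2\mathrm{i}\pi z/h}}+w_N^{\mathrm{M}}(z),$$ $$w_N^{\mathrm{MT}}(z):=\frac{2e^{-z^2}}{1-e^{-2\mathrm{i}\pi z/h}}+\frac{\mathrm{i}h}{\pi z}+\frac{2\mathrm{i}hz}{\pi}\sum_{k=1}^N\frac{e^{-\tau_k^2}}{z^2-\tau_k^2}.$$ For $z=x+\mathrm{i}y$ with $x\ge 0$, $y\geq 0$ define $$w_N(z):=\begin{cases} w_N^{\mathrm{M}}(z), & \mbox{if } y\geq\max(x,\pi/h),\\ w_N^{\mathrm{MT}}(z), & \mbox{if } y<x \mbox{ and } 1/4\leq\varphi(x/h)\leq 3/4,\\ w_N^{\mathrm{MM}}(z), & \mbox{otherwise.}\end{cases}$$ Extend $w_N$ to $\mathbb{C}$ by $w_N(z):=\overline{w_N(-\overline{z})}$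 if $y\geq 0$ and $x<0$, and then $w_N(z):=2e^{-z^2}-w_N(-z)$ if $y<0$. *)

(* Defs.v *)
From Stdlib Require Import Reals.
From Coquelicot Require Import Coquelicot.

Open Scope R_scope.

Definition Cexp (z : C) : C := (exp (Re z) * cos (Im z), exp (Re z) * sin (Im z)).

(* The contour of integration from z to infinity is the horizontal ray
   t = z + s, s >= 0; the integral is an improper Riemann integral of a
   C-valued function of the real variable s. *)
Definition erfc (z : C) : C :=
  (RtoC (2 / sqrt PI) *
     RInt_gen (V := C_R_CompleteNormedModule)
       (fun s : R => Cexp (- (z + RtoC s) ^ 2))
       (at_point 0%R) (Rbar_locally p_infty))%C.

Definition faddeeva (z : C) : C := (Cexp (- z ^ 2) * erfc (- (Ci * z)))%C.

Definition step (N : nat) : R := sqrt (PI / (INR N + 1)).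

Definition midnode (N : nat) (k : nat) : R := (INR k + 1 / 2) * step N.

Definition node (N : nat) (k : nat) : R := INR k * step N.

Definition wM (N : nat) (z : C) : C :=
  (2 * Ci * step N * z / PI *
     sum_n (fun k => RtoC (exp (- midnode N k ^ 2)) / (z ^ 2 - midnode N k ^ 2)) N)%C.

Definition wMM (N : nat) (z : C) : C :=
  (2 * Cexp (- z ^ 2) / (1 + Cexp (- (2 * Ci * PI * z / step N))) + wM N z)%C.

(* The sum is empty, hence zero, when N = 0. *)
Definition wMT (N : nat) (z : C) : C :=
  (2 * Cexp (- z ^ 2) / (1 - Cexp (- (2 * Ci * PI * z / step N)))
   + Ci * step N / (PI * z)
   + 2 * Ci * step N * z / PI *
     sum_n_m (fun k => RtoC (exp (- node N k ^ 2)) / (z ^ 2 - node N k ^ 2)) 1 N)%C.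

(* Only meant for 0 <= Re z and 0 <= Im z; none of the denominators of the
   selected branch vanishes there. *)
Definition wN_quadrant (N : nat) (z : C) : C :=
  let x := Re z in
  let y := Im z in
  let phi := frac_part (x / step N) in
  if Rle_dec (Rmax x (PI / step N)) y then wM N z
  else if sumbool_and _ _ _ _ (Rlt_dec y x)
            (sumbool_and _ _ _ _ (Rle_dec (1 / 4) phi) (Rle_dec phi (3 / 4)))
       then wMT N z
  else wMM N z.

Definition wN_upper (N : nat) (z : C) : C :=
  if Rle_dec 0 (Re z) then wN_quadrant N z
  else Cconj (wN_quadrant N (- Cconj z)%C).

Definition wN (N : nat) (z : C) : C :=
  if Rle_dec 0 (Im z) then wN_upper N z
  else (2 * Cexp (- z ^ 2) - wN_upper N (- z))%C.

Definition abs_const : R :=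
  2 * (2 * exp 1 + sqrt PI)
    / (exp PI * sqrt (exp 1 * PI) * (1 - exp (- 2 * PI + sqrt (2 * PI))))
  + 10 * sqrt 2 * (1 + 2 * PI) / (exp PI * PI ^ 2).

Definition rel_const : R :=
  2 * sqrt 2 * (1 + sqrt PI) * (2 * exp 1 + sqrt PI)
    / (exp PI * sqrt (exp 1) * (1 - exp (- 2 * PI + sqrt (2 * PI))))
  + 10 * (1 + 2 * PI) * (2 * PI + sqrt 2) / (exp PI * PI ^ 2).

(* Main.v *)
Require Import Defs.
From Stdlib Require Import ZArith Reals Lra Lia Machin.
From Coquelicot Require Import Coquelicot.
Open Scope R_scope.

(** Completing the square in the definition gives, for every complex z,
<<
      w(z) = 2/sqrt(pi) * (integral over s >= 0 of exp(-s^2 + 2isz)).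
>>
    Everything follows from this formula by elementary means; no path of integration is ever
    deformed.

    Bounds for w. Estimating the integral gives |w| <= 1 in the closed upper half-plane, and one
    integration by parts gives |z||w(z)| <= 2/sqrt(pi) there. The same integration by parts
    writes (1 - i sqrt(pi) z) w(z) - 1 as an integral whose modulus is at most 2/pi, so that
    |w(z)| >= (1 - 2/pi) / (1 + sqrt(pi)|z|) ([faddeeva_lower_bound]); this is what turns absolute
    errors into relative ones. The Fourier transform of the Gaussian is the reflection formula
    w(z) + w(-z) = 2 exp(-z^2) ([faddeeva_reflect]).

    The error of the rules. Put H = pi/h and q = exp(2iHz). Poisson summation ([poisson]) equates
    the sum of exp(-(u+nH)^2) over the integers n with h/sqrt(pi) times the sum of
    exp(-s^2) cos(2us) over the nodes s. Multiply both by 2/sqrt(pi) exp(2iuz) and integrate over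
    u in [0, H]. The node side becomes 1 - q times the untruncated rational sum. On the other side
    the integral of the n-th term is a difference c_n - q c_(n+1) with
    c_n = exp(-n^2H^2) w(z + inH), so that the sum over n is 1 - q times the sum of the c_n. For negative n the reflection formula replaces w(z + inH) by
    2 exp(-(z + inH)^2) - w(-z - inH); the exponentials form a geometric series in q, which is the
    pole correction of the modified rules. What remains is
<<
      w(z) - (corrected rational sum)
        = - sum over n >= 1 of exp(-n^2H^2) (w(inH + z) - w(inH - z)),
>>
    with signs (-1)^n and -q in place of q for the midpoint nodes ([rule_expansion]). Since
    H^2 = pi(N+1), the right-hand side is of the order exp(-pi(N+1)) as soon as the values of w
    are bounded, which is the case in the regions where the three formulas are used. The
    truncation of the rational sum after N terms has the same order, because z keeps the
    distance h/4 from the omitted nodes ([quadrant_error]). Every bound is proved together with a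
    bound for |z| times the same quantity, as the lower bound for |w| requires. *)

Notation gauss t := (exp (- (t * t))).
Notation rate N := (exp (- (PI * (INR N + 1)))).

(** * The complex exponential, and integrals of complex-valued functions *)

Lemma RtoC_neq_0 : forall x : R, x <> 0 -> RtoC x <> 0%C.
Proof. intros x Hx H; apply RtoC_inj in H; exact (Hx H). Qed.

Lemma Cexp_plus : forall a b : C, Cexp (a + b) = (Cexp a * Cexp b)%C.
Proof.
  intros [a1 a2] [b1 b2]; unfold Cexp; simpl.
  rewrite exp_plus, cos_plus, sin_plus.
  apply injective_projections; simpl; ring.
Qed.

Lemma Cexp_0 : Cexp 0 = 1%C.
Proof.
  unfold Cexp; simpl; rewrite exp_0, cos_0, sin_0.
  apply injective_projections; simpl; ring.
Qed.

Lemma Cmod_Cexp : forall z : C, Cmod (Cexp z) = exp (Re z).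
Proof.
  intros [x y]; unfold Cexp, Cmod; simpl.
  assert (Hx := exp_pos x).
  replace (_ + _) with (exp x ^ 2 * (Rsqr (sin y) + Rsqr (cos y))) by (unfold Rsqr; ring).
  rewrite sin2_cos2, Rmult_1_r.
  apply sqrt_pow2; lra.
Qed.

Lemma Cexp_opp_l : forall z : C, (Cexp (- z) * Cexp z)%C = 1%C.
Proof. intros z; rewrite <- Cexp_plus, <- Cexp_0; f_equal; ring. Qed.

Lemma Cexp_neq_0 : forall z : C, Cexp z <> 0%C.
Proof.
  intros z Hz; assert (H := Cmod_Cexp z).
  rewrite Hz, Cmod_0 in H; assert (Hx := exp_pos (Re z)); lra.
Qed.

Lemma Cexp_conj : forall z : C, Cexp (Cconj z) = Cconj (Cexp z).
Proof.
  intros [x y]; unfold Cexp, Cconj; simpl.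
  rewrite cos_neg, sin_neg; apply injective_projections; simpl; ring.
Qed.

Lemma Cexp_RtoC : forall x : R, Cexp (RtoC x) = RtoC (exp x).
Proof.
  intros x; unfold Cexp, RtoC; simpl; rewrite cos_0, sin_0.
  apply injective_projections; simpl; ring.
Qed.

(* The carrier of an equality is often a canonical structure that computes to R or C, where the
   decision procedures for R and C do not apply. *)
Ltac Req := match goal with |- @eq _ ?a ?b => change (@eq R a b) end.
Ltac Ceq := match goal with |- @eq _ ?a ?b => change (@eq C a b) end.
Ltac Rring := simpl; Req; ring.

Ltac cont_derive :=
  apply (ex_derive_continuous (V := R_NormedModule)); auto_derive; auto.

Lemma cont_plus : forall (f g : R -> R) s,
  continuous f s -> continuous g s -> continuous (fun t => f t + g t) s.
Proof. intros f g s; apply (continuous_plus (V := R_NormedModule)). Qed.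

Lemma cont_minus : forall (f g : R -> R) s,
  continuous f s -> continuous g s -> continuous (fun t => f t - g t) s.
Proof. intros f g s; apply (continuous_minus (V := R_NormedModule)). Qed.

Lemma cont_mult : forall (f g : R -> R) s,
  continuous f s -> continuous g s -> continuous (fun t => f t * g t) s.
Proof. intros f g s; apply (continuous_mult (K := R_AbsRing)). Qed.

Lemma RInt_cst : forall c a b : R, RInt (fun _ => c) a b = (b - a) * c.
Proof. intros c a b; exact (RInt_const (V := R_CompleteNormedModule) a b c). Qed.

Definition Ccont (f : R -> C) : Prop :=
  forall s, continuous (fun t => fst (f t)) s /\ continuous (fun t => snd (f t)) s.

Lemma Ccont_const : forall c : C, Ccont (fun _ => c).
Proof. intros c s; split; apply continuous_const. Qed.

Lemma Ccont_RtoC : forall f : R -> R, (forall s, continuous f s) -> Ccont (fun s => RtoC (f s)).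
Proof. intros f Hf s; split; simpl; [apply Hf | apply continuous_const]. Qed.

Lemma Ccont_plus : forall f g : R -> C, Ccont f -> Ccont g -> Ccont (fun s => f s + g s)%C.
Proof.
  intros f g Hf Hg s; destruct (Hf s), (Hg s); simpl.
  split; apply cont_plus; assumption.
Qed.

Lemma Ccont_mult : forall f g : R -> C, Ccont f -> Ccont g -> Ccont (fun s => f s * g s)%C.
Proof.
  intros f g Hf Hg s; destruct (Hf s), (Hg s); simpl.
  split; [apply cont_minus
         | apply cont_plus];
    apply cont_mult; assumption.
Qed.

Lemma Ccont_opp : forall f : R -> C, Ccont f -> Ccont (fun s => - f s)%C.
Proof.
  intros f Hf s; destruct (Hf s); simpl.
  split; apply (continuous_opp (V := R_NormedModule)); assumption.
Qed.

Lemma Ccont_minus : forall f g : R -> C, Ccont f -> Ccont g -> Ccont (fun s => f s - g s)%C.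
Proof. intros f g Hf Hg; apply Ccont_plus; [|apply Ccont_opp]; assumption. Qed.

Lemma continuous_cos_comp : forall (f : R -> R) s, continuous f s -> continuous (fun t => cos (f t)) s.
Proof.
  intros f s Hf; apply (continuous_comp f cos); [exact Hf|].
  apply continuity_pt_filterlim, continuity_cos.
Qed.

Lemma continuous_sin_comp : forall (f : R -> R) s, continuous f s -> continuous (fun t => sin (f t)) s.
Proof.
  intros f s Hf; apply (continuous_comp f sin); [exact Hf|].
  apply continuity_pt_filterlim, continuity_sin.
Qed.

Lemma Ccont_Cexp : forall f : R -> C, Ccont f -> Ccont (fun s => Cexp (f s)).
Proof.
  intros f Hf s; destruct (Hf s) as [H1 H2]; unfold Cexp; simpl.
  split; apply cont_mult.
  1, 3: apply (continuous_comp (fun t => fst (f t)) exp); [exact H1|];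
    apply continuity_pt_filterlim, derivable_continuous_pt, derivable_pt_exp.
  - apply continuous_cos_comp; exact H2.
  - apply continuous_sin_comp; exact H2.
Qed.

Lemma Ccont_comp_lin : forall (f : R -> C) (u v : R), Ccont f -> Ccont (fun s => f (u * s + v)).
Proof.
  intros f u v Hf s; destruct (Hf (u * s + v)) as [H1 H2].
  assert (Hl : continuous (fun t : R => u * t + v) s).
  { apply cont_plus.
    - apply cont_mult; [apply continuous_const | apply continuous_id].
    - apply continuous_const. }
  split; [apply (continuous_comp _ (fun t => fst (f t)))
         | apply (continuous_comp _ (fun t => snd (f t)))]; assumption.
Qed.

Ltac Ccont_tac :=
  repeat match goal with
    | H : Ccont ?f |- Ccont ?f => exact H
    | H : Ccont ?f |- Ccont (fun s => ?f s) => exact H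
    | |- Ccont (fun _ => ?c) => apply (Ccont_const c)
    | |- Ccont (fun s => RtoC (@?f s)) =>
        apply (Ccont_RtoC f); intros ?s; apply (ex_derive_continuous (V := R_NormedModule));
        auto_derive; auto
    | |- Ccont (fun s => Cexp (@?f s)) => apply (Ccont_Cexp f)
    | |- Ccont (fun s => Cplus (@?f s) (@?g s)) => apply (Ccont_plus f g)
    | |- Ccont (fun s => Cminus (@?f s) (@?g s)) => apply (Ccont_minus f g)
    | |- Ccont (fun s => Copp (@?f s)) => apply (Ccont_opp f)
    | |- Ccont (fun s => Cmult (@?f s) (@?g s)) => apply (Ccont_mult f g)
    end.

(** Componentwise, so that all linear rules reduce to the real ones. *)
Definition CInt (f : R -> C) (a b : R) : C :=
  (RInt (fun s => fst (f s)) a b, RInt (fun s => snd (f s)) a b).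

Lemma ex_RInt_cont : forall (f : R -> R) a b, (forall s, continuous f s) -> ex_RInt f a b.
Proof. intros f a b Hf; apply (ex_RInt_continuous (V := R_CompleteNormedModule)); auto. Qed.

Lemma Ccont_ex : forall f a b, Ccont f ->
  ex_RInt (fun s => fst (f s)) a b /\ ex_RInt (fun s => snd (f s)) a b.
Proof. intros f a b Hf; split; apply ex_RInt_cont; intros s; destruct (Hf s); assumption. Qed.

Lemma is_RInt_CInt : forall (f : R -> C) a b, Ccont f ->
  is_RInt (V := C_R_CompleteNormedModule) f a b (CInt f a b).
Proof.
  intros f a b Hf; destruct (Ccont_ex f a b Hf) as [H1 H2].
  apply (is_RInt_fct_extend_pair (U := R_NormedModule) (V := R_NormedModule) f);
    apply (RInt_correct (V := R_CompleteNormedModule)); assumption.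
Qed.

Lemma CInt_ext : forall f g a b, (forall s, f s = g s) -> CInt f a b = CInt g a b.
Proof.
  intros f g a b H; unfold CInt; f_equal; apply RInt_ext; intros s _; rewrite H; reflexivity.
Qed.

Lemma CInt_plus : forall f g a b, Ccont f -> Ccont g ->
  CInt (fun s => f s + g s)%C a b = (CInt f a b + CInt g a b)%C.
Proof.
  intros f g a b Hf Hg.
  destruct (Ccont_ex f a b Hf), (Ccont_ex g a b Hg).
  unfold CInt; apply injective_projections; simpl;
    apply (RInt_plus (V := R_CompleteNormedModule)); assumption.
Qed.

Lemma RInt_lin2 : forall (f g : R -> R) c d a b, ex_RInt f a b -> ex_RInt g a b ->
  RInt (fun s => c * f s + d * g s) a b = c * RInt f a b + d * RInt g a b.
Proof.
  intros f g c d a b Hf Hg.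
  rewrite (RInt_plus (V := R_CompleteNormedModule) (fun s => c * f s) (fun s => d * g s)).
  - rewrite (RInt_scal (V := R_CompleteNormedModule) f), (RInt_scal (V := R_CompleteNormedModule) g);
      try assumption; reflexivity.
  - apply (ex_RInt_scal (V := R_NormedModule)); exact Hf.
  - apply (ex_RInt_scal (V := R_NormedModule)); exact Hg.
Qed.

Lemma CInt_scal : forall (c : C) f a b, Ccont f ->
  CInt (fun s => c * f s)%C a b = (c * CInt f a b)%C.
Proof.
  intros [c d] f a b Hf; destruct (Ccont_ex f a b Hf) as [H1 H2].
  unfold CInt; apply injective_projections; simpl.
  - rewrite (RInt_ext _ (fun s => c * fst (f s) + (- d) * snd (f s))) by (intros; Rring).
    rewrite RInt_lin2 by assumption; ring.
  - rewrite RInt_lin2 by assumption; ring.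
Qed.

Lemma CInt_minus : forall f g a b, Ccont f -> Ccont g ->
  CInt (fun s => f s - g s)%C a b = (CInt f a b - CInt g a b)%C.
Proof.
  intros f g a b Hf Hg.
  rewrite (CInt_ext _ (fun s => f s + (RtoC (-1)) * g s)%C)
    by (intros; apply injective_projections; simpl; ring).
  assert (H : Ccont (fun s => RtoC (-1) * g s)%C) by (apply Ccont_mult; [apply Ccont_const | exact Hg]).
  rewrite (CInt_plus f _ a b Hf H), (CInt_scal _ g a b Hg).
  apply injective_projections; simpl; ring.
Qed.

Lemma CInt_Chasles : forall f a b c, Ccont f ->
  (CInt f a b + CInt f b c)%C = CInt f a c.
Proof.
  intros f a b c Hf.
  destruct (Ccont_ex f a b Hf), (Ccont_ex f b c Hf).
  unfold CInt; apply injective_projections; simpl;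
    apply (RInt_Chasles (V := R_CompleteNormedModule)); assumption.
Qed.

Lemma CInt_shift : forall f c a b, Ccont f ->
  CInt (fun s => f (s + c)) a b = CInt f (a + c) (b + c).
Proof.
  intros f c a b Hf.
  destruct (Ccont_ex f (1 * a + c) (1 * b + c) Hf) as [H1 H2].
  unfold CInt.
  replace (a + c) with (1 * a + c) by ring; replace (b + c) with (1 * b + c) by ring.
  rewrite <- (RInt_comp_lin (V := R_CompleteNormedModule) _ 1 c a b H1).
  rewrite <- (RInt_comp_lin (V := R_CompleteNormedModule) _ 1 c a b H2).
  f_equal; apply RInt_ext; intros s _; unfold scal; simpl; unfold mult; simpl;
    rewrite !Rmult_1_l; reflexivity.
Qed.

Lemma RInt_reflect : forall (f : R -> R) a b, (forall s, continuous f s) ->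
  RInt (fun s => f (- s)) a b = - RInt f (- a) (- b).
Proof.
  intros f a b Hf.
  assert (H1 := ex_RInt_cont f (-1 * a + 0) (-1 * b + 0) Hf).
  replace (- a) with (-1 * a + 0) by ring; replace (- b) with (-1 * b + 0) by ring.
  assert (E : -1 * RInt (fun y => f (- y)) a b = RInt f (-1 * a + 0) (-1 * b + 0)).
  { etransitivity; [|exact (RInt_comp_lin (V := R_CompleteNormedModule) f (-1) 0 a b H1)].
    etransitivity; [symmetry; apply (RInt_scal (V := R_CompleteNormedModule))|].
    - apply ex_RInt_cont; intros s; apply (continuous_comp Ropp f); [|apply Hf].
      apply (continuous_opp (V := R_NormedModule)), continuous_id.
    - apply RInt_ext; intros s _; replace (-1 * s + 0) with (- s) by Rring; reflexivity. }
  assert (K : forall x : R, x = - (-1 * x)) by (intros; ring).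
  rewrite <- E; apply K.
Qed.

Lemma CInt_reflect : forall f a b, Ccont f ->
  CInt (fun s => f (- s)) a b = (- CInt f (- a) (- b))%C.
Proof.
  intros f a b Hf; unfold CInt; apply injective_projections.
  - apply (RInt_reflect (fun s => fst (f s))); intros s; destruct (Hf s); assumption.
  - apply (RInt_reflect (fun s => snd (f s))); intros s; destruct (Hf s); assumption.
Qed.

Lemma Cmod_CInt_le : forall (f : R -> C) (g : R -> R) a b, a <= b ->
  Ccont f -> (forall s, continuous g s) ->
  (forall s, a <= s <= b -> Cmod (f s) <= g s) ->
  Cmod (CInt f a b) <= RInt g a b.
Proof.
  intros f g a b Hab Hf Hg Hfg.
  set (I := CInt f a b).
  assert (HI := Cmod_ge_0 I).
  destruct (Req_dec (Cmod I) 0) as [H0|H0].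
  { rewrite H0; apply RInt_ge_0; [exact Hab | apply ex_RInt_cont; exact Hg |].
    intros s Hs; apply Rle_trans with (Cmod (f s)); [apply Cmod_ge_0 | apply Hfg; lra]. }
  (* Test against the conjugate of I: its product with I is the square of Cmod I. *)
  apply Rmult_le_reg_l with (Cmod I); [lra|].
  assert (E : Cmod I * Cmod I = fst I * fst I + snd I * snd I).
  { rewrite <- (sqrt_sqrt (fst I * fst I + snd I * snd I)) by nra.
    unfold Cmod; replace (fst I ^ 2 + snd I ^ 2) with (fst I * fst I + snd I * snd I) by ring.
    reflexivity. }
  rewrite E.
  destruct (Ccont_ex f a b Hf) as [H1 H2].
  assert (L : fst I * fst I + snd I * snd I =
              RInt (fun s => fst I * fst (f s) + snd I * snd (f s)) a b).
  { rewrite RInt_lin2 by assumption; reflexivity. }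
  rewrite L.
  assert (Q : Cmod I * RInt g a b = RInt (fun s => Cmod I * g s) a b).
  { symmetry; apply (RInt_scal (V := R_CompleteNormedModule)); apply ex_RInt_cont; exact Hg. }
  rewrite Q.
  apply RInt_le; [exact Hab | | |].
  - apply ex_RInt_cont; intros s; destruct (Hf s).
    apply cont_plus; apply cont_mult;
      try apply continuous_const; assumption.
  - apply ex_RInt_cont; intros s.
    apply cont_mult; [apply continuous_const | apply Hg].
  - intros s Hs.
    apply Rle_trans with (Cmod I * Cmod (f s)).
    + apply Rle_trans with (Cmod (Cconj I * f s)%C).
      * eapply Rle_trans; [|apply re_le_Cmod]; eapply Rle_trans; [|apply Rle_abs].
        simpl; lra.
      * rewrite Cmod_mult, Cmod_conj; lra.
    + apply Rmult_le_compat_l; [exact HI | apply Hfg; lra].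
Qed.

Lemma is_derive_exp_cos : forall (P Q : R -> R) s dP dQ, is_derive P s dP -> is_derive Q s dQ ->
  is_derive (fun t => exp (P t) * cos (Q t)) s (dP * (exp (P s) * cos (Q s)) - dQ * (exp (P s) * sin (Q s))).
Proof.
  intros P Q s dP dQ D1 D2; auto_derive.
  - repeat split; eexists; [exact D1 | exact D2].
  - assert (E1 : Derive (fun x : R => P x) s = dP) by (apply is_derive_unique; exact D1).
    assert (E2 : Derive (fun x : R => Q x) s = dQ) by (apply is_derive_unique; exact D2).
    rewrite E1, E2; ring.
Qed.

Lemma is_derive_exp_sin : forall (P Q : R -> R) s dP dQ, is_derive P s dP -> is_derive Q s dQ ->
  is_derive (fun t => exp (P t) * sin (Q t)) s (dP * (exp (P s) * sin (Q s)) + dQ * (exp (P s) * cos (Q s))).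
Proof.
  intros P Q s dP dQ D1 D2; auto_derive.
  - repeat split; eexists; [exact D1 | exact D2].
  - assert (E1 : Derive (fun x : R => P x) s = dP) by (apply is_derive_unique; exact D1).
    assert (E2 : Derive (fun x : R => Q x) s = dQ) by (apply is_derive_unique; exact D2).
    rewrite E1, E2; ring.
Qed.

Lemma CInt_Cexp_derive : forall (p dp : R -> C) a b,
  (forall s, is_derive (fun t => fst (p t)) s (fst (dp s))) ->
  (forall s, is_derive (fun t => snd (p t)) s (snd (dp s))) ->
  Ccont dp ->
  CInt (fun s => dp s * Cexp (p s))%C a b = (Cexp (p b) - Cexp (p a))%C.
Proof.
  intros p dp a b H1 H2 Hc.
  assert (Hp : Ccont p).
  { intros s; split; apply (ex_derive_continuous (V := R_NormedModule));
      eexists; [apply H1 | apply H2]. }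
  assert (Hi : Ccont (fun s => dp s * Cexp (p s))%C) by Ccont_tac.
  unfold CInt; apply injective_projections; apply is_RInt_unique.
  - apply (is_RInt_derive (V := R_CompleteNormedModule) (fun t => fst (Cexp (p t)))
             (fun s => fst (dp s * Cexp (p s))%C)).
    + intros s _; exact (is_derive_exp_cos _ _ s _ _ (H1 s) (H2 s)).
    + intros s _; destruct (Hi s); assumption.
  - apply (is_RInt_derive (V := R_CompleteNormedModule) (fun t => snd (Cexp (p t)))
             (fun s => snd (dp s * Cexp (p s))%C)).
    + intros s _; exact (is_derive_exp_sin _ _ s _ _ (H1 s) (H2 s)).
    + intros s _; destruct (Hi s); assumption.
Qed.

(** * Limits, and the Fourier transform of the Gaussian *)

(** Convergence at plus infinity, with a weak inequality so that bounds can be used directly. *)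
Definition Clim (f : R -> C) (l : C) : Prop :=
  forall eta, 0 < eta -> exists B, forall b, B <= b -> Cmod (f b - l) <= eta.

Lemma Clim_ext : forall (f g : R -> C) l, (forall b, f b = g b) -> Clim f l -> Clim g l.
Proof.
  intros f g l E H eta He; destruct (H eta He) as [B HB]; exists B; intros b Hb.
  rewrite <- E; apply HB, Hb.
Qed.

Lemma Clim_plus : forall f g l m, Clim f l -> Clim g m -> Clim (fun b => f b + g b)%C (l + m)%C.
Proof.
  intros f g l m Hf Hg eta He.
  destruct (Hf (eta / 2)) as [B1 H1]; [lra|]; destruct (Hg (eta / 2)) as [B2 H2]; [lra|].
  exists (Rmax B1 B2); intros b Hb.
  assert (L1 := Rmax_l B1 B2); assert (L2 := Rmax_r B1 B2).
  replace (f b + g b - (l + m))%C with ((f b - l) + (g b - m))%C by ring.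
  eapply Rle_trans; [apply Cmod_triangle|].
  assert (A := H1 b ltac:(lra)); assert (A' := H2 b ltac:(lra)); lra.
Qed.

Lemma Clim_const : forall c, Clim (fun _ => c) c.
Proof.
  intros c eta He; exists 0; intros b _.
  replace (c - c)%C with (RtoC 0) by ring; rewrite Cmod_0; lra.
Qed.

Lemma Clim_scal : forall c f l, Clim f l -> Clim (fun b => c * f b)%C (c * l)%C.
Proof.
  intros c f l Hf eta He.
  assert (Hc := Cmod_ge_0 c).
  destruct (Hf (eta / (Cmod c + 1))) as [B HB].
  { apply Rdiv_lt_0_compat; lra. }
  exists B; intros b Hb; assert (A := HB b Hb).
  replace (c * f b - c * l)%C with (c * (f b - l))%C by ring; rewrite Cmod_mult.
  apply Rle_trans with (Cmod c * (eta / (Cmod c + 1))).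
  - apply Rmult_le_compat_l; assumption.
  - apply Rmult_le_reg_r with (Cmod c + 1); [lra|].
    field_simplify; nra.
Qed.

Lemma Clim_minus : forall f g l m, Clim f l -> Clim g m -> Clim (fun b => f b - g b)%C (l - m)%C.
Proof.
  intros f g l m Hf Hg.
  apply Clim_ext with (fun b => f b + (RtoC (-1)) * g b)%C.
  - intros b; apply injective_projections; simpl; ring.
  - replace (l - m)%C with (l + (RtoC (-1)) * m)%C by (apply injective_projections; simpl; ring).
    apply Clim_plus, Clim_scal; assumption.
Qed.

Lemma Clim_shift : forall f l c, Clim f l -> Clim (fun b => f (b + c)) l.
Proof.
  intros f l c Hf eta He; destruct (Hf eta He) as [B HB]; exists (B - c); intros b Hb.
  apply HB; lra.
Qed.

Lemma Clim_Cmod_le : forall f l c B, Clim f l -> (forall b, B <= b -> Cmod (f b) <= c) -> Cmod l <= c.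
Proof.
  intros f l c B Hf H; apply Rnot_lt_le; intros Hc.
  destruct (Hf ((Cmod l - c) / 2)) as [B' HB]; [lra|].
  set (b := Rmax B B').
  assert (A := HB b (Rmax_r _ _)); assert (A' := H b (Rmax_l _ _)).
  assert (T := Cmod_triangle (f b) (- (f b - l))).
  replace (f b + - (f b - l))%C with l in T by ring; rewrite Cmod_opp in T; lra.
Qed.

Lemma Clim_unique : forall f l m, Clim f l -> Clim f m -> l = m.
Proof.
  intros f l m Hl Hm.
  assert (H := Clim_minus _ _ _ _ Hl Hm).
  assert (E : Cmod (l - m) <= 0).
  { apply (Clim_Cmod_le _ _ 0 0 H); intros b _.
    replace (f b - f b)%C with (RtoC 0) by ring; rewrite Cmod_0; lra. }
  assert (E0 : (l - m)%C = 0%C) by (apply Cmod_eq_0; assert (P := Cmod_ge_0 (l - m)); lra).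
  replace l with ((l - m) + m)%C by ring; rewrite E0; ring.
Qed.

Lemma continuity_pt_ex_derive : forall (f : R -> R) x, ex_derive f x -> continuity_pt f x.
Proof.
  intros f x H; apply continuity_pt_filterlim; exact (ex_derive_continuous (V := R_NormedModule) f x H).
Qed.

Lemma exp_small : forall c eta, 0 < eta -> exists B, forall b, B <= b -> c * exp (- b) <= eta.
Proof.
  intros c eta He; exists (Rmax 1 (c / eta)); intros b Hb.
  assert (L1 := Rmax_l 1 (c / eta)); assert (L2 := Rmax_r 1 (c / eta)).
  assert (Hp := exp_pos (- b)).
  destruct (Rle_lt_dec c 0) as [Hc|Hc]; [nra|].
  assert (Hb' : c <= eta * b).
  { replace c with (eta * (c / eta)) by (field; lra); apply Rmult_le_compat_l; lra. }
  assert (E : exp b * exp (- b) = 1) by (rewrite <- exp_plus, <- exp_0; f_equal; ring).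
  assert (G := exp_ineq1_le b).
  assert (G' : b * exp (- b) <= 1) by nra.
  nra.
Qed.

Lemma exp_le_mono : forall x y, x <= y -> exp x <= exp y.
Proof. intros x y [H|H]; [left; apply exp_increasing, H | right; rewrite H; reflexivity]. Qed.

Lemma gauss_small : forall c eta, 0 < eta -> exists B, forall b, B <= b -> c * gauss b <= eta.
Proof.
  intros c eta He; destruct (exp_small (Rabs c) eta He) as [B HB].
  exists (Rmax 1 B); intros b Hb.
  assert (L1 := Rmax_l 1 B); assert (L2 := Rmax_r 1 B).
  apply Rle_trans with (Rabs c * exp (- b)); [|apply HB; lra].
  apply Rle_trans with (Rabs c * gauss b).
  - apply Rmult_le_compat_r; [left; apply exp_pos | apply Rle_abs].
  - apply Rmult_le_compat_l; [apply Rabs_pos | apply exp_le_mono; nra].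
Qed.

Lemma cont_gauss : forall s, continuous (fun t : R => gauss t) s.
Proof. intros s; cont_derive. Qed.

Lemma cont_gauss_cos : forall x s, continuous (fun t : R => gauss t * cos (2 * x * t)) s.
Proof. intros x s; cont_derive. Qed.

(** The left-hand side has derivative 0 in x and equals arctan 1 at x = 0; as x grows it tends to
    the square of the Gaussian integral. *)
Lemma gauss_square : forall x,
  RInt (fun t => gauss t) 0 x ^ 2 +
  RInt (fun t => exp (- (x * x) * (1 + t * t)) / (1 + t * t)) 0 1 = PI / 4.
Proof.
  set (G := (fun x => RInt (fun t => gauss t) 0 x) : R -> R).
  set (K := (fun x => RInt (fun t => exp (- (x * x) * (1 + t * t)) / (1 + t * t)) 0 1) : R -> R).
  assert (DG : forall x, is_derive G x (gauss x)).
  { intros x; apply (is_derive_RInt (V := R_NormedModule) (fun t => gauss t) G 0).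
    - exists posreal_one; intros y _; apply (RInt_correct (V := R_CompleteNormedModule)).
      apply ex_RInt_cont, cont_gauss.
    - apply cont_gauss. }
  assert (Dk : forall x t, is_derive (fun x => exp (- (x * x) * (1 + t * t)) / (1 + t * t)) x
                 (- (2 * x) * exp (- (x * x) * (1 + t * t)))).
  { intros x t; auto_derive; [nra | field; nra]. }
  assert (Dk' : forall x t : R, Derive (fun u : R => exp (- (u * u) * (1 + t * t)) / (1 + t * t)) x =
                 - (2 * x) * exp (- (x * x) * (1 + t * t)))
    by (intros x t; exact (is_derive_unique _ _ _ (Dk x t))).
  assert (DK : forall x, is_derive K x (- 2 * gauss x * G x)).
  { intros x.
    replace (- 2 * gauss x * G x)
      with (RInt (fun t => Derive (fun u => exp (- (u * u) * (1 + t * t)) / (1 + t * t)) x) 0 1).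
    - apply (is_derive_RInt_param (fun x t => exp (- (x * x) * (1 + t * t)) / (1 + t * t))).
      + exists posreal_one; intros y _ t _; eexists; apply Dk.
      + intros t _.
        apply continuity_2d_pt_ext with (fun u v => - (2 * u) * exp (- (u * u) * (1 + v * v))).
        { intros u v; symmetry; apply is_derive_unique, Dk. }
        apply continuity_2d_pt_mult.
        * apply continuity_1d_2d_pt_comp with (f := fun u => - (2 * u)) (g := fun u v => u);
            [|apply continuity_2d_pt_id1].
          apply continuity_pt_ex_derive; auto_derive; auto.
        * apply continuity_1d_2d_pt_comp with (f := exp) (g := fun u v => - (u * u) * (1 + v * v)).
          { apply continuity_pt_ex_derive; auto_derive; auto. }
          apply continuity_2d_pt_mult.
          { apply continuity_2d_pt_opp, continuity_2d_pt_mult; apply continuity_2d_pt_id1. }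
          apply continuity_2d_pt_plus; [apply continuity_2d_pt_const|].
          apply continuity_2d_pt_mult; apply continuity_2d_pt_id2.
      + exists posreal_one; intros y _; apply ex_RInt_cont; intros s.
        apply (ex_derive_continuous (V := R_NormedModule)); auto_derive; nra.
    - rewrite (RInt_ext _ (fun t => (- 2 * gauss x) * (x * gauss (x * t + 0)))).
      + assert (E : RInt (fun t => (- 2 * gauss x) * (x * gauss (x * t + 0))) 0 1
               = (- 2 * gauss x) * RInt (fun t => x * gauss (x * t + 0)) 0 1).
        { apply (RInt_scal (V := R_CompleteNormedModule)), ex_RInt_cont; intros s.
          cont_derive. }
        assert (E' : RInt (fun t => x * gauss (x * t + 0)) 0 1 = G x).
        { etransitivity.
          - apply (RInt_comp_lin (V := R_CompleteNormedModule) (fun t => gauss t) x 0 0 1).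
            apply ex_RInt_cont, cont_gauss.
          - unfold G; f_equal; ring. }
        rewrite E, E'; reflexivity.
      + intros t _; rewrite Dk'.
        replace (- (x * x) * (1 + t * t)) with (- (x * x) + - ((x * t + 0) * (x * t + 0))) by ring.
        rewrite exp_plus; Rring. }
  assert (D : forall x, is_derive (fun x => G x ^ 2 + K x) x zero).
  { intros x.
    assert (A := is_derive_plus _ _ _ _ _ (is_derive_pow G 2 x _ (DG x)) (DK x)).
    match type of A with is_derive _ _ ?v => replace zero with v; [exact A|] end.
    unfold plus, zero; simpl; ring. }
  assert (E0 : G 0 ^ 2 + K 0 = PI / 4).
  { unfold G, K; rewrite RInt_point.
    rewrite (RInt_ext _ (fun t => / (1 + t * t))).
    - assert (E : is_RInt (fun t => / (1 + t * t)) 0 1 (minus (atan 1) (atan 0))).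
      { apply (is_RInt_derive (V := R_CompleteNormedModule)).
        - intros x _; auto_derive; [auto|]; unfold Rsqr; simpl; field; nra.
        - intros x _; apply (ex_derive_continuous (V := R_NormedModule)); auto_derive; nra. }
      rewrite (is_RInt_unique _ _ _ _ E), atan_1, atan_0; unfold minus, plus, opp, zero; simpl; lra.
    - intros t _; replace (- (0 * 0) * (1 + t * t)) with 0 by ring; rewrite exp_0.
      Req; field; nra. }
  intros x; fold (G x); fold (K x); rewrite <- E0.
  destruct (Rtotal_order x 0) as [H|[H|H]].
  - apply (eq_is_derive (fun x => G x ^ 2 + K x)); [intros; apply D | exact H].
  - rewrite H; reflexivity.
  - symmetry; apply (eq_is_derive (fun x => G x ^ 2 + K x)); [intros; apply D | exact H].
Qed.

Lemma sqrt_PI_gt_1 : 1 < sqrt PI.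
Proof.
  rewrite <- sqrt_1; apply sqrt_lt_1; [lra | left; apply PI_RGT_0 |].
  assert (H := PI2_1); lra.
Qed.

Lemma sqrt_PI_sqr : sqrt PI * sqrt PI = PI.
Proof. apply sqrt_sqrt; left; apply PI_RGT_0. Qed.

Lemma gauss_half : forall b, 0 <= b ->
  Rabs (RInt (fun t => gauss t) 0 b - sqrt PI / 2) <= 2 * gauss b.
Proof.
  intros b Hb; assert (E := gauss_square b).
  set (G := RInt (fun t => gauss t) 0 b) in *.
  set (K := RInt _ 0 1) in E.
  assert (HG : 0 <= G).
  { apply RInt_ge_0; [exact Hb | apply ex_RInt_cont, cont_gauss | intros; left; apply exp_pos]. }
  assert (Hc : ex_RInt (fun t => exp (- (b * b) * (1 + t * t)) / (1 + t * t)) 0 1).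
  { apply ex_RInt_cont; intros s; apply (ex_derive_continuous (V := R_NormedModule)); auto_derive; nra. }
  assert (HK : 0 <= K).
  { apply RInt_ge_0; [lra | exact Hc |]; intros t _.
    apply Rlt_le, Rdiv_lt_0_compat; [apply exp_pos | nra]. }
  assert (HK' : K <= gauss b).
  { replace (gauss b) with (RInt (fun _ => gauss b) 0 1)
      by (rewrite RInt_cst; lra).
    apply RInt_le; [lra | exact Hc | apply ex_RInt_cont; intros; apply continuous_const |].
    intros t _; apply Rle_trans with (exp (- (b * b) * (1 + t * t))).
    - apply Rle_div_l; [nra|]; assert (P := exp_pos (- (b * b) * (1 + t * t))); nra.
    - apply exp_le_mono; nra. }
  assert (S1 := sqrt_PI_gt_1); assert (S2 := sqrt_PI_sqr).
  apply Rabs_le; split; nra.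
Qed.

(** In the variable x the integral J satisfies J' = exp(-b^2) sin(2bx) - 2xJ, so that
    exp(x^2) J is constant up to an error that vanishes as b grows. *)
Lemma gauss_cos_half : forall x b, 0 <= b ->
  Rabs (RInt (fun t => gauss t * cos (2 * x * t)) 0 b - sqrt PI / 2 * gauss x)
    <= (Rabs x + 2) * gauss b.
Proof.
  intros x0 b Hb.
  set (J := (fun x => RInt (fun t => gauss t * cos (2 * x * t)) 0 b) : R -> R).
  set (k := fun x t => gauss t * cos (2 * x * t)).
  assert (Dk : forall x t, is_derive (fun x => k x t) x (- (2 * t) * (gauss t * sin (2 * x * t)))).
  { intros x t; unfold k; auto_derive; [auto | ring]. }
  assert (Dk' : forall x t : R, Derive (fun u : R => k u t) x = - (2 * t) * (gauss t * sin (2 * x * t)))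
    by (intros x t; exact (is_derive_unique _ _ _ (Dk x t))).
  assert (DJ : forall x, is_derive J x (gauss b * sin (2 * x * b) - 2 * x * J x)).
  { intros x.
    replace (gauss b * sin (2 * x * b) - 2 * x * J x)
      with (RInt (fun t => Derive (fun u => k u t) x) 0 b).
    - apply (is_derive_RInt_param k).
      + exists posreal_one; intros y _ t _; eexists; apply Dk.
      + intros t _.
        apply continuity_2d_pt_ext with (fun u v => (- (2 * v) * gauss v) * sin (2 * (u * v))).
        { intros u v; symmetry; apply is_derive_unique.
          assert (A := Dk u v); match type of A with is_derive _ _ ?w =>
            match goal with |- is_derive _ _ ?w' => replace w' with w; [exact A|] end end.
          replace (2 * (u * v)) with (2 * u * v) by ring; ring. }
        apply continuity_2d_pt_mult.
        * apply continuity_1d_2d_pt_comp with (f := fun v => - (2 * v) * gauss v) (g := fun u v => v);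
            [|apply continuity_2d_pt_id2].
          apply continuity_pt_ex_derive; auto_derive; auto.
        * apply continuity_1d_2d_pt_comp with (f := fun v => sin (2 * v)) (g := fun u v => u * v).
          { apply continuity_pt_ex_derive; auto_derive; auto. }
          apply continuity_2d_pt_mult; [apply continuity_2d_pt_id1 | apply continuity_2d_pt_id2].
      + exists posreal_one; intros y _; apply ex_RInt_cont, cont_gauss_cos.
    - assert (E : is_RInt (fun t => Derive (fun u => k u t) x + 2 * x * k x t) 0 b
                    (minus (gauss b * sin (2 * x * b)) (gauss 0 * sin (2 * x * 0)))).
      { apply (is_RInt_derive (V := R_CompleteNormedModule) (fun t => gauss t * sin (2 * x * t))).
        - intros t _; rewrite Dk'; unfold k; auto_derive; [auto | ring].
        - intros t _; apply continuous_ext with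
            (fun t => - (2 * t) * (gauss t * sin (2 * x * t)) + 2 * x * k x t).
          { intros u; rewrite Dk'; reflexivity. }
          unfold k; cont_derive. }
      apply (is_RInt_unique (V := R_CompleteNormedModule)) in E.
      assert (Q := RInt_lin2 (fun t => Derive (fun u => k u t) x) (fun t => k x t) 1 (2 * x) 0 b).
      rewrite (RInt_ext _ (fun t => Derive (fun u => k u t) x + 2 * x * k x t)) in Q
        by (intros; Rring).
      rewrite E in Q; unfold minus, plus, opp in Q; simpl in Q.
      replace (2 * x * 0) with 0 in Q by ring; rewrite sin_0 in Q.
      rewrite Rmult_0_r, Ropp_0, Rplus_0_r in Q.
      assert (K : forall u v w : R, u = 1 * v + 2 * x * w -> v = u - 2 * x * w) by (intros; lra).
      apply K, Q.
      + apply ex_RInt_ext with (fun t => - (2 * t) * (gauss t * sin (2 * x * t))).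
        { intros u _; rewrite Dk'; reflexivity. }
        apply ex_RInt_cont; intros s; cont_derive.
      + apply ex_RInt_cont, cont_gauss_cos. }
  assert (D : forall x, is_derive (fun x => exp (x * x) * J x) x (exp (x * x) * (gauss b * sin (2 * x * b)))).
  { intros x.
    assert (A := is_derive_mult (fun x => exp (x * x)) J x _ _
                   ltac:(auto_derive; [auto | reflexivity]) (DJ x) Rmult_comm).
    match type of A with is_derive _ _ ?w =>
      match goal with |- is_derive _ _ ?w' => replace w' with w; [exact A|] end end.
    unfold plus, mult; simpl; ring. }
  destruct (MVT_gen (fun x => exp (x * x) * J x) 0 x0 _ (fun x _ => D x)) as [c [Hc E]].
  { intros x _; apply continuity_pt_ex_derive.
    eexists; apply D. }
  assert (J0 : J 0 = RInt (fun t => gauss t) 0 b).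
  { apply RInt_ext; intros t _; replace (2 * 0 * t) with 0 by ring; rewrite cos_0; Rring. }
  assert (G := gauss_half b Hb); rewrite <- J0 in G.
  replace (0 * 0) with 0 in E by ring; rewrite exp_0 in E.
  assert (Hcc : c * c <= x0 * x0).
  { unfold Rmin, Rmax in Hc; destruct (Rle_dec 0 x0); nra. }
  assert (Hx : gauss x0 * exp (x0 * x0) = 1)
    by (rewrite <- exp_plus, <- exp_0; f_equal; ring).
  change (Rabs (J x0 - sqrt PI / 2 * gauss x0) <= (Rabs x0 + 2) * gauss b).
  replace (J x0 - sqrt PI / 2 * gauss x0)
    with (gauss x0 * (exp (c * c) * (gauss b * sin (2 * c * b)) * (x0 - 0))
          + gauss x0 * (J 0 - sqrt PI / 2)).
  2:{ rewrite <- E.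
      replace (gauss x0 * (exp (x0 * x0) * J x0 - 1 * J 0))
        with ((gauss x0 * exp (x0 * x0)) * J x0 - gauss x0 * J 0) by ring.
      rewrite Hx; ring. }
  assert (P0 := exp_pos (- (x0 * x0))); assert (Pb := exp_pos (- (b * b))).
  assert (Pc := exp_pos (c * c)).
  assert (L1 : gauss x0 <= 1) by (rewrite <- exp_0; apply exp_le_mono; nra).
  assert (L2 : gauss x0 * exp (c * c) <= 1)
    by (rewrite <- exp_plus, <- exp_0; apply exp_le_mono; lra).
  eapply Rle_trans; [apply Rabs_triang|]; rewrite !Rabs_mult, Rminus_0_r.
  rewrite (Rabs_pos_eq (gauss x0)), (Rabs_pos_eq (exp (c * c))), (Rabs_pos_eq (gauss b)) by lra.
  assert (S1 : Rabs (sin (2 * c * b)) <= 1) by (apply Rabs_le, SIN_bound).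
  assert (X := Rabs_pos x0); assert (X' := Rabs_pos (sin (2 * c * b))).
  rewrite Rmult_plus_distr_r; apply Rplus_le_compat.
  - replace (gauss x0 * (exp (c * c) * (gauss b * Rabs (sin (2 * c * b))) * Rabs x0))
      with ((gauss x0 * exp (c * c)) * Rabs (sin (2 * c * b)) * (Rabs x0 * gauss b)) by ring.
    assert (Y : 0 <= Rabs x0 * gauss b) by (apply Rmult_le_pos; lra).
    assert (U : gauss x0 * exp (c * c) * Rabs (sin (2 * c * b)) <= 1).
    { assert (0 < gauss x0 * exp (c * c)) by (apply Rmult_lt_0_compat; assumption). nra. }
    nra.
  - assert (Y := Rabs_pos (J 0 - sqrt PI / 2)); nra.
Qed.

(** * The Faddeeva function as a limit of integrals over [0, b] *)

Definition wker (z : C) (s : R) : C := Cexp (- (RtoC s * RtoC s) + 2 * Ci * z * RtoC s)%C.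

Definition wpart (z : C) (b : R) : C := CInt (wker z) 0 b.

Lemma Ccont_wker : forall z, Ccont (wker z).
Proof.
  intros z; unfold wker; apply Ccont_Cexp, Ccont_plus.
  - apply Ccont_opp, Ccont_mult; apply (Ccont_RtoC (fun s => s)); intros s; apply continuous_id.
  - apply Ccont_mult; [apply Ccont_const|].
    apply (Ccont_RtoC (fun s => s)); intros s; apply continuous_id.
Qed.

Lemma Cmod_wker : forall z s, Cmod (wker z s) = exp (- (s * s) - 2 * Im z * s).
Proof. intros [x y] s; unfold wker; rewrite Cmod_Cexp; f_equal; simpl; ring. Qed.

Lemma Cmod_wker_le : forall z s, 0 <= Im z -> 0 <= s -> Cmod (wker z s) <= gauss s.
Proof. intros z s Hz Hs; rewrite Cmod_wker; apply exp_le_mono; nra. Qed.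

Lemma RInt_exp_opp : forall c b b', RInt (fun s => exp (c - s)) b b' = exp (c - b) - exp (c - b').
Proof.
  intros c b b'; apply is_RInt_unique.
  replace (exp (c - b) - exp (c - b')) with (minus (- exp (c - b')) (- exp (c - b)))
    by (unfold minus, plus, opp; simpl; ring).
  apply (is_RInt_derive (V := R_CompleteNormedModule) (fun s => - exp (c - s))).
  - intros s _; auto_derive; [auto | unfold Rminus; ring].
  - intros s _; cont_derive.
Qed.

(** The quadratic -s^2 + 2|Im z|s stays below c - s, where c depends on Im z only. *)
Lemma wpart_cauchy : forall z b b', b <= b' ->
  Cmod (wpart z b' - wpart z b) <= exp ((1 + 2 * Rabs (Im z)) ^ 2 / 4 - b).
Proof.
  intros z b b' Hb; unfold wpart.
  rewrite <- (CInt_Chasles (wker z) 0 b b' (Ccont_wker z)).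
  replace (CInt (wker z) 0 b + CInt (wker z) b b' - CInt (wker z) 0 b)%C
    with (CInt (wker z) b b') by ring.
  set (c := (1 + 2 * Rabs (Im z)) ^ 2 / 4).
  apply Rle_trans with (RInt (fun s => exp (c - s)) b b').
  - apply Cmod_CInt_le; [exact Hb | apply Ccont_wker | |].
    + intros s; cont_derive.
    + intros s _; rewrite Cmod_wker; apply exp_le_mono; unfold c.
      assert (H1 : - (2 * Im z * s) <= 2 * Rabs (Im z) * Rabs s).
      { eapply Rle_trans; [apply Rle_abs|]; rewrite Rabs_Ropp, !Rabs_mult, (Rabs_pos_eq 2) by lra; lra. }
      assert (H2 := Rle_abs s); assert (H3 : s * s = Rabs s * Rabs s)
        by (rewrite <- Rabs_mult, Rabs_pos_eq; [reflexivity | nra]).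
      assert (H4 := pow2_ge_0 ((1 + 2 * Rabs (Im z)) / 2 - Rabs s)); nra.
  - rewrite RInt_exp_opp; assert (P := exp_pos (c - b')); lra.
Qed.

Lemma wpart_ex_lim : forall z, exists l, Clim (wpart z) l.
Proof.
  intros z.
  set (c := (1 + 2 * Rabs (Im z)) ^ 2 / 4).
  destruct (proj1 (filterlim_locally_cauchy (U := C_R_CompleteNormedModule)
                     (F := Rbar_locally p_infty) (wpart z))) as [l Hl].
  - intros eps.
    destruct (exp_small (exp c) (eps / 2)) as [B HB].
    { destruct eps as [e He]; simpl; lra. }
    exists (fun b => B < b); split; [exists B; auto|].
    assert (S : forall u v, B < u -> B < v -> u <= v -> Cmod (wpart z v - wpart z u) < eps).
    { intros u v Hu Hv Huv; eapply Rle_lt_trans; [apply wpart_cauchy, Huv|]; fold c.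
      unfold Rminus; rewrite exp_plus.
      eapply Rle_lt_trans; [apply HB; lra|]; destruct eps as [e He]; simpl; lra. }
    intros u v Hu Hv; apply (C_NormedModule_mixin_compat1 (wpart z u)).
    destruct (Rle_lt_dec u v) as [Huv|Huv].
    + apply S; assumption.
    + change (Cmod (wpart z v - wpart z u) < eps).
      rewrite <- Cmod_opp.
      replace (- (wpart z v - wpart z u))%C with (wpart z u - wpart z v)%C by ring.
      apply S; lra.
  - exists l; intros eta He.
    assert (Hp : 0 < eta / sqrt 2) by (apply Rdiv_lt_0_compat; [lra | apply sqrt_lt_R0; lra]).
    destruct (Hl (fun y => ball l (mkposreal _ Hp) y)) as [B HB].
    { exists (mkposreal _ Hp); auto. }
    exists (B + 1); intros b Hb; left.
    assert (A := C_NormedModule_mixin_compat2 l (wpart z b) (mkposreal _ Hp) (HB b ltac:(lra))).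
    replace eta with (sqrt 2 * (mkposreal _ Hp)); [exact A|].
    simpl; field; assert (0 < sqrt 2) by (apply sqrt_lt_R0; lra); lra.
Qed.

(** The Gaussian factor of the definition of w completes the square, which turns the
    integrand of erfc into exp(-s^2 + 2isz). *)
Lemma wpart_lim : forall z, Clim (wpart z) (sqrt PI / 2 * faddeeva z)%C.
Proof.
  intros z; destruct (wpart_ex_lim z) as [l Hl].
  assert (S1 := sqrt_PI_gt_1).
  replace (sqrt PI / 2 * faddeeva z)%C with l; [exact Hl|].
  set (f := fun s : R => Cexp (- (- (Ci * z) + RtoC s) ^ 2)%C).
  assert (Hf : forall s, f s = (Cexp (z ^ 2) * wker z s)%C).
  { intros s; unfold f, wker; rewrite <- Cexp_plus; f_equal.
    destruct z as [x y]; apply injective_projections; simpl; ring. }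
  assert (Cf : Ccont f).
  { assert (A : Ccont (fun s => Cexp (z ^ 2) * wker z s)%C)
      by (apply Ccont_mult; [apply Ccont_const | apply Ccont_wker]).
    intros s; destruct (A s) as [A1 A2].
    split; [eapply continuous_ext; [|exact A1] | eapply continuous_ext; [|exact A2]];
      intros t; rewrite Hf; reflexivity. }
  assert (L : Clim (CInt f 0) (Cexp (z ^ 2) * l)%C).
  { apply Clim_ext with (fun b => Cexp (z ^ 2) * wpart z b)%C; [|apply Clim_scal, Hl].
    intros b; unfold wpart; rewrite <- (CInt_scal _ _ 0 b (Ccont_wker z)).
    apply CInt_ext; intros s; symmetry; apply Hf. }
  assert (G : RInt_gen (V := C_R_CompleteNormedModule) f (at_point 0) (Rbar_locally p_infty)
              = (Cexp (z ^ 2) * l)%C).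
  { apply (is_RInt_gen_unique (V := C_R_CompleteNormedModule)).
    intros P [eps HP].
    destruct (L (eps / 2)) as [B HB].
    { destruct eps as [e He]; simpl; lra. }
    apply (Filter_prod _ _ _ (fun a => a = 0) (fun b => B < b)).
    - reflexivity.
    - exists B; auto.
    - intros a b Ha Hb; simpl; rewrite Ha; exists (CInt f 0 b).
      split; [apply is_RInt_CInt, Cf|].
      apply HP, (C_NormedModule_mixin_compat1 (Cexp (z ^ 2) * l)%C).
      change (Cmod (CInt f 0 b - Cexp (z ^ 2) * l) < eps).
      eapply Rle_lt_trans; [apply HB; lra|]; destruct eps as [e He]; simpl; lra. }
  unfold faddeeva, erfc; fold f; rewrite G.
  assert (E := Cexp_opp_l (z ^ 2)).
  assert (E2 : (sqrt PI / 2 * RtoC (2 / sqrt PI))%C = 1%C).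
  { rewrite RtoC_div by lra; field; repeat split; apply RtoC_neq_0; lra. }
  transitivity ((sqrt PI / 2 * RtoC (2 / sqrt PI)) * (Cexp (- z ^ 2) * Cexp (z ^ 2)) * l)%C.
  - rewrite E, E2; ring.
  - ring.
Qed.

Lemma faddeeva_lim : forall z, Clim (fun b => RtoC (2 / sqrt PI) * wpart z b)%C (faddeeva z).
Proof.
  intros z.
  replace (faddeeva z) with (RtoC (2 / sqrt PI) * (sqrt PI / 2 * faddeeva z))%C.
  - apply Clim_scal, wpart_lim.
  - assert (S1 := sqrt_PI_gt_1); rewrite RtoC_div by lra; field; repeat split; apply RtoC_neq_0; lra.
Qed.

Lemma wpart_opp : forall z b, wpart (- z) b = (- wpart z (- b))%C.
Proof.
  intros z b; unfold wpart.
  rewrite (CInt_ext _ (fun s => wker z (- s))).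
  - rewrite (CInt_reflect _ _ _ (Ccont_wker z)), Ropp_0; reflexivity.
  - intros s; unfold wker; f_equal; rewrite RtoC_opp; ring.
Qed.

Lemma CInt_RtoC : forall (f : R -> R) a b, CInt (fun s => RtoC (f s)) a b = RtoC (RInt f a b).
Proof.
  intros f a b; unfold CInt; apply injective_projections; simpl; [reflexivity|].
  rewrite RInt_cst; ring.
Qed.

Lemma faddeeva_reflect_real : forall x : R,
  (faddeeva (RtoC x) + faddeeva (- RtoC x) = 2 * Cexp (- (RtoC x) ^ 2))%C.
Proof.
  intros x; assert (S1 := sqrt_PI_gt_1).
  apply Clim_unique with (fun b => RtoC (2 / sqrt PI) * (wpart x b + wpart (- RtoC x) b))%C.
  - eapply Clim_ext; [|apply Clim_plus; apply faddeeva_lim].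
    intros b; simpl; ring.
  - replace (2 * Cexp (- RtoC x ^ 2))%C
      with (RtoC (2 / sqrt PI) * RtoC (2 * (sqrt PI / 2 * gauss x)))%C.
    2:{ replace (- RtoC x ^ 2)%C with (RtoC (- (x * x)))
          by (apply injective_projections; simpl; ring).
        rewrite Cexp_RtoC, <- RtoC_mult.
        replace (2 / sqrt PI * (2 * (sqrt PI / 2 * gauss x))) with (2 * gauss x)
          by (field; lra).
        apply RtoC_mult. }
    apply Clim_scal.
    apply Clim_ext with (fun b => RtoC (2 * RInt (fun t => gauss t * cos (2 * x * t)) 0 b)).
    { intros b; unfold wpart; rewrite <- CInt_plus by apply Ccont_wker.
      rewrite (CInt_ext _ (fun s => RtoC 2 * RtoC (gauss s * cos (2 * x * s)))%C).
      - rewrite CInt_scal, CInt_RtoC, RtoC_mult; [reflexivity|].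
        apply (Ccont_RtoC (fun s => gauss s * cos (2 * x * s))); apply cont_gauss_cos.
      - intros s; unfold wker, Cexp; apply injective_projections; simpl.
        + replace (- (s * s - 0 * 0) + ((2 * 0 - 0 * 1) * x - (2 * 1 + 0 * 0) * 0) * s) with (- (s * s)) by ring.
          match goal with |- exp ?a * cos ?b + exp ?c * cos ?d = _ =>
            replace a with (- (s * s)) by ring; replace b with (2 * x * s) by ring;
            replace c with (- (s * s)) by ring; replace d with (- (2 * x * s)) by ring end.
          rewrite cos_neg; ring.
        + match goal with |- exp ?a * sin ?b + exp ?c * sin ?d = _ =>
            replace a with (- (s * s)) by ring; replace b with (2 * x * s) by ring;
            replace c with (- (s * s)) by ring; replace d with (- (2 * x * s)) by ring end.
          rewrite sin_neg; ring. }
    intros eta He.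
    destruct (gauss_small (2 * (Rabs x + 2)) eta He) as [B HB].
    exists (Rmax 0 B); intros b Hb.
    assert (L1 := Rmax_l 0 B); assert (L2 := Rmax_r 0 B).
    rewrite <- RtoC_minus, Cmod_R, <- Rmult_minus_distr_l, Rabs_mult, (Rabs_pos_eq 2) by lra.
    assert (G := gauss_cos_half x b ltac:(lra)); assert (H := HB b ltac:(lra)); lra.
Qed.

(** With z = x + iy, the substitution of s + y for s turns exp(-s^2 + 2isz) into a constant times
    exp(-s^2 + 2isx). This reduces the formula to real z, where the two half-line integrals add
    up to the Fourier transform of the Gaussian. *)
Lemma faddeeva_reflect : forall z, (faddeeva z + faddeeva (- z) = 2 * Cexp (- z ^ 2))%C.
Proof.
  intros [x y].
  set (kappa := Cexp (RtoC (y * y) + - (2 * Ci * RtoC (x * y)))%C).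
  assert (K : forall u v s : R, (u * v = x * y)%R -> (v * v = y * y)%R ->
             wker (u, v) s = (kappa * wker (RtoC u) (s + v))%C).
  { intros u v s H1 H2; unfold wker, kappa; rewrite <- Cexp_plus, <- H1, <- H2; f_equal.
    apply injective_projections; simpl; ring. }
  assert (I : forall u v b : R, (u * v = x * y)%R -> (v * v = y * y)%R ->
             wpart (u, v) b = (kappa * (wpart (RtoC u) (b + v) - wpart (RtoC u) v))%C).
  { intros u v b H1 H2; unfold wpart.
    rewrite (CInt_ext _ _ 0 b (fun s => K u v s H1 H2)).
    rewrite (CInt_scal kappa (fun s => wker (RtoC u) (s + v))).
    - rewrite (CInt_shift _ v 0 b (Ccont_wker _)), Rplus_0_l.
      rewrite <- (CInt_Chasles (wker (RtoC u)) 0 v (b + v) (Ccont_wker _)); ring.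
    - intros s; destruct (Ccont_comp_lin (wker (RtoC u)) 1 v (Ccont_wker _) s) as [A1 A2].
      split; [eapply continuous_ext; [|exact A1] | eapply continuous_ext; [|exact A2]];
        intros t; simpl; rewrite Rmult_1_l; reflexivity. }
  apply Clim_unique with (fun b => RtoC (2 / sqrt PI) * (wpart (x, y) b + wpart (- (x, y))%C b))%C.
  - eapply Clim_ext; [|apply Clim_plus; apply faddeeva_lim].
    intros b; simpl; ring.
  - apply Clim_ext with (fun b => kappa * (RtoC (2 / sqrt PI) * wpart (RtoC x) (b + y)
                            + RtoC (2 / sqrt PI) * wpart (- RtoC x) (b + - y)))%C.
    + intros b; rewrite (I x y b eq_refl eq_refl).
      replace (- (x, y))%C with ((- x)%R, (- y)%R) by reflexivity.
      rewrite (I (- x) (- y) b) by ring.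
      replace (RtoC (- x)) with (- RtoC x)%C by (rewrite RtoC_opp; reflexivity).
      rewrite (wpart_opp (RtoC x) (- y)), Ropp_involutive; ring.
    + replace (2 * Cexp (- (x, y) ^ 2))%C
        with (kappa * (faddeeva (RtoC x) + faddeeva (- RtoC x)))%C.
      * apply Clim_scal, Clim_plus.
        -- apply (Clim_shift (fun b => RtoC (2 / sqrt PI) * wpart (RtoC x) b)%C), faddeeva_lim.
        -- apply (Clim_shift (fun b => RtoC (2 / sqrt PI) * wpart (- RtoC x) b)%C), faddeeva_lim.
      * rewrite faddeeva_reflect_real; unfold kappa.
        transitivity (2 * (Cexp (RtoC (y * y) + - (2 * Ci * RtoC (x * y))) * Cexp (- RtoC x ^ 2)))%C; [ring|].
        rewrite <- Cexp_plus; do 2 f_equal.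
        apply injective_projections; simpl; ring.
Qed.

Lemma faddeeva_conj : forall z, faddeeva (- Cconj z) = Cconj (faddeeva z).
Proof.
  intros z; apply Clim_unique with (fun b => RtoC (2 / sqrt PI) * wpart (- Cconj z) b)%C;
    [apply faddeeva_lim|].
  intros eta He; destruct (faddeeva_lim z eta He) as [B HB]; exists B; intros b Hb.
  rewrite <- (Cmod_conj).
  replace (Cconj (RtoC (2 / sqrt PI) * wpart (- Cconj z) b - Cconj (faddeeva z)))%C
    with (RtoC (2 / sqrt PI) * wpart z b - faddeeva z)%C; [apply HB, Hb|].
  assert (E : wpart (- Cconj z) b = Cconj (wpart z b)).
  { unfold wpart, CInt.
    assert (K : forall s, wker (- Cconj z) s = Cconj (wker z s)).
    { intros s; unfold wker; rewrite <- Cexp_conj; f_equal.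
      destruct z as [x y]; apply injective_projections; simpl; ring. }
    apply injective_projections.
    - change (RInt (fun s => fst (wker (- Cconj z) s)) 0 b = RInt (fun s => fst (wker z s)) 0 b).
      apply RInt_ext; intros s _; rewrite K; reflexivity.
    - change (RInt (fun s => snd (wker (- Cconj z) s)) 0 b = - RInt (fun s => snd (wker z s)) 0 b).
      rewrite (RInt_ext _ (fun s => 0 * fst (wker z s) + (-1) * snd (wker z s)))
        by (intros s _; rewrite K; Rring).
      destruct (Ccont_ex (wker z) 0 b (Ccont_wker z)).
      rewrite RInt_lin2 by assumption.
      assert (Q : forall u v : R, 0 * u + (-1) * v = - v) by (intros; ring); apply Q. }
  rewrite E; destruct (faddeeva z), (wpart z b); apply injective_projections; simpl; ring.
Qed.

(** * Bounds for the Faddeeva function in the closed upper half-plane *)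

Lemma gauss_half_le : forall b, 0 <= b -> RInt (fun t => gauss t) 0 b <= sqrt PI / 2.
Proof.
  intros b Hb; assert (E := gauss_square b).
  assert (HK : 0 <= RInt (fun t => exp (- (b * b) * (1 + t * t)) / (1 + t * t)) 0 1).
  { apply RInt_ge_0; [lra | |].
    - apply ex_RInt_cont; intros s; apply (ex_derive_continuous (V := R_NormedModule)); auto_derive; nra.
    - intros t _; apply Rlt_le, Rdiv_lt_0_compat; [apply exp_pos | nra]. }
  assert (S1 := sqrt_PI_gt_1); assert (S2 := sqrt_PI_sqr).
  apply Rnot_lt_le; intros H; nra.
Qed.

Lemma cont_lin_gauss : forall c d s, continuous (fun t : R => (c * t + d) * gauss t) s.
Proof. intros c d s; cont_derive. Qed.

Lemma RInt_gauss_deriv : forall b, RInt (fun t => (2 * t + 0) * gauss t) 0 b = 1 - gauss b.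
Proof.
  intros b; apply is_RInt_unique.
  replace (1 - gauss b) with (minus (- gauss b) (- gauss 0)).
  - apply (is_RInt_derive (V := R_CompleteNormedModule) (fun t => - gauss t)).
    + intros t _; auto_derive; [auto | ring].
    + intros t _; apply cont_lin_gauss.
  - unfold minus, plus, opp; simpl; rewrite Rmult_0_l, Ropp_0, exp_0; ring.
Qed.

Lemma faddeeva_le_1 : forall z, 0 <= Im z -> Cmod (faddeeva z) <= 1.
Proof.
  intros z Hz; assert (S1 := sqrt_PI_gt_1).
  apply (Clim_Cmod_le _ _ 1 0 (faddeeva_lim z)); intros b Hb.
  rewrite Cmod_mult, Cmod_R, Rabs_pos_eq by (apply Rlt_le, Rdiv_lt_0_compat; lra).
  assert (H : Cmod (wpart z b) <= sqrt PI / 2).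
  { eapply Rle_trans; [|exact (gauss_half_le b Hb)].
    apply Cmod_CInt_le; [exact Hb | apply Ccont_wker | apply cont_gauss |].
    intros s Hs; apply Cmod_wker_le; lra. }
  apply Rmult_le_reg_l with (sqrt PI / 2); [lra|].
  replace (sqrt PI / 2 * (2 / sqrt PI * Cmod (wpart z b))) with (Cmod (wpart z b)) by (field; lra).
  lra.
Qed.

(** Integration by parts against the derivative of exp(-s^2 + 2isz). *)
Lemma wpart_by_parts : forall z b,
  (2 * Ci * z * wpart z b = wker z b - 1 + CInt (fun s => RtoC (2 * s + 0) * wker z s) 0 b)%C.
Proof.
  intros z b.
  assert (C1 : Ccont (fun s => RtoC (2 * s + 0) * wker z s)%C).
  { apply Ccont_mult; [|apply Ccont_wker].
    apply (Ccont_RtoC (fun s => 2 * s + 0)); intros s.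
    cont_derive. }
  assert (C2 : Ccont (fun s => 2 * Ci * z * wker z s)%C)
    by (apply Ccont_mult; [apply Ccont_const | apply Ccont_wker]).
  assert (E : CInt (fun s => 2 * Ci * z * wker z s - RtoC (2 * s + 0) * wker z s)%C 0 b
              = (wker z b - wker z 0)%C).
  { rewrite (CInt_ext _ (fun s => (2 * Ci * z + - RtoC (2 * s)) *
        Cexp (- (RtoC s * RtoC s) + 2 * Ci * z * RtoC s))%C)
      by (intros s; unfold wker; rewrite Rplus_0_r; ring).
    apply (CInt_Cexp_derive (fun s => - (RtoC s * RtoC s) + 2 * Ci * z * RtoC s)%C
             (fun s => 2 * Ci * z + - RtoC (2 * s))%C).
    - intros s; simpl; auto_derive; [auto | ring].
    - intros s; simpl; auto_derive; [auto | ring].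
    - apply Ccont_plus; [apply Ccont_const | apply Ccont_opp].
      apply (Ccont_RtoC (fun s => 2 * s)); intros s.
      cont_derive. }
  rewrite (CInt_minus _ _ 0 b C2 C1), (CInt_scal _ _ 0 b (Ccont_wker z)) in E.
  assert (E0 : wker z 0 = 1%C).
  { unfold wker; rewrite <- Cexp_0; f_equal; ring. }
  rewrite E0 in E; fold (wpart z b) in E; rewrite <- E; ring.
Qed.

Lemma Cmod_wker_moment_le : forall z b, 0 <= Im z -> 0 <= b ->
  Cmod (CInt (fun s => RtoC (2 * s + 0) * wker z s)%C 0 b) <= 1 - gauss b.
Proof.
  intros z b Hz Hb; rewrite <- RInt_gauss_deriv.
  apply Cmod_CInt_le; [exact Hb | | apply cont_lin_gauss |].
  - apply Ccont_mult; [|apply Ccont_wker].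
    apply (Ccont_RtoC (fun s => 2 * s + 0)); intros s.
    cont_derive.
  - intros s Hs; rewrite Cmod_mult, Cmod_R, Rabs_pos_eq by lra.
    apply Rmult_le_compat_l; [lra | apply Cmod_wker_le; lra].
Qed.

(** Twice iz times the integral is the sum of a boundary term and of an integral dominated by the
    total variation of exp(-s^2); each of the two is at most 1 in the limit. *)
Lemma faddeeva_decay : forall z, 0 <= Im z -> Cmod z * Cmod (faddeeva z) <= 2 / sqrt PI.
Proof.
  intros z Hz; assert (S1 := sqrt_PI_gt_1).
  rewrite <- Cmod_mult.
  apply (Clim_Cmod_le _ _ _ 0 (Clim_scal z _ _ (faddeeva_lim z))); intros b Hb.
  replace (z * (RtoC (2 / sqrt PI) * wpart z b))%C
    with (RtoC (1 / sqrt PI) * - Ci * (2 * Ci * z * wpart z b))%C.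
  2:{ rewrite !RtoC_div by lra.
      replace (1 / sqrt PI * - Ci * (2 * Ci * z * wpart z b))%C
        with (- (Ci * Ci) * (1 / sqrt PI * (2 * z * wpart z b)))%C by ring.
      replace (Ci * Ci)%C with (- (1))%C by (apply injective_projections; simpl; ring).
      field; apply RtoC_neq_0; lra. }
  rewrite wpart_by_parts, !Cmod_mult, Cmod_R, Rabs_pos_eq by (apply Rlt_le, Rdiv_lt_0_compat; lra).
  rewrite Cmod_opp, Cmod_Ci.
  replace (2 / sqrt PI) with (1 / sqrt PI * 1 * 2) by (field; lra).
  apply Rmult_le_compat_l; [apply Rmult_le_pos; [apply Rlt_le, Rdiv_lt_0_compat; lra | lra]|].
  eapply Rle_trans; [apply Cmod_triangle|].
  assert (A := Cmod_wker_moment_le z b Hz Hb).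
  assert (B : Cmod (wker z b - 1) <= gauss b + 1).
  { unfold Cminus; eapply Rle_trans; [apply Cmod_triangle|].
    rewrite Cmod_opp, Cmod_1; assert (H := Cmod_wker_le z b Hz Hb); lra. }
  lra.
Qed.

(** By parts, (1 - i sqrt(pi) z) w(z) - 1 is the integral of (2a - 2s) exp(-s^2 + 2isz) with
    a = 1/sqrt(pi). For this a the weight (2a - 2s) exp(-s^2) has total integral 0, so its
    absolute integral is twice that of its positive part, which is at most the integral of
    2a - 2s over [0, a], that is, a^2 = 1/pi. *)
Lemma faddeeva_near_inverse : forall z, 0 <= Im z ->
  Cmod ((1 - Ci * sqrt PI * z) * faddeeva z - 1) <= 2 / PI.
Proof.
  intros z Hz; assert (S1 := sqrt_PI_gt_1); assert (S2 := sqrt_PI_sqr).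
  set (a := / sqrt PI).
  assert (Ha : 0 < a <= 1).
  { unfold a; split; [apply Rinv_0_lt_compat; lra|].
    rewrite <- Rinv_1; apply Rinv_le_contravar; lra. }
  assert (Haa : a * a = / PI) by (unfold a; rewrite <- Rinv_mult, S2; reflexivity).
  apply le_epsilon; intros eta He.
  destruct (gauss_small 5 eta He) as [B HB].
  assert (L := Clim_minus _ _ _ _ (Clim_scal (1 - Ci * sqrt PI * z)%C _ _ (faddeeva_lim z)) (Clim_const 1%C)).
  apply (Clim_Cmod_le _ _ _ (Rmax 1 B) L); intros b Hb.
  assert (L1 := Rmax_l 1 B); assert (L2 := Rmax_r 1 B).
  assert (Cm : forall c d, Ccont (fun s => RtoC (c * s + d) * wker z s)%C).
  { intros c d; apply Ccont_mult; [|apply Ccont_wker].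
    apply (Ccont_RtoC (fun s => c * s + d)); intros s.
    cont_derive. }
  set (I := fun u v => CInt (fun s => RtoC (-2 * s + 2 * a) * wker z s)%C u v).
  assert (E : ((1 - Ci * sqrt PI * z) * (RtoC (2 / sqrt PI) * wpart z b) - 1 = I 0 a + I a b - wker z b)%C).
  { unfold I; rewrite CInt_Chasles by apply Cm.
    rewrite (CInt_ext _ (fun s => RtoC (2 * a) * wker z s - RtoC (2 * s + 0) * wker z s)%C)
      by (intros s; rewrite !RtoC_plus, !RtoC_mult; replace (RtoC (-2)) with (- (2))%C
            by (apply injective_projections; simpl; ring); ring).
    rewrite (CInt_minus (fun s => RtoC (2 * a) * wker z s)%C (fun s => RtoC (2 * s + 0) * wker z s)%C);
      [| apply (Ccont_mult (fun _ => RtoC (2 * a)) (wker z)); [apply Ccont_const | apply Ccont_wker]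
       | exact (Cm 2 0)].
    rewrite (CInt_scal (RtoC (2 * a)) (wker z) 0 b (Ccont_wker z)).
    fold (wpart z b).
    assert (P := wpart_by_parts z b).
    replace (CInt (fun s : R => RtoC (2 * s + 0) * wker z s) 0 b)%C
      with (2 * Ci * z * wpart z b - wker z b + 1)%C by (rewrite P; ring).
    unfold a; rewrite RtoC_mult, RtoC_inv, RtoC_div by lra; field; apply RtoC_neq_0; lra. }
  rewrite E.
  assert (W : forall c d s, continuous (fun t => (c * t + d) * gauss t) s) by (intros; apply cont_lin_gauss).
  assert (B1 : Cmod (I 0 a) <= RInt (fun t => (-2 * t + 2 * a) * gauss t) 0 a).
  { apply Cmod_CInt_le; [lra | apply Cm | apply W |].
    intros s Hs; rewrite Cmod_mult, Cmod_R, Rabs_pos_eq by lra.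
    apply Rmult_le_compat_l; [lra | apply Cmod_wker_le; lra]. }
  assert (B2 : Cmod (I a b) <= RInt (fun t => (2 * t + - (2 * a)) * gauss t) a b).
  { apply Cmod_CInt_le; [lra | apply Cm | apply W |].
    intros s Hs; rewrite Cmod_mult, Cmod_R, Rabs_left1 by lra.
    replace (2 * s + - (2 * a)) with (- (-2 * s + 2 * a)) by ring.
    apply Rmult_le_compat_l; [lra | apply Cmod_wker_le; lra]. }
  set (N1 := RInt (fun t => (-2 * t + 2 * a) * gauss t) 0 a) in *.
  assert (B3 : N1 <= a * a).
  { replace (a * a) with (RInt (fun t => -2 * t + 2 * a) 0 a).
    - apply RInt_le; [lra | apply ex_RInt_cont, W | |].
      + apply ex_RInt_cont; intros s; cont_derive.
      + intros t Ht; rewrite <- (Rmult_1_r (-2 * t + 2 * a)) at 2.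
        apply Rmult_le_compat_l; [lra|]; rewrite <- exp_0; apply exp_le_mono; nra.
    - apply is_RInt_unique.
      replace (a * a) with (minus (- (a * a) + 2 * a * a) (- (0 * 0) + 2 * a * 0))
        by (unfold minus, plus, opp; simpl; ring).
      apply (is_RInt_derive (V := R_CompleteNormedModule) (fun t => - (t * t) + 2 * a * t)).
      + intros t _; auto_derive; [auto | ring].
      + intros t _; cont_derive. }
  assert (B4 : RInt (fun t => (2 * t + - (2 * a)) * gauss t) a b <= N1 + 4 * gauss b).
  { assert (Q1 : RInt (fun t => (2 * t + - (2 * a)) * gauss t) 0 a = - N1).
    { replace (- N1) with (-1 * N1 + 0 * N1) by ring; unfold N1.
      rewrite <- RInt_lin2 by apply ex_RInt_cont, W.
      apply RInt_ext; intros t _; Rring. }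
    assert (Q2 : RInt (fun t => (2 * t + - (2 * a)) * gauss t) 0 b
                 = 1 - gauss b - 2 * a * RInt (fun t => gauss t) 0 b).
    { rewrite <- RInt_gauss_deriv.
      replace (RInt (fun t => (2 * t + 0) * gauss t) 0 b - 2 * a * RInt (fun t => gauss t) 0 b)
        with (1 * RInt (fun t => (2 * t + 0) * gauss t) 0 b
              + (- (2 * a)) * RInt (fun t => gauss t) 0 b) by ring.
      rewrite <- RInt_lin2; [apply RInt_ext; intros t _; Rring | apply ex_RInt_cont, W | apply ex_RInt_cont, cont_gauss]. }
    assert (Q3 := RInt_Chasles (V := R_CompleteNormedModule) (fun t => (2 * t + - (2 * a)) * gauss t) 0 a b
              (ex_RInt_cont _ _ _ (W _ _)) (ex_RInt_cont _ _ _ (W _ _))).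
    rewrite Q2 in Q3; unfold plus in Q3; simpl in Q3; rewrite Q1 in Q3.
    assert (G := gauss_half b ltac:(lra)); apply Rabs_le_between in G.
    assert (Hs : a * sqrt PI = 1) by (unfold a; field; lra).
    assert (Pb := exp_pos (- (b * b))).
    set (G0 := RInt (fun t => gauss t) 0 b) in *.
    assert (a * G0 >= a * (sqrt PI / 2 - 2 * gauss b)) by (apply Rle_ge, Rmult_le_compat_l; lra).
    nra. }
  assert (T1 := Cmod_triangle (I 0 a + I a b) (- wker z b)).
  assert (T2 := Cmod_triangle (I 0 a) (I a b)).
  rewrite Cmod_opp in T1.
  assert (A := Cmod_wker_le z b Hz ltac:(lra)).
  assert (A' := HB b ltac:(lra)).
  unfold Rdiv; rewrite <- Haa; unfold Cminus at 1; lra.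
Qed.

Lemma PI_gt_3 : 3 < PI.
Proof. assert (H := PI2_3_2); lra. Qed.

Lemma faddeeva_lower_bound : forall z, 0 <= Im z ->
  1 - 2 / PI <= (1 + sqrt PI * Cmod z) * Cmod (faddeeva z).
Proof.
  intros z Hz; assert (S1 := sqrt_PI_gt_1).
  assert (H := faddeeva_near_inverse z Hz).
  assert (T := Cmod_triangle ((1 - Ci * sqrt PI * z) * faddeeva z) (- ((1 - Ci * sqrt PI * z) * faddeeva z - 1))).
  replace ((1 - Ci * sqrt PI * z) * faddeeva z + - ((1 - Ci * sqrt PI * z) * faddeeva z - 1))%C
    with (RtoC 1) in T by ring.
  rewrite Cmod_1, Cmod_opp, Cmod_mult in T.
  assert (D : Cmod (1 - Ci * sqrt PI * z) <= 1 + sqrt PI * Cmod z).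
  { unfold Cminus; eapply Rle_trans; [apply Cmod_triangle|].
    rewrite Cmod_1, Cmod_opp, !Cmod_mult, Cmod_Ci, Cmod_R, Rabs_pos_eq by lra; lra. }
  assert (P := Cmod_ge_0 (faddeeva z)).
  assert (Cmod (1 - Ci * sqrt PI * z) * Cmod (faddeeva z) <= (1 + sqrt PI * Cmod z) * Cmod (faddeeva z))
    by (apply Rmult_le_compat_r; assumption).
  lra.
Qed.

(** * Poisson summation for the Gaussian *)

Lemma period_pos : forall h H, 0 < h -> h * H = PI -> 0 < H.
Proof. intros h H Hh HH; assert (P := PI_RGT_0); apply Rnot_le_lt; intros; nra. Qed.

Lemma sum1_0 : forall (a : nat -> R), sum_n_m a 1 0 = 0.
Proof. intros a; rewrite sum_n_m_zero by lia; reflexivity. Qed.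

Lemma sum1_S : forall (a : nat -> R) n, sum_n_m a 1 (S n) = sum_n_m a 1 n + a (S n).
Proof. intros a n; rewrite sum_n_Sm by lia; reflexivity. Qed.

(** The geometric bound is telescoping: C exp(-nc) is the difference of two consecutive terms
    of the bound. *)
Lemma sum1_exp_tail : forall (a : nat -> R) C c, 0 < c ->
  (forall n, (1 <= n)%nat -> Rabs (a n) <= C * exp (- (INR n * c))) ->
  forall M d, Rabs (sum_n_m a 1 (M + d) - sum_n_m a 1 M)
    <= C / (exp c - 1) * (exp (- (INR M * c)) - exp (- (INR (M + d) * c))).
Proof.
  intros a C c Hc Ha M d.
  assert (E1 : 1 < exp c) by (rewrite <- exp_0; apply exp_increasing; exact Hc).
  induction d as [|d IH].
  - rewrite Nat.add_0_r, !Rminus_diag, Rabs_R0; lra.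
  - replace (M + S d)%nat with (S (M + d)) by lia; rewrite sum1_S.
    replace (sum_n_m a 1 (M + d) + a (S (M + d)) - sum_n_m a 1 M)
      with ((sum_n_m a 1 (M + d) - sum_n_m a 1 M) + a (S (M + d))) by ring.
    eapply Rle_trans; [apply Rabs_triang|].
    assert (A := Ha (S (M + d)) ltac:(lia)).
    assert (E : exp (- (INR (M + d) * c)) = exp c * exp (- (INR (S (M + d)) * c))).
    { rewrite <- exp_plus, S_INR; f_equal; ring. }
    apply Rle_trans with (C / (exp c - 1) * (exp (- (INR M * c)) - exp (- (INR (M + d) * c)))
                          + C * exp (- (INR (S (M + d)) * c))); [lra|].
    rewrite E; right; field; lra.
Qed.

Lemma gauss_le_exp : forall t, gauss t <= exp 1 * exp (- Rabs t).
Proof.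
  intros t; rewrite <- exp_plus; apply exp_le_mono.
  assert (H : t * t = Rabs t * Rabs t) by (rewrite <- Rabs_mult, Rabs_pos_eq; [reflexivity | nra]).
  rewrite H; assert (Q := pow2_ge_0 (Rabs t - 1 / 2)); nra.
Qed.

Definition gauss_sum (H u : R) (M : nat) : R :=
  gauss u +
  sum_n_m (fun n => gauss (u + INR n * H)
                  + gauss (u - INR n * H)) 1 M.

Definition cos_sum (h u : R) (K : nat) : R :=
  1 + 2 * sum_n_m (fun k => gauss (INR k * h) * cos (2 * u * (INR k * h))) 1 K.

Definition dirichlet (t : R) (m : nat) : R := 1 + 2 * sum_n_m (fun k => cos (2 * INR k * t)) 1 m.

(** K times the Fejer kernel. *)
Fixpoint fejer (t : R) (K : nat) : R :=
  match K with O => 0 | S m => fejer t m + dirichlet t m end.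

Lemma dirichlet_S : forall t m, dirichlet t (S m) = dirichlet t m + 2 * cos (2 * INR (S m) * t).
Proof. intros t m; unfold dirichlet; rewrite sum1_S; ring. Qed.

Lemma dirichlet_sin : forall t m, sin t * dirichlet t m = sin ((2 * INR m + 1) * t).
Proof.
  intros t m; induction m as [|m IH].
  - unfold dirichlet; rewrite sum1_0; simpl; rewrite Rmult_0_r, Rplus_0_r, Rplus_0_l, Rmult_1_l; ring.
  - rewrite dirichlet_S, Rmult_plus_distr_l, IH, S_INR.
    replace ((2 * INR m + 1) * t) with (2 * (INR m + 1) * t - t) by ring.
    replace ((2 * (INR m + 1) + 1) * t) with (2 * (INR m + 1) * t + t) by ring.
    rewrite sin_minus, sin_plus; ring.
Qed.

(** The squares of sin(Kt) telescope, since sin^2((m+1)t) - sin^2(mt) = sin(t) sin((2m+1)t). *)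
Lemma fejer_sin : forall t K, sin t * sin t * fejer t K = sin (INR K * t) * sin (INR K * t).
Proof.
  intros t K; induction K as [|K IH].
  - simpl; rewrite Rmult_0_l, sin_0; ring.
  - cbn [fejer]; rewrite Rmult_plus_distr_l, IH, Rmult_assoc, dirichlet_sin, S_INR.
    set (A := INR K * t); set (X := (INR K + 1) * t).
    replace ((2 * INR K + 1) * t) with (X + A) by (unfold X, A; ring).
    replace (sin t) with (sin (X - A)) by (f_equal; unfold X, A; ring).
    rewrite sin_minus, sin_plus.
    assert (P1 := sin2_cos2 A); assert (P2 := sin2_cos2 X); unfold Rsqr in *.
    transitivity (sin A * sin A + (sin X * sin X * (cos A * cos A) - cos X * cos X * (sin A * sin A))); [ring|].
    replace (cos A * cos A) with (1 - sin A * sin A) by lra.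
    replace (cos X * cos X) with (1 - sin X * sin X) by lra; ring.
Qed.

(** Where sin t does not vanish this is the closed form; where it does, every cosine is 1. *)
Lemma fejer_ge_0 : forall t K, 0 <= fejer t K.
Proof.
  intros t K; destruct (Req_dec (sin t) 0) as [H0|H0].
  - assert (S0 : forall k, sin (INR k * t) = 0).
    { induction k as [|k IH]; [simpl; rewrite Rmult_0_l; apply sin_0|].
      rewrite S_INR, Rmult_plus_distr_r, Rmult_1_l, sin_plus, IH, H0; ring. }
    assert (D : forall m, 0 <= dirichlet t m).
    { induction m as [|m IH].
      - unfold dirichlet; rewrite sum1_0; lra.
      - rewrite dirichlet_S.
        replace (2 * INR (S m) * t) with (2 * (INR (S m) * t)) by ring.
        rewrite cos_2a_sin, S0; lra. }
    induction K as [|K IH]; simpl; [lra | assert (A := D K); lra].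
  - assert (E := fejer_sin t K).
    apply Rnot_lt_le; intros H.
    assert (0 < sin t * sin t) by nra.
    assert (0 <= sin (INR K * t) * sin (INR K * t)) by nra.
    nra.
Qed.

Lemma cont_dirichlet : forall h m s, continuous (fun v => dirichlet (h * v) m) s.
Proof.
  intros h m s; apply (ex_derive_continuous (V := R_NormedModule)).
  induction m as [|m IH].
  - apply ex_derive_ext with (fun _ => 1).
    + intros v; unfold dirichlet; rewrite sum1_0; Rring.
    + apply ex_derive_const.
  - apply ex_derive_ext with (fun v => dirichlet (h * v) m + 2 * cos (2 * INR (S m) * (h * v))).
    + intros v; rewrite dirichlet_S; reflexivity.
    + apply (ex_derive_plus (V := R_NormedModule)); [exact IH | auto_derive; auto].
Qed.

Lemma cont_fejer : forall h K s, continuous (fun v => fejer (h * v) K) s.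
Proof.
  intros h K s; induction K as [|K IH]; [apply continuous_const|].
  apply cont_plus; [exact IH | apply cont_dirichlet].
Qed.

Lemma cos_nat_period : forall x n, cos (x + INR n * (2 * PI)) = cos x.
Proof. intros x n; rewrite <- (cos_period x n); f_equal; ring. Qed.

Lemma dirichlet_period : forall t m n, dirichlet (t + INR n * PI) m = dirichlet t m.
Proof.
  intros t m n; unfold dirichlet; do 2 f_equal; apply sum_n_m_ext; intros k.
  replace (2 * INR k * (t + INR n * PI)) with (2 * INR k * t + INR (k * n) * (2 * PI))
    by (rewrite mult_INR; ring).
  apply cos_nat_period.
Qed.

Lemma fejer_period : forall t K n, fejer (t + INR n * PI) K = fejer t K.
Proof.
  intros t K n; induction K as [|K IH]; simpl; [reflexivity | rewrite IH, dirichlet_period; reflexivity].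
Qed.

Lemma sin_nat_PI : forall n, sin (INR n * PI) = 0.
Proof.
  induction n as [|n IH]; [simpl; rewrite Rmult_0_l; apply sin_0|].
  rewrite S_INR, Rmult_plus_distr_r, Rmult_1_l, neg_sin, IH; ring.
Qed.

Lemma RInt_cos_sym : forall s a, s <> 0 -> RInt (fun v => cos (s * v)) (- a) a = 2 * sin (s * a) / s.
Proof.
  intros s a Hs; apply is_RInt_unique.
  replace (2 * sin (s * a) / s) with (minus (sin (s * a) / s) (sin (s * - a) / s)).
  - apply (is_RInt_derive (V := R_CompleteNormedModule) (fun v => sin (s * v) / s)).
    + intros v _; auto_derive; [auto | field; exact Hs].
    + intros v _; cont_derive.
  - replace (s * - a) with (- (s * a)) by ring.
    rewrite sin_neg; unfold minus, plus, opp; simpl; field; exact Hs.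
Qed.

Lemma RInt_dirichlet_cell : forall h H m, 0 < h -> h * H = PI ->
  RInt (fun v => dirichlet (h * v) m) (- (H / 2)) (H / 2) = H.
Proof.
  intros h H m Hh HH; induction m as [|m IH].
  - rewrite (RInt_ext _ (fun _ => 1)).
    + rewrite RInt_cst; lra.
    + intros v _; unfold dirichlet; rewrite sum1_0; Rring.
  - rewrite (RInt_ext _ (fun v => 1 * dirichlet (h * v) m + 2 * cos (2 * INR (S m) * (h * v))))
      by (intros v _; rewrite dirichlet_S; Rring).
    assert (Hn : INR (S m) <> 0) by (apply not_0_INR; lia).
    assert (E : RInt (fun v => cos (2 * INR (S m) * (h * v))) (- (H / 2)) (H / 2) = 0).
    { rewrite (RInt_ext _ (fun v => cos ((2 * INR (S m) * h) * v))) by (intros v _; f_equal; Rring).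
      rewrite RInt_cos_sym by nra.
      replace (2 * INR (S m) * h * (H / 2)) with (INR (S m) * PI) by (rewrite <- HH; field).
      rewrite sin_nat_PI; unfold Rdiv; Rring. }
    rewrite RInt_lin2, IH, E; [Rring | |].
    + apply ex_RInt_cont, cont_dirichlet.
    + apply ex_RInt_cont; intros s; cont_derive.
Qed.

Lemma RInt_fejer_cell : forall h H K, 0 < h -> h * H = PI ->
  RInt (fun v => fejer (h * v) K) (- (H / 2)) (H / 2) = INR K * H.
Proof.
  intros h H K Hh HH; induction K as [|K IH].
  - simpl; rewrite RInt_cst; Rring.
  - rewrite (RInt_ext _ (fun v => 1 * fejer (h * v) K + 1 * dirichlet (h * v) K))
      by (intros v _; cbn [fejer]; Rring).
    rewrite RInt_lin2;
      [| apply ex_RInt_cont, cont_fejer | apply ex_RInt_cont, cont_dirichlet].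
    rewrite IH, (RInt_dirichlet_cell h H K Hh HH), S_INR; Rring.
Qed.

Lemma sin_ge_third : forall t, 0 <= t <= PI / 2 -> t / 3 <= sin t.
Proof.
  intros t Ht; assert (P := PI_4).
  destruct (sin_bound t 0) as [H _]; [lra | lra |].
  unfold sin_approx, sin_term in H; simpl in H.
  replace (1 * (t * 1 / 1) + -1 * 1 * (t * (t * (t * 1)) / (1 + 1 + 1 + 1 + 1 + 1))) with (t - t * t * t / 6) in H by field.
  assert (t * t <= 4) by nra.
  nra.
Qed.

(** Near a node G moves by at most L|v| <= L(d + v^2/d). The first part is integrated against the
    kernel, of total mass KH; in the second, v^2 is dominated by sin(hv)^2, which times the kernel
    stays below 1. Any d of smaller order than 1 and larger than 1/K makes the bound o(K). *)
Lemma fejer_cell : forall h H K d L c (G : R -> R), 0 < h -> h * H = PI -> 0 < d -> 0 <= L ->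
  (forall s, continuous G s) ->
  (forall v, fejer (h * (v + c)) K = fejer (h * v) K) ->
  (forall v, - (H / 2) <= v <= H / 2 -> Rabs (G (v + c) - G c) <= L * Rabs v) ->
  Rabs (RInt (fun v => G v * fejer (h * v) K) (c - H / 2) (c + H / 2) - INR K * H * G c)
    <= L * (H * (d * INR K + 9 / (h * h * d))).
Proof.
  intros h H K d L c G Hh HH Hd HL HG Hper HGL.
  assert (HHp : 0 < H) by exact (period_pos h H Hh HH).
  assert (CG : forall s, continuous (fun v => G (v + c)) s).
  { intros s; apply (continuous_comp (fun v => v + c) G); [|apply HG].
    apply cont_plus; [apply continuous_id | apply continuous_const]. }
  assert (E : RInt (fun v => G v * fejer (h * v) K) (c - H / 2) (c + H / 2) - INR K * H * G c
              = RInt (fun v => (G (v + c) - G c) * fejer (h * v) K) (- (H / 2)) (H / 2)).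
  { assert (E1 : RInt (fun v => G v * fejer (h * v) K) (c - H / 2) (c + H / 2)
                 = RInt (fun v => G (v + c) * fejer (h * v) K) (- (H / 2)) (H / 2)).
    { replace (c - H / 2) with (1 * (- (H / 2)) + c) by ring.
      replace (c + H / 2) with (1 * (H / 2) + c) by ring.
      etransitivity; [symmetry; apply (RInt_comp_lin (V := R_CompleteNormedModule) _ 1 c)|].
      - apply ex_RInt_cont; intros s; apply cont_mult; [apply HG | apply cont_fejer].
      - apply RInt_ext; intros v _; unfold scal; simpl; unfold mult; simpl.
        rewrite !Rmult_1_l, Hper; reflexivity. }
    rewrite E1, <- (RInt_fejer_cell h H K Hh HH).
    rewrite (RInt_ext (fun v => (G (v + c) - G c) * fejer (h * v) K)
      (fun v => 1 * (G (v + c) * fejer (h * v) K) + (- G c) * fejer (h * v) K)) by (intros; Rring).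
    rewrite RInt_lin2.
    - set (A := RInt (fun v => G (v + c) * _) _ _); set (B := RInt (fun v => fejer _ _) _ _).
      assert (Q : forall a b : R, a - b * G c = 1 * a + - G c * b) by (intros; ring); apply Q.
    - apply ex_RInt_cont; intros s; apply cont_mult; [apply CG | apply cont_fejer].
    - apply ex_RInt_cont, cont_fejer. }
  rewrite E.
  assert (Cg : forall s, continuous (fun v => (G (v + c) - G c) * fejer (h * v) K) s).
  { intros s; apply cont_mult; [|apply cont_fejer].
    apply cont_minus; [apply CG | apply continuous_const]. }
  eapply Rle_trans; [apply abs_RInt_le; [lra | apply ex_RInt_cont, Cg]|].
  assert (Q : RInt (fun v => L * (d * fejer (h * v) K) + L * (9 / (h * h * d)) * 1) (- (H / 2)) (H / 2)
              = L * (H * (d * INR K + 9 / (h * h * d)))).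
  { rewrite (RInt_ext _ (fun v => (L * d) * fejer (h * v) K + (L * (9 / (h * h * d))) * 1)) by (intros; Rring).
    rewrite RInt_lin2, (RInt_fejer_cell h H K Hh HH), RInt_cst.
    - Req; field; lra.
    - apply ex_RInt_cont, cont_fejer.
    - apply ex_RInt_cont; intros; apply continuous_const. }
  rewrite <- Q; apply RInt_le; [lra | | |].
  - apply ex_RInt_cont; intros s; apply (continuous_comp _ Rabs); [apply Cg | apply continuous_Rabs].
  - apply ex_RInt_cont; intros s; apply cont_plus; [|apply continuous_const].
    apply cont_mult; [apply continuous_const|].
    apply cont_mult; [apply continuous_const | apply cont_fejer].
  - intros v Hv; rewrite Rabs_mult, (Rabs_pos_eq (fejer _ _)) by apply fejer_ge_0.
    assert (F := fejer_ge_0 (h * v) K); assert (Fs := fejer_sin (h * v) K).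
    assert (S1 : sin (INR K * (h * v)) * sin (INR K * (h * v)) <= 1).
    { assert (B := SIN_bound (INR K * (h * v))); nra. }
    assert (Sv : h * h * (v * v) <= 9 * (sin (h * v) * sin (h * v))).
    { assert (Hs : forall w, 0 <= w <= H / 2 -> h * h * (w * w) <= 9 * (sin (h * w) * sin (h * w))).
      { intros w Hw; assert (A := sin_ge_third (h * w)).
        assert (0 <= h * w <= PI / 2) by (rewrite <- HH; split; nra).
        specialize (A ltac:(assumption)); nra. }
      destruct (Rle_lt_dec 0 v) as [H0|H0]; [apply Hs; lra|].
      assert (A := Hs (- v) ltac:(lra)).
      replace (h * - v) with (- (h * v)) in A by ring; rewrite sin_neg in A; lra. }
    assert (Hvd : Rabs v <= d + v * v / d).
    { assert (Hvv : v * v = Rabs v * Rabs v) by (rewrite <- Rabs_mult, Rabs_pos_eq; [reflexivity | nra]).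
      assert (Hav := Rabs_pos v); rewrite Hvv.
      apply Rmult_le_reg_r with d; [exact Hd|].
      replace ((d + Rabs v * Rabs v / d) * d) with (d * d + Rabs v * Rabs v) by (field; lra).
      nra. }
    apply Rle_trans with (L * Rabs v * fejer (h * v) K).
    { apply Rmult_le_compat_r; [exact F | apply HGL; lra]. }
    replace (L * (d * fejer (h * v) K) + L * (9 / (h * h * d)) * 1)
      with (L * (d * fejer (h * v) K + 9 / (h * h * d))) by ring.
    rewrite Rmult_assoc; apply Rmult_le_compat_l; [exact HL|].
    apply Rle_trans with ((d + v * v / d) * fejer (h * v) K); [apply Rmult_le_compat_r; assumption|].
    assert (K2 : v * v / d * fejer (h * v) K <= 9 / (h * h * d)).
    { apply Rmult_le_reg_r with (h * h * d); [apply Rmult_lt_0_compat; nra|].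
      replace (v * v / d * fejer (h * v) K * (h * h * d)) with (h * h * (v * v) * fejer (h * v) K) by (field; lra).
      replace (9 / (h * h * d) * (h * h * d)) with 9 by (field; lra).
      apply Rle_trans with (9 * (sin (h * v) * sin (h * v)) * fejer (h * v) K);
        [apply Rmult_le_compat_r; assumption|].
      rewrite Rmult_assoc, Fs; lra. }
    lra.
Qed.

Lemma Clim_re : forall f l, Clim f l -> Clim (fun b => RtoC (fst (f b))) (RtoC (fst l)).
Proof.
  intros f l Hf eta He; destruct (Hf eta He) as [B HB]; exists B; intros b Hb.
  rewrite <- RtoC_minus, Cmod_R.
  eapply Rle_trans; [|apply HB, Hb]; apply (re_le_Cmod (f b - l)%C).
Qed.

Lemma cont_gauss_shift : forall u s, continuous (fun v : R => gauss (v - u)) s.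
Proof. intros u s; cont_derive. Qed.

Lemma gauss_fourier : forall s u,
  Clim (fun A => RtoC (RInt (fun v => gauss (v - u) * cos (2 * s * v)) (- A) A))
       (RtoC (sqrt PI * (gauss s * cos (2 * u * s)))).
Proof.
  intros s u.
  set (kappa := Cexp (2 * Ci * RtoC (s * u))%C).
  assert (L : Clim (fun A => kappa * (wpart s (A + - u) + wpart (- RtoC s) (A + u)))%C
                (kappa * (sqrt PI / 2 * (faddeeva s + faddeeva (- RtoC s))))%C).
  { apply Clim_scal.
    replace (sqrt PI / 2 * (faddeeva s + faddeeva (- RtoC s)))%C
      with (sqrt PI / 2 * faddeeva s + sqrt PI / 2 * faddeeva (- RtoC s))%C by ring.
    apply Clim_plus; [apply (Clim_shift (wpart s)) | apply (Clim_shift (wpart (- RtoC s)))]; apply wpart_lim. }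
  apply Clim_re in L.
  replace (fst (kappa * (sqrt PI / 2 * (faddeeva s + faddeeva (- RtoC s))))%C)
    with (sqrt PI * (gauss s * cos (2 * u * s))) in L.
  2:{ rewrite faddeeva_reflect_real.
      replace (- RtoC s ^ 2)%C with (RtoC (- (s * s))) by (apply injective_projections; simpl; ring).
      replace (sqrt PI / 2 * (2 * Cexp (RtoC (- (s * s)))))%C with (RtoC (sqrt PI * gauss s)).
      - unfold kappa, Cexp; simpl.
        match goal with |- _ = exp ?a * cos ?b * _ - _ =>
          replace a with 0 by ring; replace b with (2 * u * s) by ring end.
        rewrite exp_0; ring.
      - rewrite Cexp_RtoC, RtoC_mult; field; apply RtoC_neq_0; lra. }
  apply Clim_ext with (2 := L); intros A; f_equal.
  rewrite wpart_opp.
  replace (- (A + u)) with (- A + - u) by ring.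
  transitivity (fst (CInt (fun v => kappa * wker s (v + - u))%C (- A) A)).
  - rewrite CInt_scal.
    + rewrite (CInt_shift (wker s) (- u) (- A) A (Ccont_wker s)).
      rewrite <- (CInt_Chasles (wker s) (- A + - u) 0 (A + - u) (Ccont_wker s)).
      f_equal; unfold wpart.
      assert (Q : (CInt (wker s) 0 (- A + - u) + CInt (wker s) (- A + - u) 0 = 0)%C).
      { rewrite (CInt_Chasles _ _ _ _ (Ccont_wker s)); unfold CInt; rewrite !RInt_point; reflexivity. }
      replace (CInt (wker s) (- A + - u) 0) with (- CInt (wker s) 0 (- A + - u))%C; [ring|].
      replace (CInt (wker s) (- A + - u) 0)
        with (CInt (wker s) 0 (- A + - u) + CInt (wker s) (- A + - u) 0 - CInt (wker s) 0 (- A + - u))%C by ring.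
      rewrite Q; ring.
    + intros t; destruct (Ccont_comp_lin (wker s) 1 (- u) (Ccont_wker s) t) as [A1 A2].
      split; [eapply continuous_ext; [|exact A1] | eapply continuous_ext; [|exact A2]];
        intros v; simpl; rewrite Rmult_1_l; reflexivity.
  - unfold CInt; cbn [fst]; apply RInt_ext; intros v _.
    unfold kappa, wker; rewrite <- Cexp_plus; unfold Cexp, Re, Im; simpl.
    f_equal; f_equal; Rring.
Qed.

(** K times the K-th Cesaro mean of the trigonometric sums. *)
Fixpoint cesaro_sum (h u : R) (K : nat) : R :=
  match K with O => 0 | S m => cesaro_sum h u m + cos_sum h u m end.

Lemma cos_sum_S : forall h u m, cos_sum h u (S m) =
  cos_sum h u m + 2 * (gauss (INR (S m) * h) * cos (2 * u * (INR (S m) * h))).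
Proof. intros h u m; unfold cos_sum; rewrite sum1_S; ring. Qed.

Lemma gauss_dirichlet_lim : forall h u m,
  Clim (fun A => RtoC (RInt (fun v => gauss (v - u) * dirichlet (h * v) m) (- A) A))
       (RtoC (sqrt PI * cos_sum h u m)).
Proof.
  intros h u m; induction m as [|m IH].
  - assert (L := gauss_fourier 0 u).
    replace (sqrt PI * (gauss 0 * cos (2 * u * 0))) with (sqrt PI * cos_sum h u 0) in L.
    + apply Clim_ext with (2 := L); intros A; f_equal; apply RInt_ext; intros v _.
      unfold dirichlet; rewrite sum1_0, Rmult_0_r, Rmult_0_l, cos_0; Rring.
    + unfold cos_sum; rewrite sum1_0; replace (2 * u * 0) with 0 by ring; replace (- (0 * 0)) with 0 by ring.
      rewrite exp_0, cos_0; ring.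
  - rewrite cos_sum_S, Rmult_plus_distr_l, RtoC_plus.
    assert (L := Clim_scal 2 _ _ (gauss_fourier (INR (S m) * h) u)).
    replace (RtoC (sqrt PI * (2 * (exp (- (INR (S m) * h * (INR (S m) * h))) * cos (2 * u * (INR (S m) * h))))))
      with (2 * RtoC (sqrt PI * (exp (- (INR (S m) * h * (INR (S m) * h))) * cos (2 * u * (INR (S m) * h)))))%C
      by (rewrite <- RtoC_mult; f_equal; ring).
    apply Clim_ext with (2 := Clim_plus _ _ _ _ IH L); intros A; cbv beta.
    rewrite <- RtoC_mult, <- RtoC_plus; f_equal.
    set (g := fun v => gauss (v - u)).
    rewrite (RInt_ext (fun v => gauss (v - u) * dirichlet (h * v) (S m))
      (fun v => 1 * (g v * dirichlet (h * v) m) + 2 * (g v * cos (2 * (INR (S m) * h) * v)))).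
    + rewrite RInt_lin2; unfold g.
      * rewrite Rmult_1_l; reflexivity.
      * apply ex_RInt_cont; intros s; apply cont_mult;
          [apply cont_gauss_shift | apply cont_dirichlet].
      * apply ex_RInt_cont; intros s; apply cont_mult; [apply cont_gauss_shift|].
        cont_derive.
    + intros v _; rewrite dirichlet_S; unfold g.
      replace (2 * (INR (S m) * h) * v) with (2 * INR (S m) * (h * v)) by Rring; Rring.
Qed.

Lemma gauss_fejer_lim : forall h u K,
  Clim (fun A => RtoC (RInt (fun v => gauss (v - u) * fejer (h * v) K) (- A) A))
       (RtoC (sqrt PI * cesaro_sum h u K)).
Proof.
  intros h u K; induction K as [|K IH].
  - apply Clim_ext with (fun _ => RtoC (sqrt PI * cesaro_sum h u 0)); [|apply Clim_const].
    intros A; f_equal; symmetry.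
    rewrite (RInt_ext _ (fun _ => 0)) by (intros v _; simpl; Rring).
    rewrite RInt_cst; Rring.
  - cbn [cesaro_sum]; rewrite Rmult_plus_distr_l, RtoC_plus.
    apply Clim_ext with (2 := Clim_plus _ _ _ _ IH (gauss_dirichlet_lim h u K)); intros A; cbv beta.
    rewrite <- RtoC_plus; f_equal.
    set (g := fun v => gauss (v - u)).
    rewrite (RInt_ext (fun v => gauss (v - u) * fejer (h * v) (S K))
      (fun v => 1 * (g v * fejer (h * v) K) + 1 * (g v * dirichlet (h * v) K))).
    + rewrite RInt_lin2; unfold g.
      * rewrite !Rmult_1_l; reflexivity.
      * apply ex_RInt_cont; intros s; apply cont_mult;
          [apply cont_gauss_shift | apply cont_fejer].
      * apply ex_RInt_cont; intros s; apply cont_mult;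
          [apply cont_gauss_shift | apply cont_dirichlet].
    + intros v _; cbn [fejer]; unfold g; Rring.
Qed.

(** The derivative -2x exp(-x^2) is at most 2e exp(-|x|), because x^2 >= 2|x| - 1. *)
Lemma gauss_lipschitz : forall a v m, m <= Rabs a - Rabs v ->
  Rabs (gauss (v + a) - gauss a) <= 2 * exp 1 * exp (- m) * Rabs v.
Proof.
  intros a v m Hm.
  destruct (MVT_gen (fun t => gauss t) a (v + a) (fun t => - (2 * t) * gauss t)) as [x [Hx E]].
  - intros x _; auto_derive; [auto | ring].
  - intros x _; apply continuity_pt_ex_derive; auto_derive; auto.
  - rewrite E; replace (v + a - a) with v by ring.
    rewrite Rabs_mult; apply Rmult_le_compat_r; [apply Rabs_pos|].
    assert (Hx' : m <= Rabs x).
    { assert (Rabs (a - x) <= Rabs v).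
      { unfold Rmin, Rmax in Hx; destruct (Rle_dec a (v + a)).
        - rewrite (Rabs_pos_eq v), Rabs_left1 by lra; lra.
        - rewrite (Rabs_left v), Rabs_pos_eq by lra; lra. }
      assert (T := Rabs_triang (a - x) x); replace (a - x + x) with a in T by ring; lra. }
    rewrite Rabs_mult, Rabs_Ropp, Rabs_mult, (Rabs_pos_eq 2), (Rabs_pos_eq (exp _))
      by (lra || (left; apply exp_pos)).
    assert (Hxx : x * x = Rabs x * Rabs x) by (rewrite <- Rabs_mult, Rabs_pos_eq; [reflexivity | nra]).
    assert (H1 : Rabs x <= exp (Rabs x)) by (assert (A := exp_ineq1_le (Rabs x)); lra).
    assert (H2 : gauss x <= exp 1 * exp (- m) * exp (- Rabs x)).
    { rewrite <- !exp_plus; apply exp_le_mono; rewrite Hxx; assert (Q := pow2_ge_0 (Rabs x - 1)); nra. }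
    assert (H3 : exp (Rabs x) * exp (- Rabs x) = 1) by (rewrite <- exp_plus, <- exp_0; f_equal; ring).
    assert (P1 := exp_pos 1); assert (P2 := exp_pos (- m)); assert (P3 := exp_pos (- Rabs x)).
    assert (P4 := exp_pos (- (x * x))); assert (P5 := Rabs_pos x).
    apply Rle_trans with (2 * exp (Rabs x) * (exp 1 * exp (- m) * exp (- Rabs x))).
    + apply Rmult_le_compat; lra.
    + right; transitivity (2 * exp 1 * exp (- m) * (exp (Rabs x) * exp (- Rabs x))); [ring|].
      rewrite H3; ring.
Qed.

(** The interval is cut into cells of length H centred at the multiples of H. On the cell around
    nH the Lipschitz constant of the Gaussian is of the order exp(-|n|H), so the errors of all
    cells have a sum bounded independently of M. *)
Lemma fejer_estimate : forall h H, 0 < h -> h * H = PI -> exists C, 0 <= C /\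
  forall u K M d, 0 <= u <= H -> 0 < d ->
  Rabs (RInt (fun v => gauss (v - u) * fejer (h * v) K)
             (- ((INR M + 1 / 2) * H)) ((INR M + 1 / 2) * H)
        - INR K * H * gauss_sum H u M)
    <= C * (H * (d * INR K + 9 / (h * h * d))).
Proof.
  intros h H Hh HH.
  assert (HHp : 0 < H) by exact (period_pos h H Hh HH).
  set (L0 := 2 * exp 1 * exp (3 / 2 * H)).
  assert (L0p : 0 < L0) by (unfold L0; repeat apply Rmult_lt_0_compat; try apply exp_pos; lra).
  set (L := fun n : nat => L0 * exp (- (INR n * H))).
  assert (Lp : forall n, 0 <= L n) by (intros n; unfold L; assert (P := exp_pos (- (INR n * H))); nra).
  assert (E1 : 1 < exp H) by (rewrite <- exp_0; apply exp_increasing; exact HHp).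
  exists (L0 + 2 * (L0 / (exp H - 1))).
  assert (D0 : 0 <= L0 / (exp H - 1)) by (apply Rlt_le, Rdiv_lt_0_compat; lra).
  split; [lra|].
  intros u K M d Hu Hd.
  set (X := H * (d * INR K + 9 / (h * h * d))).
  assert (Xp : 0 <= X).
  { unfold X; apply Rmult_le_pos; [lra|]; apply Rplus_le_le_0_compat.
    - apply Rmult_le_pos; [lra | apply pos_INR].
    - apply Rlt_le, Rdiv_lt_0_compat; [lra | repeat apply Rmult_lt_0_compat; lra]. }
  set (G := fun v => gauss (v - u)).
  assert (Cell : forall n c, (c = INR n * H \/ c = - (INR n * H)) ->
    Rabs (RInt (fun v => G v * fejer (h * v) K) (c - H / 2) (c + H / 2) - INR K * H * G c) <= L n * X).
  { intros n c Hc; apply fejer_cell; try assumption; [apply Lp | apply cont_gauss_shift | |].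
    - intros v; destruct Hc as [-> | ->].
      + rewrite <- (fejer_period (h * v) K n); f_equal; rewrite <- HH; ring.
      + rewrite <- (fejer_period (h * (v + - (INR n * H))) K n); f_equal; rewrite <- HH; ring.
    - intros v Hv; unfold G.
      replace (v + c - u) with (v + (c - u)) by ring.
      eapply Rle_trans; [apply (gauss_lipschitz (c - u) v (INR n * H - 3 / 2 * H))|].
      + assert (T := Rabs_triang (c - u) u); replace (c - u + u) with c in T by ring.
        assert (Rabs c = INR n * H).
        { assert (0 <= INR n * H) by (apply Rmult_le_pos; [apply pos_INR | lra]).
          destruct Hc as [-> | ->]; [|rewrite Rabs_Ropp]; apply Rabs_pos_eq; assumption. }
        rewrite (Rabs_pos_eq u) in T by lra.
        assert (Rabs v <= H / 2) by (apply Rabs_le; lra).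
        lra.
      + right; unfold L, L0.
        replace (- (INR n * H - 3 / 2 * H)) with (3 / 2 * H + - (INR n * H)) by ring.
        rewrite exp_plus; ring. }
  assert (Cont : forall s, continuous (fun v => G v * fejer (h * v) K) s).
  { intros s; apply cont_mult; [apply cont_gauss_shift | apply cont_fejer]. }
  assert (Main : Rabs (RInt (fun v => G v * fejer (h * v) K) (- ((INR M + 1 / 2) * H)) ((INR M + 1 / 2) * H)
        - INR K * H * gauss_sum H u M) <= (L0 + 2 * sum_n_m L 1 M) * X).
  { induction M as [|M IH].
    - assert (A := Cell 0%nat 0 ltac:(left; simpl; ring)).
      replace (- ((INR 0 + 1 / 2) * H)) with (0 - H / 2) by (simpl; field).
      replace ((INR 0 + 1 / 2) * H) with (0 + H / 2) by (simpl; field).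
      replace (gauss_sum H u 0) with (G 0).
      + rewrite sum1_0; replace (L0 + 2 * 0) with (L 0%nat); [exact A|].
        unfold L; simpl; rewrite Rmult_0_l, Ropp_0, exp_0; ring.
      + unfold gauss_sum, G; rewrite sum1_0, Rplus_0_r; f_equal; ring.
    - set (a := (INR M + 1 / 2) * H) in *.
      set (c := INR (S M) * H).
      assert (Ec : (INR (S M) + 1 / 2) * H = c + H / 2) by (unfold c; field).
      assert (Ea : a = c - H / 2) by (unfold a, c; rewrite S_INR; field).
      rewrite Ec.
      assert (Q : forall x y, ex_RInt (V := R_CompleteNormedModule) (fun v => G v * fejer (h * v) K) x y)
        by (intros; apply ex_RInt_cont, Cont).
      assert (Q1 := RInt_Chasles _ _ _ _ (Q (- (c + H / 2)) (- a)) (Q (- a) (c + H / 2))).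
      assert (Q2 := RInt_Chasles _ _ _ _ (Q (- a) a) (Q a (c + H / 2))).
      rewrite <- Q1, <- Q2; unfold plus; simpl.
      assert (B1 := Cell (S M) c (or_introl eq_refl)).
      assert (B2 := Cell (S M) (- c) (or_intror eq_refl)).
      replace (- c - H / 2) with (- (c + H / 2)) in B2 by ring.
      replace (- c + H / 2) with (- a) in B2 by (rewrite Ea; ring).
      rewrite <- Ea in B1.
      unfold gauss_sum in *; rewrite !sum1_S.
      replace (gauss (u + INR (S M) * H)) with (G (- c))
        by (unfold G, c; f_equal; ring).
      replace (gauss (u - INR (S M) * H)) with (G c)
        by (unfold G, c; f_equal; ring).
      set (I0 := RInt _ (- a) a) in *; set (I1 := RInt _ a (c + H / 2)) in *.
      set (I2 := RInt _ (- (c + H / 2)) (- a)) in *.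
      set (S0 := gauss u + sum_n_m _ 1 M) in *.
      match goal with |- Rabs ?e <= _ =>
        replace e with ((I0 - INR K * H * S0) + ((I1 - INR K * H * G c) + (I2 - INR K * H * G (- c))))
          by (unfold S0; ring) end.
      eapply Rle_trans; [apply Rabs_triang|].
      eapply Rle_trans; [apply Rplus_le_compat_l, Rabs_triang|].
      nra. }
  eapply Rle_trans; [exact Main|].
  apply Rmult_le_compat_r; [exact Xp|].
  assert (T := sum1_exp_tail L L0 H HHp).
  specialize (T ltac:(intros n _; rewrite Rabs_pos_eq by apply Lp; unfold L; lra) 0%nat M).
  rewrite sum1_0, Rminus_0_r in T; simpl in T; rewrite Rmult_0_l, Ropp_0, exp_0 in T.
  assert (P := exp_pos (- (INR M * H))).
  assert (T' := Rle_abs (sum_n_m L 1 M)).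
  nra.
Qed.

Lemma cos_sum_cauchy : forall h, 0 < h -> exists B, 0 <= B /\ forall u m P,
  Rabs (cos_sum h u m - cos_sum h u P) <= B * (exp (- (INR m * h)) + exp (- (INR P * h))).
Proof.
  intros h Hh; exists (2 * (exp 1 / (exp h - 1))).
  assert (E1 : 1 < exp h) by (rewrite <- exp_0; apply exp_increasing; exact Hh).
  assert (D0 : 0 <= exp 1 / (exp h - 1)) by (apply Rlt_le, Rdiv_lt_0_compat; [apply exp_pos | lra]).
  split; [lra|]; intros u.
  set (a := fun k => gauss (INR k * h) * cos (2 * u * (INR k * h))).
  assert (Ha : forall n, (1 <= n)%nat -> Rabs (a n) <= exp 1 * exp (- (INR n * h))).
  { intros n _; unfold a; rewrite Rabs_mult, Rabs_pos_eq by (left; apply exp_pos).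
    assert (Rabs (cos (2 * u * (INR n * h))) <= 1) by (apply Rabs_le, COS_bound).
    assert (G := gauss_le_exp (INR n * h)).
    rewrite (Rabs_pos_eq (INR n * h)) in G by (apply Rmult_le_pos; [apply pos_INR | lra]).
    assert (P := exp_pos (- (INR n * h * (INR n * h)))).
    assert (Rabs_pos := Rabs_pos (cos (2 * u * (INR n * h)))); nra. }
  assert (W : forall m P, (m <= P)%nat ->
    Rabs (cos_sum h u P - cos_sum h u m) <= 2 * (exp 1 / (exp h - 1)) * exp (- (INR m * h))).
  { intros m P Hm; replace P with (m + (P - m))%nat by lia.
    assert (T := sum1_exp_tail a (exp 1) h Hh Ha m (P - m)).
    unfold cos_sum; fold a.
    replace (1 + 2 * sum_n_m a 1 (m + (P - m)) - (1 + 2 * sum_n_m a 1 m))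
      with (2 * (sum_n_m a 1 (m + (P - m)) - sum_n_m a 1 m)) by ring.
    rewrite Rabs_mult, (Rabs_pos_eq 2) by lra.
    assert (Q := exp_pos (- (INR (m + (P - m)) * h))); nra. }
  intros m P; assert (Q1 := exp_pos (- (INR m * h))); assert (Q2 := exp_pos (- (INR P * h))).
  destruct (Nat.le_ge_cases m P) as [Hm|Hm].
  - rewrite Rabs_minus_sym; eapply Rle_trans; [apply W, Hm|]; nra.
  - eapply Rle_trans; [apply W, Hm|]; nra.
Qed.

Lemma gauss_sum_cauchy : forall H, 0 < H -> exists B, 0 <= B /\ forall u M d, 0 <= u <= H ->
  Rabs (gauss_sum H u (M + d) - gauss_sum H u M) <= B * exp (- (INR M * H)).
Proof.
  intros H HH; set (C := 2 * exp 1 * exp H); exists (C / (exp H - 1)).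
  assert (E1 : 1 < exp H) by (rewrite <- exp_0; apply exp_increasing; exact HH).
  assert (D0 : 0 <= C / (exp H - 1)).
  { apply Rlt_le, Rdiv_lt_0_compat; [unfold C; repeat apply Rmult_lt_0_compat; try apply exp_pos; lra | lra]. }
  split; [exact D0|]; intros u M d Hu.
  set (a := fun n => gauss (u + INR n * H) + gauss (u - INR n * H)).
  assert (Ha : forall n, (1 <= n)%nat -> Rabs (a n) <= C * exp (- (INR n * H))).
  { intros n _; unfold a, C.
    assert (Hn : 0 <= INR n * H) by (apply Rmult_le_pos; [apply pos_INR | lra]).
    rewrite Rabs_pos_eq by (apply Rplus_le_le_0_compat; left; apply exp_pos).
    assert (K : forall t, INR n * H - H <= Rabs t -> gauss t <= exp 1 * exp H * exp (- (INR n * H))).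
    { intros t Ht; eapply Rle_trans; [apply gauss_le_exp|].
      rewrite <- !exp_plus; apply exp_le_mono; lra. }
    assert (K1 := K (u + INR n * H)); assert (K2 := K (u - INR n * H)).
    rewrite Rabs_pos_eq in K1 by lra.
    assert (A := Rabs_triang_inv (INR n * H) u).
    rewrite Rabs_minus_sym, !Rabs_pos_eq in A by lra.
    specialize (K1 ltac:(lra)); specialize (K2 ltac:(lra)); lra. }
  assert (T := sum1_exp_tail a C H HH Ha M d).
  unfold gauss_sum; fold a.
  replace (gauss u + sum_n_m a 1 (M + d) - (gauss u + sum_n_m a 1 M))
    with (sum_n_m a 1 (M + d) - sum_n_m a 1 M) by ring.
  assert (Q := exp_pos (- (INR (M + d) * H))); nra.
Qed.

Lemma cesaro_sum_near : forall h B, 0 < h -> 0 <= B -> forall u P,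
  (forall m, Rabs (cos_sum h u m - cos_sum h u P) <= B * (exp (- (INR m * h)) + exp (- (INR P * h)))) ->
  forall K, Rabs (cesaro_sum h u K - INR K * cos_sum h u P)
    <= B * (exp h / (exp h - 1)) * (1 - exp (- (INR K * h))) + INR K * (B * exp (- (INR P * h))).
Proof.
  intros h B Hh HB u P HP K.
  assert (E1 : 1 < exp h) by (rewrite <- exp_0; apply exp_increasing; exact Hh).
  induction K as [|K IH].
  - simpl; rewrite !Rmult_0_l, Ropp_0, exp_0, !Rminus_diag, Rabs_R0; lra.
  - cbn [cesaro_sum]; rewrite S_INR.
    replace (cesaro_sum h u K + cos_sum h u K - (INR K + 1) * cos_sum h u P)
      with ((cesaro_sum h u K - INR K * cos_sum h u P) + (cos_sum h u K - cos_sum h u P)) by ring.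
    eapply Rle_trans; [apply Rabs_triang|].
    assert (A := HP K).
    assert (E : exp (- (INR K * h)) = exp h * exp (- ((INR K + 1) * h)))
      by (rewrite <- exp_plus; f_equal; ring).
    apply Rle_trans with (B * (exp h / (exp h - 1)) * (1 - exp (- (INR K * h))) + INR K * (B * exp (- (INR P * h)))
       + B * (exp (- (INR K * h)) + exp (- (INR P * h)))); [lra|].
    rewrite E; right; field; lra.
Qed.

(** Poisson summation. The K-th Cesaro mean of the trigonometric sums is the integral of the
    Gaussian against a nonnegative kernel that concentrates at the multiples of H, hence
    converges to the sum of the translates; the trigonometric sums converge by themselves, so
    they have the same limit. All estimates are uniform on [0, H]. *)
Lemma poisson : forall h H, 0 < h -> h * H = PI -> exists A, 0 <= A /\
  forall u P M, 0 <= u <= H ->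
  Rabs (sqrt PI * cos_sum h u P - H * gauss_sum H u M)
    <= A * (exp (- (INR P * h)) + exp (- (INR M * H))).
Proof.
  intros h H Hh HH.
  assert (HHp : 0 < H) by exact (period_pos h H Hh HH).
  assert (S1 := sqrt_PI_gt_1).
  destruct (cos_sum_cauchy h Hh) as [Bc [Bc0 Hc]].
  destruct (gauss_sum_cauchy H HHp) as [Bg [Bg0 Hg]].
  destruct (fejer_estimate h H Hh HH) as [C [C0 Hf]].
  exists (sqrt PI * Bc + H * Bg).
  split; [nra|]; intros u P M Hu.
  assert (E1 : 1 < exp h) by (rewrite <- exp_0; apply exp_increasing; exact Hh).
  set (eP := exp (- (INR P * h))); set (eM := exp (- (INR M * H))).
  assert (Pp : 0 < eP) by apply exp_pos; assert (Mp : 0 < eM) by apply exp_pos.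
  set (X := Rabs (sqrt PI * cos_sum h u P - H * gauss_sum H u M)).
  set (s := exp h / (exp h - 1)).
  assert (s0 : 0 < s) by (apply Rdiv_lt_0_compat; lra).
  assert (Main : forall K d, 0 < d ->
    INR K * X <= sqrt PI * (Bc * s + INR K * (Bc * eP)) + 1 + C * (H * (d * INR K + 9 / (h * h * d)))
                 + INR K * H * (Bg * eM)).
  { intros K d Hd.
    destruct (gauss_fejer_lim h u K 1 Rlt_0_1) as [B HB].
    (* M + n cells, so that the integral over them is within 1 of its limit *)
    destruct (INR_archimed H B HHp) as [n Hn].
    set (d' := n).
    assert (Z1 := HB ((INR (M + d') + 1 / 2) * H)).
    rewrite <- RtoC_minus, Cmod_R in Z1.
    assert (Hbig : B <= (INR (M + d') + 1 / 2) * H).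
    { rewrite plus_INR; unfold d'; assert (PM := pos_INR M); nra. }
    specialize (Z1 Hbig).
    assert (Z2 := Hf u K (M + d')%nat d Hu Hd).
    assert (Z3 := Hg u M d' Hu); fold eM in Z3.
    assert (Z4 := cesaro_sum_near h Bc Hh Bc0 u P (fun m => Hc u m P) K); fold eP s in Z4.
    set (I := RInt _ _ _) in Z1, Z2.
    set (g1 := gauss_sum H u (M + d')) in *; set (g0 := gauss_sum H u M) in *.
    set (ce := cesaro_sum h u K) in *; set (cp := cos_sum h u P) in *.
    assert (K0 := pos_INR K).
    assert (EX : INR K * X = Rabs (- (sqrt PI * (ce - INR K * cp)) + (- (I - sqrt PI * ce) + ((I - INR K * H * g1) + INR K * H * (g1 - g0))))).
    { unfold X; rewrite <- (Rabs_pos_eq (INR K)) at 1 by exact K0; rewrite <- Rabs_mult; f_equal.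
      ring. }
    rewrite EX.
    eapply Rle_trans; [apply Rabs_triang|].
    eapply Rle_trans; [apply Rplus_le_compat_l, Rabs_triang|].
    eapply Rle_trans; [apply Rplus_le_compat_l, Rplus_le_compat_l, Rabs_triang|].
    rewrite !Rabs_Ropp, !Rabs_mult, (Rabs_pos_eq (sqrt PI)), (Rabs_pos_eq (INR K)), (Rabs_pos_eq H) by lra.
    assert (Y1 : sqrt PI * Rabs (ce - INR K * cp) <= sqrt PI * (Bc * s + INR K * (Bc * eP))).
    { apply Rmult_le_compat_l; [lra|]; eapply Rle_trans; [exact Z4|].
      assert (Q := exp_pos (- (INR K * h))).
      assert (0 <= Bc * s) by (apply Rmult_le_pos; lra); nra. }
    assert (Y2 : INR K * H * Rabs (g1 - g0) <= INR K * H * (Bg * eM)).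
    { apply Rmult_le_compat_l; [apply Rmult_le_pos; lra | exact Z3]. }
    lra. }
  (* d absorbs the part of the error that K does not make small; K is then taken so large that
     the constant W is less than K eta / 2. *)
  apply le_epsilon; intros eta He.
  set (d := eta / (2 * (C * H + 1))).
  assert (CH : 0 <= C * H) by (apply Rmult_le_pos; lra).
  assert (d0 : 0 < d) by (apply Rdiv_lt_0_compat; lra).
  assert (dd : C * H * d <= eta / 2).
  { apply Rmult_le_reg_r with (2 * (C * H + 1)); [lra|].
    unfold d; field_simplify; nra. }
  set (W := sqrt PI * (Bc * s) + 1 + C * (H * (9 / (h * h * d)))).
  destruct (INR_archimed (eta / 2) W ltac:(lra)) as [K HK].
  assert (K1 : INR K + 1 > 0) by (assert (A := pos_INR K); lra).
  assert (A := Main (S K) d d0); rewrite S_INR in A.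
  apply Rmult_le_reg_l with (INR K + 1); [lra|].
  assert (dd2 : (INR K + 1) * (C * H * d) <= (INR K + 1) * (eta / 2)) by (apply Rmult_le_compat_l; lra).
  unfold W in HK.
  assert (0 <= sqrt PI * Bc) by (apply Rmult_le_pos; lra).
  assert (0 <= H * Bg) by (apply Rmult_le_pos; lra).
  assert (0 <= (INR K + 1) * (sqrt PI * Bc) * eM).
  { apply Rmult_le_pos; [apply Rmult_le_pos; lra | lra]. }
  assert (0 <= (INR K + 1) * (H * Bg) * eP).
  { apply Rmult_le_pos; [apply Rmult_le_pos; lra | lra]. }
  eapply Rle_trans; [exact A|].
  nra.
Qed.

(** * The rational sums as expansions in translates of the Faddeeva function *)

Lemma csum1_0 : forall a : nat -> C, sum_n_m a 1 0 = RtoC 0.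
Proof. intros a; rewrite sum_n_m_zero by lia; reflexivity. Qed.

Lemma csum1_S : forall (a : nat -> C) n, sum_n_m a 1 (S n) = (sum_n_m a 1 n + a (S n))%C.
Proof. intros a n; rewrite sum_n_Sm by lia; reflexivity. Qed.

Definition gauss_sgn (e H u : R) (M : nat) : R :=
  gauss u +
  sum_n_m (fun n => e ^ n * (gauss (u + INR n * H)
                           + gauss (u - INR n * H))) 1 M.

Definition mid_cos_sum (h u : R) (K : nat) : R :=
  2 * sum_n (fun k => gauss ((INR k + 1 / 2) * h) * cos (2 * u * ((INR k + 1 / 2) * h))) K.

Lemma gauss_sgn_1 : forall H u M, gauss_sgn 1 H u M = gauss_sum H u M.
Proof.
  intros H u M; unfold gauss_sgn, gauss_sum; f_equal; apply sum_n_m_ext; intros n.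
  rewrite pow1; Rring.
Qed.

(** Twice the even-indexed terms minus all terms leaves alternating signs. *)
Lemma gauss_sgn_double : forall H u M,
  gauss_sgn (-1) H u (2 * M) = 2 * gauss_sum (2 * H) u M - gauss_sum H u (2 * M).
Proof.
  intros H u M; unfold gauss_sgn, gauss_sum; induction M as [|M IH].
  - rewrite !sum1_0; ring.
  - replace (2 * S M)%nat with (S (S (2 * M))) by lia.
    rewrite !sum1_S.
    replace (INR (S M) * (2 * H)) with (INR (S (S (2 * M))) * H)
      by (rewrite !S_INR, mult_INR; simpl; ring).
    set (A := sum_n_m _ 1 (2 * M)) in *; set (B := sum_n_m _ 1 M) in *.
    set (D := sum_n_m (fun n => exp _ + exp _) 1 (2 * M)) in *.
    assert (P0 : (-1) ^ (2 * M) = 1) by (rewrite pow_mult; replace ((-1) ^ 2) with 1 by ring; apply pow1).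
    replace ((-1) ^ S (S (2 * M))) with 1 by (cbn [pow]; rewrite P0; ring).
    replace ((-1) ^ S (2 * M)) with (-1) by (cbn [pow]; rewrite P0; ring).
    lra.
Qed.

(** The nodes of step h/2 that are not nodes of step h are the midpoints. *)
Lemma mid_cos_sum_double : forall h u K,
  mid_cos_sum h u K = cos_sum (h / 2) u (2 * K + 1) - cos_sum h u K.
Proof.
  intros h u K; unfold mid_cos_sum; induction K as [|K IH].
  - replace (2 * 0 + 1)%nat with 1%nat by lia; rewrite sum_O; unfold cos_sum; rewrite sum1_S, !sum1_0.
    simpl INR; replace (1 * (h / 2)) with ((0 + 1 / 2) * h) by field; ring.
  - rewrite sum_Sn; replace (2 * S K + 1)%nat with (S (S (2 * K + 1))) by lia.
    rewrite !cos_sum_S; unfold plus; simpl plus.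
    replace (INR (S (S (2 * K + 1))) * (h / 2)) with ((INR (S K) + 1 / 2) * h)
      by (rewrite !S_INR, plus_INR, mult_INR; simpl; field).
    replace (INR (S (2 * K + 1)) * (h / 2)) with (INR (S K) * h)
      by (rewrite !S_INR, plus_INR, mult_INR; simpl; field).
    cbn in *; lra.
Qed.

Lemma poisson_trap : forall h H, 0 < h -> h * H = PI -> forall eta n1, 0 < eta ->
  exists n0, (n1 <= n0)%nat /\ forall M K u, (n0 <= M)%nat -> (n0 <= K)%nat -> 0 <= u <= H ->
  Rabs (gauss_sum H u M - h / sqrt PI * cos_sum h u K) <= eta.
Proof.
  intros h H Hh HH eta n1 He.
  assert (HHp : 0 < H) by exact (period_pos h H Hh HH).
  assert (S1 := sqrt_PI_gt_1); assert (S2 := sqrt_PI_sqr).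
  destruct (poisson h H Hh HH) as [A [A0 HA]].
  destruct (exp_small (2 * A / H) eta He) as [B HB].
  destruct (INR_archimed (Rmin h H) B ltac:(apply Rmin_glb_lt; assumption)) as [n Hn].
  exists (Nat.max n n1); split; [lia|]; intros M K u HM HK Hu.
  assert (E : Rabs (gauss_sum H u M - h / sqrt PI * cos_sum h u K)
            = / H * Rabs (sqrt PI * cos_sum h u K - H * gauss_sum H u M)).
  { rewrite <- (Rabs_pos_eq (/ H)) by (left; apply Rinv_0_lt_compat, HHp).
    rewrite <- Rabs_mult, Rabs_minus_sym; f_equal.
    replace h with (sqrt PI * sqrt PI / H) at 1 by (rewrite S2, <- HH; field; lra).
    field; lra. }
  rewrite E.
  assert (Hk : forall k x, (n <= k)%nat -> Rmin h H <= x -> exp (- (INR k * x)) <= exp (- B)).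
  { intros k x Hk Hx; apply exp_le_mono.
    assert (INR n <= INR k) by (apply le_INR; exact Hk).
    assert (0 <= INR n) by apply pos_INR.
    assert (0 < Rmin h H) by (apply Rmin_glb_lt; assumption).
    assert (INR n * Rmin h H <= INR k * x) by (apply Rmult_le_compat; lra).
    lra. }
  assert (K1 := Hk K h ltac:(lia) (Rmin_l _ _)); assert (K2 := Hk M H ltac:(lia) (Rmin_r _ _)).
  assert (Z := HA u K M Hu); assert (Z2 := HB B (Rle_refl _)).
  apply Rle_trans with (2 * A / H * exp (- B)); [|exact Z2].
  replace (2 * A / H * exp (- B)) with (/ H * (A * (exp (- B) + exp (- B)))) by (field; lra).
  apply Rmult_le_compat_l; [left; apply Rinv_0_lt_compat, HHp|].
  eapply Rle_trans; [exact Z|]; apply Rmult_le_compat_l; lra.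
Qed.

(** The alternating identity for step h is twice the plain one for step h/2, whose period is 2H,
    minus the plain one for step h. *)
Lemma poisson_mid : forall h H, 0 < h -> h * H = PI -> forall eta n1, 0 < eta ->
  exists M K, (n1 <= M)%nat /\ (n1 <= K)%nat /\ forall u, 0 <= u <= H ->
  Rabs (gauss_sgn (-1) H u M - h / sqrt PI * mid_cos_sum h u K) <= eta.
Proof.
  intros h H Hh HH eta n1 He.
  assert (HHp : 0 < H) by exact (period_pos h H Hh HH).
  assert (S1 := sqrt_PI_gt_1).
  destruct (poisson_trap h H Hh HH (eta / 3) n1 ltac:(lra)) as [n2 [Hn2 P2]].
  destruct (poisson_trap (h / 2) (2 * H) ltac:(lra) ltac:(lra) (eta / 3) n2 ltac:(lra)) as [n3 [Hn3 P3]].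
  exists (2 * n3)%nat, n3; repeat split; try lia; intros u Hu.
  rewrite gauss_sgn_double, mid_cos_sum_double.
  assert (A := P2 (2 * n3)%nat n3 u ltac:(lia) ltac:(lia) Hu).
  assert (B := P3 n3 (2 * n3 + 1)%nat u ltac:(lia) ltac:(lia) ltac:(lra)).
  replace (h / 2 / sqrt PI) with (h / sqrt PI / 2) in B by (field; lra).
  apply Rabs_le_between in A; apply Rabs_le_between in B; apply Rabs_le; lra.
Qed.

(** The integral over u >= 0 of osc z u exp(-(u+a)^2), see [CInt_osc_gauss]. *)
Definition wtrans (z : C) (a : R) : C :=
  (RtoC (sqrt PI / 2) * (RtoC (gauss a) * faddeeva (z + Ci * RtoC a)))%C.

Definition osc (z : C) (u : R) : C := Cexp (2 * Ci * z * RtoC u)%C.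

Lemma Ccont_osc : forall z, Ccont (osc z).
Proof.
  intros z; apply Ccont_Cexp, Ccont_mult; [apply Ccont_const|].
  apply (Ccont_RtoC (fun s => s)); intros s; apply continuous_id.
Qed.

Lemma osc_plus : forall z u v, osc z (u + v) = (osc z u * osc z v)%C.
Proof. intros z u v; unfold osc; rewrite <- Cexp_plus, RtoC_plus; f_equal; ring. Qed.

Lemma Cmod_osc_le : forall z u, 0 <= Im z -> 0 <= u -> Cmod (osc z u) <= 1.
Proof.
  intros [x y] u Hy Hu; unfold osc; rewrite Cmod_Cexp, <- exp_0.
  apply exp_le_mono; simpl in *; nra.
Qed.

Lemma Ccont_osc_mult : forall z (f : R -> R), (forall s, continuous f s) ->
  Ccont (fun u => osc z u * RtoC (f u))%C.
Proof. intros z f Hf; apply Ccont_mult; [apply Ccont_osc | apply Ccont_RtoC, Hf]. Qed.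

Lemma cont_gauss_plus : forall a s, continuous (fun u : R => gauss (u + a)) s.
Proof. intros a s; cont_derive. Qed.

(** The integral over the whole half-line is wtrans z a, and the part beyond H is a translate
    of the same half-line integral. *)
Lemma CInt_osc_gauss : forall z a H,
  CInt (fun u => osc z u * RtoC (gauss (u + a)))%C 0 H
  = (wtrans z a - osc z H * wtrans z (a + H))%C.
Proof.
  intros z a H.
  assert (W : forall a b, CInt (fun u => osc z u * RtoC (gauss (u + a)))%C 0 b
              = (RtoC (gauss a) * wpart (z + Ci * RtoC a) b)%C).
  { intros c b; unfold wpart; rewrite <- (CInt_scal _ _ 0 b (Ccont_wker _)).
    apply CInt_ext; intros u; unfold osc, wker; rewrite <- !Cexp_RtoC, <- !Cexp_plus; f_equal.
    destruct z as [x y]; apply injective_projections; simpl; ring. }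
  assert (L : forall a, Clim (fun b => RtoC (gauss a) * wpart (z + Ci * RtoC a) b)%C (wtrans z a)).
  { intros c; unfold wtrans.
    replace (RtoC (sqrt PI / 2) * (RtoC (gauss c) * faddeeva (z + Ci * RtoC c)))%C
      with (RtoC (gauss c) * (sqrt PI / 2 * faddeeva (z + Ci * RtoC c)))%C
      by (rewrite RtoC_div by lra; ring).
    apply Clim_scal, wpart_lim. }
  apply Clim_unique with (fun _ : R => CInt (fun u => osc z u * RtoC (gauss (u + a)))%C 0 H);
    [apply Clim_const|].
  apply Clim_ext with (2 := Clim_minus _ _ _ _ (L a)
    (Clim_scal (osc z H) _ _ (Clim_shift _ _ (- H) (L (a + H))))); intros b; cbv beta.
  rewrite <- !W.
  rewrite <- (CInt_Chasles _ 0 H b (Ccont_osc_mult z _ (cont_gauss_plus a))).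
  replace (CInt (fun u => osc z u * RtoC (gauss (u + a)))%C H b)
    with (osc z H * CInt (fun u => osc z u * RtoC (gauss (u + (a + H)))) 0 (b + - H))%C; [ring|].
  rewrite <- (CInt_scal _ _ 0 _ (Ccont_osc_mult z _ (cont_gauss_plus (a + H)))).
  rewrite (CInt_ext _ (fun u => (fun v => osc z v * RtoC (gauss (v + a)))%C (u + H))).
  - rewrite (CInt_shift _ H 0 (b + - H) (Ccont_osc_mult z _ (cont_gauss_plus a))); f_equal; ring.
  - intros u; cbv beta; rewrite osc_plus.
    replace (u + (a + H)) with (u + H + a) by ring; ring.
Qed.

Definition dterm (H : R) (z : C) (n : nat) : C :=
  (RtoC (gauss (INR n * H))
   * (faddeeva (z + Ci * RtoC (INR n * H)) - faddeeva (Ci * RtoC (INR n * H) - z)))%C.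

Notation dsum e H z M := (sum_n_m (fun n => RtoC (e ^ n) * dterm H z n)%C 1 M).

(** For a downward translate the reflection formula splits off the exponential that makes up the
    pole correction. *)
Lemma wtrans_opp : forall z a,
  wtrans z (- a) = (RtoC (sqrt PI) * (Cexp (- z ^ 2) * osc z a)
                   - RtoC (sqrt PI / 2) * (RtoC (gauss a) * faddeeva (Ci * RtoC a - z)))%C.
Proof.
  intros z a; unfold wtrans.
  replace (- a * - a) with (a * a) by ring.
  assert (R := faddeeva_reflect (z + Ci * RtoC (- a))).
  replace (- (z + Ci * RtoC (- a)))%C with (Ci * RtoC a - z)%C in R by (rewrite RtoC_opp; ring).
  replace (faddeeva (z + Ci * RtoC (- a)))
    with (2 * Cexp (- (z + Ci * RtoC (- a)) ^ 2) - faddeeva (Ci * RtoC a - z))%C by (rewrite <- R; ring).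
  assert (E : (RtoC (gauss a) * Cexp (- (z + Ci * RtoC (- a)) ^ 2))%C = (Cexp (- z ^ 2) * osc z a)%C).
  { unfold osc; rewrite <- Cexp_RtoC, <- !Cexp_plus; f_equal.
    destruct z as [x y]; apply injective_projections; simpl; ring. }
  rewrite <- E, RtoC_div by lra.
  field; apply RtoC_neq_0; lra.
Qed.

Lemma wtrans_pair : forall z H n,
  (wtrans z (INR n * H) + wtrans z (- (INR n * H)))%C
  = (RtoC (sqrt PI / 2) * (dterm H z n + 2 * Cexp (- z ^ 2) * osc z (INR n * H)))%C.
Proof.
  intros z H n; rewrite wtrans_opp; unfold wtrans, dterm.
  rewrite RtoC_div by lra; field; apply RtoC_neq_0; lra.
Qed.

Lemma osc_INR : forall z H n, osc z (INR (S n) * H) = (osc z H * osc z (INR n * H))%C.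
Proof. intros z H n; rewrite <- osc_plus; f_equal; rewrite S_INR; ring. Qed.

Lemma gauss_sgn_S : forall e H u M, gauss_sgn e H u (S M) = gauss_sgn e H u M
  + e ^ S M * (gauss (u + INR (S M) * H)
             + gauss (u - INR (S M) * H)).
Proof. intros e H u M; unfold gauss_sgn; rewrite sum1_S; ring. Qed.

Lemma cont_gauss_sgn : forall e H M s, continuous (fun u => gauss_sgn e H u M) s.
Proof.
  intros e H M s; apply (ex_derive_continuous (V := R_NormedModule)).
  induction M as [|M IH].
  - apply ex_derive_ext with (fun u => gauss u).
    + intros u; unfold gauss_sgn; rewrite sum1_0; Rring.
    + auto_derive; auto.
  - apply ex_derive_ext with (fun u => gauss_sgn e H u M
        + e ^ S M * (gauss (u + INR (S M) * H)
                   + gauss (u - INR (S M) * H))).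
    + intros u; rewrite gauss_sgn_S; reflexivity.
    + apply (ex_derive_plus (V := R_NormedModule)); [exact IH | auto_derive; auto].
Qed.

(** The integrals of the single terms are wtrans z a - q wtrans z (a + H) with a = nH, so the sum
    telescopes up to two boundary terms. *)
Lemma CInt_osc_gauss_sgn_aux : forall e z H M, e * e = 1 ->
  CInt (fun u => osc z u * RtoC (gauss_sgn e H u M))%C 0 H
  = ((1 - RtoC e * osc z H) *
       (wtrans z 0 + sum_n_m (fun n => RtoC (e ^ n) * (wtrans z (INR n * H) + wtrans z (- (INR n * H))))%C 1 M)
     + RtoC (e ^ M) * osc z H * (RtoC e * wtrans z (- (INR M * H)) - wtrans z (INR (S M) * H)))%C.
Proof.
  intros e z H M He; induction M as [|M IH].
  - rewrite csum1_0.
    rewrite (CInt_ext _ (fun u => osc z u * RtoC (gauss (u + 0)))%C).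
    + rewrite CInt_osc_gauss.
      replace (0 + H) with (INR 1 * H) by (simpl; ring).
      replace (- (INR 0 * H)) with 0 by (simpl; ring).
      simpl pow; ring.
    + intros u; unfold gauss_sgn; rewrite sum1_0, !Rplus_0_r; reflexivity.
  - rewrite csum1_S; cbv beta.
    set (g := fun a u => (osc z u * RtoC (gauss (u + a)))%C).
    assert (Cg : forall a, Ccont (g a)) by (intros a; apply Ccont_osc_mult, cont_gauss_plus).
    rewrite (CInt_ext _ (fun u => osc z u * RtoC (gauss_sgn e H u M)
                + RtoC (e ^ S M) * (g (INR (S M) * H)%R u + g (- (INR (S M) * H))%R u))%C).
    + rewrite CInt_plus, IH.
      2: apply Ccont_osc_mult, cont_gauss_sgn.
      2: apply Ccont_mult; [apply Ccont_const | apply Ccont_plus; apply Cg].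
      rewrite CInt_scal by (apply Ccont_plus; apply Cg).
      rewrite CInt_plus by apply Cg.
      unfold g; rewrite !CInt_osc_gauss.
      replace (INR (S M) * H + H) with (INR (S (S M)) * H) by (rewrite (S_INR (S M)); ring).
      replace (- (INR (S M) * H) + H) with (- (INR M * H)) by (rewrite S_INR; ring).
      replace (e ^ S M) with (e * e ^ M) by reflexivity; rewrite !RtoC_mult.
      assert (Hee : (RtoC e * RtoC e)%C = 1%C) by (rewrite <- RtoC_mult, He; reflexivity).
      set (E := RtoC e) in *; set (P := RtoC (e ^ M)); set (q := osc z H).
      set (X1 := wtrans z (INR (S M) * H)); set (X2 := wtrans z (- (INR (S M) * H))).
      set (X3 := wtrans z (INR (S (S M)) * H)); set (X4 := wtrans z (- (INR M * H))).
      set (Y := sum_n_m _ 1 M).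
      match goal with |- ?l = ?r => transitivity (r + (E * E - 1) * (P * q * X1))%C end.
      * ring.
      * rewrite Hee; ring.
    + intros u; unfold g; rewrite gauss_sgn_S, !RtoC_plus, RtoC_mult, !RtoC_plus.
      replace (u - INR (S M) * H) with (u + - (INR (S M) * H)) by ring; ring.
Qed.

Lemma osc_0 : forall z, osc z 0 = 1%C.
Proof. intros z; unfold osc; rewrite <- Cexp_0; f_equal; ring. Qed.

Lemma sum_e_dterm : forall e z H M,
  sum_n_m (fun n => RtoC (e ^ n) * (wtrans z (INR n * H) + wtrans z (- (INR n * H))))%C 1 M
  = (RtoC (sqrt PI / 2) * (dsum e H z M
      + 2 * Cexp (- z ^ 2) * sum_n_m (fun n => RtoC (e ^ n) * osc z (INR n * H))%C 1 M))%C.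
Proof.
  intros e z H M; induction M as [|M IH].
  - rewrite !csum1_0; Ceq; ring.
  - rewrite !csum1_S; cbv beta; rewrite IH, wtrans_pair; Ceq; ring.
Qed.

Lemma osc_geometric : forall e z H M, e * e = 1 ->
  ((1 - RtoC e * osc z H) * sum_n_m (fun n => RtoC (e ^ n) * osc z (INR n * H))%C 1 M
   + RtoC (e ^ M) * osc z H * RtoC e * osc z (INR M * H) = RtoC e * osc z H)%C.
Proof.
  intros e z H M He; induction M as [|M IH].
  - rewrite csum1_0; replace (INR 0 * H) with 0 by (simpl; ring); rewrite osc_0; simpl pow; ring.
  - rewrite csum1_S; cbv beta; rewrite osc_INR.
    etransitivity; [|exact IH]; replace (e ^ S M) with (e * e ^ M) by reflexivity; rewrite !RtoC_mult.
    assert (Hee : (RtoC e * RtoC e)%C = 1%C) by (rewrite <- RtoC_mult, He; reflexivity).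
    set (E := RtoC e) in *; set (P := RtoC (e ^ M)); set (q := osc z H); set (qM := osc z (INR M * H)).
    set (S := sum_n_m _ 1 M).
    ring.
Qed.

Lemma CInt_osc_gauss_sgn : forall e z H M, e * e = 1 ->
  CInt (fun u => osc z u * RtoC (gauss_sgn e H u M))%C 0 H
  = (RtoC (sqrt PI / 2) *
      ((1 - RtoC e * osc z H) * (faddeeva z + dsum e H z M)
       + 2 * Cexp (- z ^ 2) * (RtoC e * osc z H)
       - RtoC (e ^ M) * osc z H *
          (RtoC e * (RtoC (gauss (INR M * H)) * faddeeva (Ci * RtoC (INR M * H) - z))
           + RtoC (gauss (INR (S M) * H)) * faddeeva (z + Ci * RtoC (INR (S M) * H)))))%C.
Proof.
  intros e z H M He.
  rewrite CInt_osc_gauss_sgn_aux by exact He.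
  rewrite sum_e_dterm, wtrans_opp.
  assert (G := osc_geometric e z H M He).
  replace (2 * Cexp (- z ^ 2) * (RtoC e * osc z H))%C with (2 * Cexp (- z ^ 2) *
    ((1 - RtoC e * osc z H) * sum_n_m (fun n => RtoC (e ^ n) * osc z (INR n * H)) 1 M
      + RtoC (e ^ M) * osc z H * RtoC e * osc z (INR M * H)))%C by (rewrite G; reflexivity).
  unfold wtrans.
  replace (z + Ci * RtoC 0)%C with z by ring.
  replace (- (0 * 0)) with 0 by ring; rewrite exp_0.
  set (Sq := sum_n_m (fun n => RtoC (e ^ n) * osc z (INR n * H))%C 1 M).
  set (Sd := dsum e H z M).
  rewrite RtoC_div by lra; field; apply RtoC_neq_0; lra.
Qed.

Lemma Ci_neq_0 : Ci <> 0%C.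
Proof. intros Q; apply (f_equal snd) in Q; simpl in Q; lra. Qed.

Lemma CInt_osc_eq : forall (z : C) H, z <> 0%C -> CInt (osc z) 0 H = ((osc z H - 1) / (2 * Ci * z))%C.
Proof.
  intros z H Hz.
  assert (Hc : (2 * Ci * z)%C <> 0%C).
  { repeat apply Cmult_neq_0; [apply RtoC_neq_0; lra | apply Ci_neq_0 | exact Hz]. }
  assert (E := CInt_Cexp_derive (fun u => 2 * Ci * z * RtoC u)%C (fun _ => 2 * Ci * z)%C 0 H).
  rewrite (CInt_ext _ (fun s => (2 * Ci * z) * osc z s)%C), (CInt_scal _ _ _ _ (Ccont_osc z)) in E
    by reflexivity.
  fold (osc z H) in E; fold (osc z 0) in E; rewrite osc_0 in E.
  rewrite <- E.
  - field; repeat split; first [exact Hz | apply Ci_neq_0 | apply RtoC_neq_0; lra].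
  - intros s; simpl; auto_derive; [auto | ring].
  - intros s; simpl; auto_derive; [auto | ring].
  - apply Ccont_const.
Qed.

Definition rat_term (z : C) (s : R) : C := (RtoC (exp (- s ^ 2)) / (z ^ 2 - RtoC s ^ 2))%C.

Lemma osc_add_l : forall z w u, osc (z + w) u = (osc z u * osc w u)%C.
Proof. intros z w u; unfold osc; rewrite <- Cexp_plus; f_equal; ring. Qed.

(** At a node s the factor exp(2isH) is e, so both exponentials of the cosine contribute the same
    numerator, and the two simple fractions add up to one with denominator z^2 - s^2. *)
Lemma CInt_osc_cos : forall e z s H, e * e = 1 -> osc (RtoC s) H = RtoC e ->
  (z ^ 2 - RtoC s ^ 2)%C <> 0%C ->
  CInt (fun u => osc z u * RtoC (gauss s * cos (2 * u * s)))%C 0 H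
  = ((1 - RtoC e * osc z H) * (Ci / 2 * z * rat_term z s))%C.
Proof.
  intros e z s H He Hs Hz.
  assert (H1 : (z + RtoC s)%C <> 0%C).
  { intros E; apply Hz; replace (z ^ 2 - RtoC s ^ 2)%C with ((z + RtoC s) * (z - RtoC s))%C by ring.
    rewrite E; ring. }
  assert (H2 : (z + - RtoC s)%C <> 0%C).
  { intros E; apply Hz; replace (z ^ 2 - RtoC s ^ 2)%C with ((z + RtoC s) * (z + - RtoC s))%C by ring.
    rewrite E; ring. }
  assert (Hee : (RtoC e * RtoC e)%C = 1%C) by (rewrite <- RtoC_mult, He; reflexivity).
  assert (Hs' : osc (- RtoC s) H = RtoC e).
  { assert (Q : (osc (- RtoC s) H * osc (RtoC s) H)%C = 1%C).
    { rewrite <- osc_add_l; unfold osc; rewrite <- Cexp_0; f_equal; ring. }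
    rewrite Hs in Q.
    transitivity (osc (- RtoC s) H * RtoC e * RtoC e)%C; [|rewrite Q; ring].
    rewrite <- Cmult_assoc, Hee; ring. }
  rewrite (CInt_ext _ (fun u => RtoC (gauss s / 2) * (osc (z + RtoC s) u + osc (z + - RtoC s) u))%C).
  - rewrite (CInt_scal _ _ 0 H (Ccont_plus _ _ (Ccont_osc (z + RtoC s)) (Ccont_osc (z + - RtoC s)))).
    rewrite (CInt_plus _ _ 0 H (Ccont_osc (z + RtoC s)) (Ccont_osc (z + - RtoC s))).
    change (fun s0 : R => osc (z + RtoC s) s0) with (osc (z + RtoC s)).
    rewrite (CInt_osc_eq (z + RtoC s) H H1), (CInt_osc_eq (z + - RtoC s) H H2).
    rewrite !osc_add_l, Hs, Hs'.
    unfold rat_term; replace (- s ^ 2) with (- (s * s)) by ring.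
    rewrite RtoC_div by lra.
    set (q := osc z H); set (E := RtoC e); set (x := RtoC (gauss s)).
    assert (Hi : (Ci * Ci)%C = (- (1))%C) by (apply injective_projections; simpl; ring).
    assert (Hci := Ci_neq_0).
    replace (Ci / 2)%C with (- (1) / (2 * Ci))%C.
    + field; repeat split; try assumption; apply RtoC_neq_0; lra.
    + transitivity (Ci * Ci / (2 * Ci))%C; [rewrite Hi; reflexivity|].
      field; repeat split; first [assumption | apply RtoC_neq_0; lra].
  - intros u; rewrite !osc_add_l.
    replace (RtoC (gauss s * cos (2 * u * s)))
      with (RtoC (gauss s / 2) * (osc (RtoC s) u + osc (- RtoC s) u))%C; [ring|].
    unfold osc, Cexp; apply injective_projections; simpl.
    + match goal with |- context [exp ?a * cos ?b + exp ?c * cos ?d] =>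
        replace a with 0 by ring; replace b with (2 * u * s) by ring;
        replace c with 0 by ring; replace d with (- (2 * u * s)) by ring end.
      rewrite cos_neg, exp_0; field.
    + match goal with |- context [exp ?a * sin ?b + exp ?c * sin ?d] =>
        replace a with 0 by ring; replace b with (2 * u * s) by ring;
        replace c with 0 by ring; replace d with (- (2 * u * s)) by ring end.
      rewrite sin_neg, exp_0; field.
Qed.

Definition trap_sum (h : R) (z : C) (K : nat) : C :=
  (Ci * h / (PI * z) + 2 * Ci * h * z / PI * sum_n_m (fun k => rat_term z (INR k * h)) 1 K)%C.

Definition mid_sum (h : R) (z : C) (K : nat) : C :=
  (2 * Ci * h * z / PI * sum_n (fun k => rat_term z ((INR k + 1 / 2) * h)) K)%C.

Lemma osc_node : forall h H k, h * H = PI -> osc (RtoC (INR k * h)) H = RtoC 1.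
Proof.
  intros h H k HH; unfold osc, Cexp; apply injective_projections; simpl.
  - match goal with |- exp ?a * cos ?b = _ =>
      replace a with 0 by ring; replace b with (0 + INR k * (2 * PI)) by (rewrite <- HH; ring) end.
    rewrite exp_0, cos_nat_period, cos_0; ring.
  - match goal with |- exp ?a * sin ?b = _ =>
      replace b with (INR (2 * k) * PI) by (rewrite mult_INR, <- HH; simpl; ring) end.
    rewrite sin_nat_PI; ring.
Qed.

Lemma osc_midnode : forall h H k, h * H = PI -> osc (RtoC ((INR k + 1 / 2) * h)) H = RtoC (-1).
Proof.
  intros h H k HH; unfold osc, Cexp; apply injective_projections; simpl.
  - match goal with |- exp ?a * cos ?b = _ =>
      replace a with 0 by ring; replace b with (PI + INR k * (2 * PI)) by (rewrite <- HH; field) end.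
    rewrite exp_0, cos_nat_period, cos_PI; ring.
  - match goal with |- exp ?a * sin ?b = _ =>
      replace b with (INR (2 * k + 1) * PI) by (rewrite plus_INR, mult_INR, <- HH; simpl; field) end.
    rewrite sin_nat_PI; ring.
Qed.

Lemma cont_cos_sum : forall h K s, continuous (fun u => cos_sum h u K) s.
Proof.
  intros h K s; apply (ex_derive_continuous (V := R_NormedModule)).
  induction K as [|K IH].
  - apply ex_derive_ext with (fun _ => 1).
    + intros u; unfold cos_sum; rewrite sum1_0; Rring.
    + apply ex_derive_const.
  - apply ex_derive_ext with (fun u => cos_sum h u K
        + 2 * (gauss (INR (S K) * h) * cos (2 * u * (INR (S K) * h)))).
    + intros u; rewrite cos_sum_S; reflexivity.
    + apply (ex_derive_plus (V := R_NormedModule)); [exact IH | auto_derive; auto].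
Qed.

Lemma cont_mid_cos_sum : forall h K s, continuous (fun u => mid_cos_sum h u K) s.
Proof.
  intros h K s; apply continuous_ext with (fun u => cos_sum (h / 2) u (2 * K + 1) - cos_sum h u K).
  - intros u; symmetry; apply mid_cos_sum_double.
  - apply cont_minus; apply cont_cos_sum.
Qed.

Lemma cont_gauss_const_cos : forall s t, continuous (fun u : R => gauss s * cos (2 * u * s)) t.
Proof. intros s t; cont_derive. Qed.

Lemma PI_C_neq_0 : RtoC PI <> 0%C.
Proof. apply RtoC_neq_0; assert (H := PI_gt_3); lra. Qed.

Lemma CInt_osc_cos_sum : forall h H z K, 0 < h -> h * H = PI ->
  (forall k, (z ^ 2 - RtoC (INR k * h) ^ 2)%C <> 0%C) ->
  CInt (fun u => osc z u * RtoC (cos_sum h u K))%C 0 H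
  = ((1 - osc z H) * (RtoC (PI / (2 * h)) * trap_sum h z K))%C.
Proof.
  intros h H z K Hh HH Hz; unfold trap_sum.
  assert (Hz0 : z <> 0%C).
  { intros E; apply (Hz 0%nat); rewrite E; simpl; rewrite Rmult_0_l; ring. }
  assert (Hhc : RtoC h <> 0%C) by (apply RtoC_neq_0; lra).
  assert (H2c : RtoC 2 <> 0%C) by (apply RtoC_neq_0; lra).
  assert (Hpi := PI_C_neq_0).
  assert (T : forall k, CInt (fun u => osc z u * RtoC (gauss (INR k * h) * cos (2 * u * (INR k * h))))%C 0 H
              = ((1 - osc z H) * (Ci / 2 * z * rat_term z (INR k * h)))%C).
  { intros k; rewrite (CInt_osc_cos 1) by (try ring; try apply osc_node; auto); ring. }
  rewrite RtoC_div, RtoC_mult by lra.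
  induction K as [|K IH].
  - rewrite csum1_0.
    assert (T0 := T 0%nat).
    replace (INR 0 * h) with 0 in T0 by (simpl; ring).
    rewrite (CInt_ext _ (fun u => osc z u * RtoC (gauss 0 * cos (2 * u * 0)))%C).
    + rewrite T0; unfold rat_term; replace (- 0 ^ 2) with 0 by ring; rewrite exp_0.
      replace (z ^ 2 - RtoC 0 ^ 2)%C with (z * z)%C by ring.
      field; repeat split; assumption.
    + intros u; unfold cos_sum; rewrite sum1_0; replace (2 * u * 0) with 0 by ring.
      replace (- (0 * 0)) with 0 by ring; rewrite exp_0, cos_0; do 2 f_equal; ring.
  - rewrite csum1_S.
    set (s := INR (S K) * h) in *.
    rewrite (CInt_ext _ (fun u => osc z u * RtoC (cos_sum h u K)
       + 2 * (osc z u * RtoC (gauss s * cos (2 * u * s))))%C).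
    + rewrite (CInt_plus (fun u => osc z u * RtoC (cos_sum h u K))%C), IH, CInt_scal.
      * unfold s; rewrite T; fold s; field; repeat split; assumption.
      * apply Ccont_osc_mult, cont_gauss_const_cos.
      * apply Ccont_osc_mult, cont_cos_sum.
      * apply Ccont_mult; [apply Ccont_const | apply Ccont_osc_mult, cont_gauss_const_cos].
    + intros u; rewrite cos_sum_S; fold s; rewrite RtoC_plus, (RtoC_mult 2); ring.
Qed.

Lemma CInt_osc_mid_cos_sum : forall h H z K, 0 < h -> h * H = PI ->
  (forall k, (z ^ 2 - RtoC ((INR k + 1 / 2) * h) ^ 2)%C <> 0%C) ->
  CInt (fun u => osc z u * RtoC (mid_cos_sum h u K))%C 0 H
  = ((1 - RtoC (-1) * osc z H) * (RtoC (PI / (2 * h)) * mid_sum h z K))%C.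
Proof.
  intros h H z K Hh HH Hz; unfold mid_sum.
  assert (Hhc : RtoC h <> 0%C) by (apply RtoC_neq_0; lra).
  assert (H2c : RtoC 2 <> 0%C) by (apply RtoC_neq_0; lra).
  assert (Hpi := PI_C_neq_0).
  assert (T : forall k, CInt (fun u => osc z u * RtoC (gauss ((INR k + 1 / 2) * h) * cos (2 * u * ((INR k + 1 / 2) * h))))%C 0 H
              = ((1 - RtoC (-1) * osc z H) * (Ci / 2 * z * rat_term z ((INR k + 1 / 2) * h)))%C).
  { intros k; apply (CInt_osc_cos (-1)); [ring | apply osc_midnode, HH | apply Hz]. }
  rewrite RtoC_div, RtoC_mult by lra.
  induction K as [|K IH].
  - rewrite sum_O.
    set (s := (INR 0 + 1 / 2) * h) in *.
    rewrite (CInt_ext _ (fun u => 2 * (osc z u * RtoC (gauss s * cos (2 * u * s))))%C).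
    + rewrite CInt_scal by apply Ccont_osc_mult, cont_gauss_const_cos.
      unfold s; rewrite T; fold s; field; repeat split; assumption.
    + intros u; unfold mid_cos_sum; rewrite sum_O; fold s; rewrite (RtoC_mult 2); ring.
  - rewrite sum_Sn.
    set (s := (INR (S K) + 1 / 2) * h) in *.
    rewrite (CInt_ext _ (fun u => osc z u * RtoC (mid_cos_sum h u K)
       + 2 * (osc z u * RtoC (gauss s * cos (2 * u * s))))%C).
    + rewrite (CInt_plus (fun u => osc z u * RtoC (mid_cos_sum h u K))%C), IH, CInt_scal.
      * unfold s; rewrite T; fold s; change plus with Cplus; field; repeat split; assumption.
      * apply Ccont_osc_mult, cont_gauss_const_cos.
      * apply Ccont_osc_mult, cont_mid_cos_sum.
      * apply Ccont_mult; [apply Ccont_const | apply Ccont_osc_mult, cont_gauss_const_cos].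
    + intros u; unfold mid_cos_sum; rewrite sum_Sn; fold s; change plus with Rplus.
      rewrite Rmult_plus_distr_l, RtoC_plus, (RtoC_mult 2 (exp _ * _)); ring.
Qed.

(** The identity obtained by integrating both sides of Poisson summation against osc z over
    [0, H]. Dividing by 1 - e q, where q = osc z H, leaves the pole correction of the
    modified rules. *)
Lemma rule_expansion : forall e h H z (g : R -> nat -> R) (T : nat -> C),
  e * e = 1 -> 0 < h -> h * H = PI -> 0 <= Im z -> (1 - RtoC e * osc z H)%C <> 0%C ->
  (forall K s, continuous (fun u => g u K) s) ->
  (forall eta n1, 0 < eta -> exists M K, (n1 <= M)%nat /\ (n1 <= K)%nat /\
     forall u, 0 <= u <= H -> Rabs (gauss_sgn e H u M - h / sqrt PI * g u K) <= eta) ->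
  (forall K, CInt (fun u => osc z u * RtoC (g u K))%C 0 H
             = ((1 - RtoC e * osc z H) * (RtoC (PI / (2 * h)) * T K))%C) ->
  forall eta n1, 0 < eta -> exists M K, (n1 <= M)%nat /\ (n1 <= K)%nat /\
    Cmod (faddeeva z + dsum e H z M
          + 2 * Cexp (- z ^ 2) * (RtoC e * osc z H / (1 - RtoC e * osc z H)) - T K)%C <= eta.
Proof.
  intros e h H z g T He Hh HH Hz Hq Cg HP HI eta n1 Heta.
  assert (HHp : 0 < H) by exact (period_pos h H Hh HH).
  assert (S1 := sqrt_PI_gt_1); assert (S2 := sqrt_PI_sqr).
  set (den := (1 - RtoC e * osc z H)%C) in *.
  set (m := Cmod den).
  assert (m0 : 0 < m) by (apply Cmod_gt_0, Hq).
  assert (em : 0 < eta * m) by (apply Rmult_lt_0_compat; assumption).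
  destruct (gauss_small 2 (eta * m / 2) ltac:(lra)) as [B HB].
  destruct (INR_archimed H (Rmax B (Im z)) HHp) as [n2 Hn2].
  destruct (HP (eta * m / (4 * H)) (Nat.max n1 n2)) as [M [K [HM [HK HMK]]]].
  { apply Rdiv_lt_0_compat; lra. }
  exists M, K; repeat split; try lia.
  assert (LB := Rmax_l B (Im z)); assert (LI := Rmax_r B (Im z)).
  assert (MH : Rmax B (Im z) <= INR M * H).
  { assert (INR n2 <= INR M) by (apply le_INR; lia); nra. }
  assert (MH0 : 0 <= INR M * H) by (apply Rmult_le_pos; [apply pos_INR | lra]).
  set (D := dsum e H z M).
  set (q := osc z H) in *.
  set (tail := (RtoC (e ^ M) * q *
          (RtoC e * (RtoC (gauss (INR M * H)) * faddeeva (Ci * RtoC (INR M * H) - z))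
           + RtoC (gauss (INR (S M) * H)) * faddeeva (z + Ci * RtoC (INR (S M) * H))))%C).
  assert (E1 := CInt_osc_gauss_sgn e z H M He).
  fold q den D tail in E1.
  assert (E2 := HI K).
  assert (HX : ((faddeeva z + D + 2 * Cexp (- z ^ 2) * (RtoC e * q / den) - T K) * den)%C
    = (RtoC (2 / sqrt PI) * CInt (fun u => osc z u * RtoC (gauss_sgn e H u M - h / sqrt PI * g u K)) 0 H + tail)%C).
  { rewrite (CInt_ext _ (fun u => osc z u * RtoC (gauss_sgn e H u M) - RtoC (h / sqrt PI) * (osc z u * RtoC (g u K)))%C)
      by (intros u; rewrite RtoC_minus, (RtoC_mult (h / sqrt PI)); ring).
    rewrite CInt_minus, CInt_scal, E1, E2.
    - assert (Hh' : RtoC h <> 0%C) by (apply RtoC_neq_0; lra).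
      assert (Hs' : RtoC (sqrt PI) <> 0%C) by (apply RtoC_neq_0; lra).
      assert (H2' : RtoC 2 <> 0%C) by (apply RtoC_neq_0; lra).
      replace (RtoC (PI / (2 * h))) with (RtoC (sqrt PI) * RtoC (sqrt PI) / (2 * RtoC h))%C.
      + rewrite !RtoC_div by lra; field; repeat split; assumption.
      + rewrite RtoC_div, RtoC_mult by lra; rewrite <- S2 at 3; rewrite RtoC_mult; reflexivity.
    - apply Ccont_osc_mult, Cg.
    - apply Ccont_osc_mult, cont_gauss_sgn.
    - apply Ccont_mult; [apply Ccont_const | apply Ccont_osc_mult, Cg]. }
  assert (Hint : Cmod (CInt (fun u => osc z u * RtoC (gauss_sgn e H u M - h / sqrt PI * g u K))%C 0 H) <= eta * m / 4).
  { replace (eta * m / 4) with (RInt (fun _ => eta * m / (4 * H)) 0 H).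
    - apply Cmod_CInt_le; [lra | | intros; apply continuous_const |].
      + apply (Ccont_osc_mult z (fun u => gauss_sgn e H u M - h / sqrt PI * g u K)); intros s.
        apply cont_minus; [apply cont_gauss_sgn|].
        apply cont_mult; [apply continuous_const | apply Cg].
      + intros u Hu; rewrite Cmod_mult, Cmod_R.
        assert (A := Cmod_osc_le z u Hz ltac:(lra)); assert (A' := HMK u Hu).
        assert (P := Cmod_ge_0 (osc z u)); assert (P' := Rabs_pos (gauss_sgn e H u M - h / sqrt PI * g u K)).
        nra.
    - rewrite RInt_cst; Req; field; lra. }
  assert (Ae : Rabs e = 1).
  { assert (Rabs e * Rabs e = 1) by (rewrite <- Rabs_mult, He; apply Rabs_R1).
    assert (P := Rabs_pos e); nra. }
  assert (Htail : Cmod tail <= eta * m / 2).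
  { assert (B1 := HB (INR M * H) ltac:(lra)).
    unfold tail; rewrite !Cmod_mult, Cmod_R, <- RPow_abs, Ae, pow1.
    assert (Q1 := Cmod_osc_le z H Hz ltac:(lra)); fold q in Q1.
    assert (Q2 : Cmod (RtoC e * (RtoC (gauss (INR M * H)) * faddeeva (Ci * RtoC (INR M * H) - z))
           + RtoC (gauss (INR (S M) * H)) * faddeeva (z + Ci * RtoC (INR (S M) * H)))%C
           <= 2 * exp (- (INR M * H * (INR M * H)))).
    { eapply Rle_trans; [apply Cmod_triangle|].
      rewrite !Cmod_mult, !Cmod_R, Ae, !(Rabs_pos_eq (exp _)) by (left; apply exp_pos).
      assert (W1 : Cmod (faddeeva (Ci * RtoC (INR M * H) - z)) <= 1).
      { apply faddeeva_le_1; destruct z; simpl in *; lra. }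
      assert (W2 : Cmod (faddeeva (z + Ci * RtoC (INR (S M) * H))) <= 1).
      { apply faddeeva_le_1; rewrite S_INR; destruct z; simpl in *; nra. }
      assert (X1 := exp_pos (- (INR M * H * (INR M * H)))).
      assert (X2 := exp_pos (- (INR (S M) * H * (INR (S M) * H)))).
      assert (X3 : exp (- (INR (S M) * H * (INR (S M) * H))) <= exp (- (INR M * H * (INR M * H)))).
      { apply exp_le_mono; rewrite S_INR; nra. }
      assert (Y1 := Cmod_ge_0 (faddeeva (Ci * RtoC (INR M * H) - z))).
      assert (Y2 := Cmod_ge_0 (faddeeva (z + Ci * RtoC (INR (S M) * H)))).
      nra. }
    assert (Q3 := Cmod_ge_0 q).
    match goal with |- 1 * Cmod q * ?t <= _ => assert (Q4 : 0 <= t) by apply Cmod_ge_0; set (t0 := t) in * end.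
    apply Rle_trans with t0; [nra | lra]. }
  apply Rmult_le_reg_r with m; [exact m0|].
  unfold m; rewrite <- Cmod_mult, HX; fold m.
  eapply Rle_trans; [apply Cmod_triangle|].
  rewrite Cmod_mult, Cmod_R, Rabs_pos_eq by (apply Rlt_le, Rdiv_lt_0_compat; lra).
  assert (Hs : 2 / sqrt PI <= 2).
  { apply Rle_div_l; lra. }
  assert (Hs0 : 0 <= 2 / sqrt PI) by (apply Rlt_le, Rdiv_lt_0_compat; lra).
  set (c := Cmod (CInt _ 0 H)) in *.
  assert (c0 : 0 <= c) by apply Cmod_ge_0.
  assert (2 / sqrt PI * c <= 2 * c) by (apply Rmult_le_compat_r; assumption).
  lra.
Qed.

Lemma trap_expansion : forall h H z, 0 < h -> h * H = PI -> 0 <= Im z ->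
  (1 - RtoC 1 * osc z H)%C <> 0%C ->
  (forall k, (z ^ 2 - RtoC (INR k * h) ^ 2)%C <> 0%C) ->
  forall eta n1, 0 < eta -> exists M K, (n1 <= M)%nat /\ (n1 <= K)%nat /\
    Cmod (faddeeva z + dsum 1 H z M
          + 2 * Cexp (- z ^ 2) * (RtoC 1 * osc z H / (1 - RtoC 1 * osc z H)) - trap_sum h z K)%C <= eta.
Proof.
  intros h H z Hh HH Hz Hq Hn.
  apply (rule_expansion 1 h H z (fun u K => cos_sum h u K)); try assumption; [ring | | |].
  - intros K s; apply cont_cos_sum.
  - intros eta n1 He; destruct (poisson_trap h H Hh HH eta n1 He) as [n0 [Hn0 P]].
    exists n0, n0; repeat split; try assumption; intros u Hu.
    rewrite gauss_sgn_1; apply P; [lia | lia | exact Hu].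
  - intros K; rewrite (CInt_osc_cos_sum h H z K Hh HH Hn); ring.
Qed.

Lemma mid_expansion : forall h H z, 0 < h -> h * H = PI -> 0 <= Im z ->
  (1 - RtoC (-1) * osc z H)%C <> 0%C ->
  (forall k, (z ^ 2 - RtoC ((INR k + 1 / 2) * h) ^ 2)%C <> 0%C) ->
  forall eta n1, 0 < eta -> exists M K, (n1 <= M)%nat /\ (n1 <= K)%nat /\
    Cmod (faddeeva z + dsum (-1) H z M
          + 2 * Cexp (- z ^ 2) * (RtoC (-1) * osc z H / (1 - RtoC (-1) * osc z H)) - mid_sum h z K)%C <= eta.
Proof.
  intros h H z Hh HH Hz Hq Hn.
  apply (rule_expansion (-1) h H z (fun u K => mid_cos_sum h u K)); try assumption; [ring | | |].
  - intros K s; apply cont_mid_cos_sum.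
  - intros eta n1 He; apply (poisson_mid h H Hh HH eta n1 He).
  - intros K; apply (CInt_osc_mid_cos_sum h H z K Hh HH Hn).
Qed.

(** * Bounds for the discretisation error *)

Lemma Cmod_telescope : forall (T : nat -> C) c rho, 0 <= c -> 0 <= rho < 1 ->
  (forall j, Cmod (T (S j) - T j) <= c * rho ^ j) ->
  forall J, Cmod (T J - T 0%nat) <= c / (1 - rho).
Proof.
  intros T c rho Hc Hr HT J.
  assert (H : Cmod (T J - T 0%nat) <= c / (1 - rho) * (1 - rho ^ J)).
  { induction J as [|J IH].
    - replace (T 0%nat - T 0%nat)%C with (RtoC 0) by ring; rewrite Cmod_0; simpl; lra.
    - replace (T (S J) - T 0%nat)%C with ((T (S J) - T J) + (T J - T 0%nat))%C by ring.
      eapply Rle_trans; [apply Cmod_triangle|].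
      assert (A := HT J); cbn [pow].
      apply Rle_trans with (c * rho ^ J + c / (1 - rho) * (1 - rho ^ J)); [lra|].
      right; field; lra. }
  eapply Rle_trans; [exact H|].
  assert (P : 0 <= rho ^ J) by (apply pow_le; lra).
  assert (Q : 0 <= c / (1 - rho)) by (apply Rmult_le_pos; [lra | left; apply Rinv_0_lt_compat; lra]).
  nra.
Qed.

Lemma INR_S_le_pow2 : forall j, INR (S j) <= 2 ^ j.
Proof.
  induction j as [|j IH]; [simpl; lra|].
  rewrite S_INR; cbn [pow]; assert (1 <= 2 ^ j) by (apply pow_R1_Rle; lra); lra.
Qed.

Lemma exp_INR_mult : forall n x, exp (- (INR n * x)) = exp (- x) ^ n.
Proof.
  induction n as [|n IH]; intros x.
  - simpl; rewrite Rmult_0_l, Ropp_0; apply exp_0.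
  - cbn [pow]; rewrite <- IH, <- exp_plus, S_INR; f_equal; ring.
Qed.

Lemma exp_square_le : forall H j,
  gauss (INR (S j) * H) <= gauss H * gauss H ^ j.
Proof.
  intros H j; change (gauss H * gauss H ^ j) with (gauss H ^ S j).
  rewrite <- exp_INR_mult; apply exp_le_mono.
  assert (1 <= INR (S j)) by (rewrite S_INR; assert (P := pos_INR j); lra).
  replace ((INR (S j) * H) * (INR (S j) * H)) with (INR (S j) * INR (S j) * (H * H)) by ring.
  assert (0 <= H * H) by nra.
  assert (INR (S j) <= INR (S j) * INR (S j)) by nra.
  nra.
Qed.

Lemma gauss_series_abs : forall H c (a : nat -> C), gauss H <= 1 / 16 -> 0 <= c ->
  (forall n, (1 <= n)%nat -> Cmod (a n) <= c * gauss (INR n * H)) ->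
  forall M, Cmod (sum_n_m a 1 M) <= c * gauss H * (16 / 15).
Proof.
  intros H c a Hr Hc Ha M; set (r := gauss H) in *.
  assert (r0 : 0 < r) by apply exp_pos.
  assert (T := Cmod_telescope (fun M => sum_n_m a 1 M) (c * r) r).
  cbv beta in T; rewrite csum1_0 in T.
  replace (sum_n_m a 1 M) with (sum_n_m a 1 M - RtoC 0)%C by (Ceq; ring).
  eapply Rle_trans; [apply T; [nra | lra |]|].
  - intros j; rewrite csum1_S.
    replace (sum_n_m a 1 j + a (S j) - sum_n_m a 1 j)%C with (a (S j)) by (Ceq; ring).
    eapply Rle_trans; [apply Ha; lia|].
    replace (c * r * r ^ j) with (c * (r * r ^ j)) by ring.
    apply Rmult_le_compat_l; [exact Hc | apply exp_square_le].
  - apply Rmult_le_reg_r with (1 - r); [lra|].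
    replace (c * r / (1 - r) * (1 - r)) with (c * r) by (field; lra).
    assert (0 <= c * r) by nra; nra.
Qed.

(** The linear factor n = j + 1 is absorbed by 2^j, which only doubles the ratio of the series. *)
Lemma gauss_series_rel : forall H A (z : C) (a : nat -> C), gauss H <= 1 / 16 -> 0 <= A -> 0 <= H ->
  (forall n, (1 <= n)%nat -> Cmod z * Cmod (a n) <= (A + INR n * H) * gauss (INR n * H)) ->
  forall M, Cmod z * Cmod (sum_n_m a 1 M) <= (A + H) * gauss H * (8 / 7).
Proof.
  intros H A z a Hr HA HH Ha M; set (r := gauss H) in *.
  assert (r0 : 0 < r) by apply exp_pos.
  assert (T := Cmod_telescope (fun M => z * sum_n_m a 1 M)%C ((A + H) * r) (2 * r)).
  cbv beta in T; rewrite csum1_0 in T.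
  rewrite <- Cmod_mult.
  replace (z * sum_n_m a 1 M)%C with (z * sum_n_m a 1 M - z * RtoC 0)%C by (Ceq; ring).
  eapply Rle_trans; [apply T; [nra | lra |]|].
  - intros j; rewrite csum1_S.
    replace (z * (sum_n_m a 1 j + a (S j)) - z * sum_n_m a 1 j)%C with (z * a (S j))%C by (Ceq; ring).
    rewrite Cmod_mult; eapply Rle_trans; [apply Ha; lia|].
    assert (E := exp_square_le H j); fold r in E.
    assert (P := INR_S_le_pow2 j).
    assert (N1 : 1 <= INR (S j)) by (rewrite S_INR; assert (Q := pos_INR j); lra).
    rewrite Rpow_mult_distr.
    apply Rle_trans with ((A + INR (S j) * H) * (r * r ^ j)).
    + apply Rmult_le_compat_l; [nra | exact E].
    + assert (0 <= r * r ^ j) by (apply Rmult_le_pos; [lra | apply pow_le; lra]).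
      assert (A + INR (S j) * H <= (A + H) * 2 ^ j) by nra.
      replace ((A + H) * r * (2 ^ j * r ^ j)) with ((A + H) * 2 ^ j * (r * r ^ j)) by ring.
      apply Rmult_le_compat_r; assumption.
  - apply Rmult_le_reg_r with (1 - 2 * r); [lra|].
    replace ((A + H) * r / (1 - 2 * r) * (1 - 2 * r)) with ((A + H) * r) by (field; lra).
    assert (0 <= (A + H) * r) by nra; nra.
Qed.

Lemma sqrt_PI_gt : 17 / 10 < sqrt PI.
Proof.
  replace (17 / 10) with (sqrt (289 / 100)).
  - apply sqrt_lt_1; [lra | left; apply PI_RGT_0 |]; assert (P := PI_gt_3); lra.
  - replace (289 / 100) with ((17 / 10) * (17 / 10)) by field; apply sqrt_square; lra.
Qed.

(** The constant exceeds 2/sqrt(pi). *)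
Lemma Cmod_mult_faddeeva_le : forall z zeta a, 0 <= Im zeta -> 0 <= a -> Cmod z <= Cmod zeta + a ->
  Cmod z * Cmod (faddeeva zeta) <= 118 / 100 + a.
Proof.
  intros z zeta a Hz Ha H.
  assert (D := faddeeva_decay zeta Hz); assert (L := faddeeva_le_1 zeta Hz).
  assert (P := Cmod_ge_0 (faddeeva zeta)).
  assert (S := sqrt_PI_gt).
  assert (2 / sqrt PI <= 118 / 100) by (apply Rle_div_l; lra).
  nra.
Qed.

Lemma Cmod_le_components : forall x x' y y', Rabs x <= Rabs x' -> Rabs y <= Rabs y' ->
  Cmod (x, y) <= Cmod (x', y').
Proof.
  intros x x' y y' Hx Hy; unfold Cmod; simpl; apply sqrt_le_1_alt.
  assert (A := Rsqr_le_abs_1 x x' Hx); assert (B := Rsqr_le_abs_1 y y' Hy).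
  unfold Rsqr in A, B; lra.
Qed.

Lemma Cmod_shift_up : forall z a, 0 <= Im z -> 0 <= a -> Cmod z <= Cmod (z + Ci * RtoC a).
Proof.
  intros [x y] a Hy Ha; simpl in Hy.
  replace ((x, y) + Ci * RtoC a)%C with (x, y + a) by (apply injective_projections; simpl; ring).
  apply Cmod_le_components; [lra|]; rewrite !Rabs_pos_eq; lra.
Qed.

(** The second value of w is taken at ia - z or at z - ia, whichever lies in the upper half-plane.
    There |z| exceeds |zeta| by at most a, and w(zeta) is at most 1 and at most 2/(sqrt(pi)|zeta|). *)
Lemma translate_pair_le : forall z zeta a (s : C), 0 <= Im z -> 0 <= a -> 0 <= Im zeta ->
  Cmod z <= Cmod zeta + a -> Cmod s = 1 ->
  let X := (RtoC (gauss a) * (faddeeva (z + Ci * RtoC a) + s * faddeeva zeta))%C in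
  Cmod X <= 2 * gauss a /\ Cmod z * Cmod X <= (236 / 100 + a) * gauss a.
Proof.
  intros z zeta a s Hz Ha I2 Hza Hs X; unfold X.
  set (w1 := faddeeva (z + Ci * RtoC a)); set (w2 := faddeeva zeta).
  assert (I1 : 0 <= Im (z + Ci * RtoC a)) by (destruct z; simpl in *; lra).
  assert (A1 := faddeeva_le_1 _ I1); assert (A2 := faddeeva_le_1 _ I2); fold w1 in A1; fold w2 in A2.
  assert (B1 : Cmod z * Cmod w1 <= 118 / 100 + 0).
  { apply Cmod_mult_faddeeva_le; [exact I1 | lra |].
    rewrite Rplus_0_r; apply Cmod_shift_up; lra. }
  assert (B2 : Cmod z * Cmod w2 <= 118 / 100 + a) by (apply Cmod_mult_faddeeva_le; assumption).
  assert (T := Cmod_triangle w1 (s * w2)); rewrite (Cmod_mult s), Hs, Rmult_1_l in T.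
  assert (E := exp_pos (- (a * a))); assert (Z := Cmod_ge_0 z).
  rewrite Cmod_mult, Cmod_R, Rabs_pos_eq by lra.
  split; [nra|].
  rewrite <- Rmult_assoc, (Rmult_comm (Cmod z)), Rmult_assoc, Rmult_comm.
  apply Rmult_le_compat_r; [lra|]; nra.
Qed.

Lemma dterm_low : forall H z n, 0 <= Im z <= INR n * H ->
  Cmod (dterm H z n) <= 2 * gauss (INR n * H) /\
  Cmod z * Cmod (dterm H z n) <= (236 / 100 + INR n * H) * gauss (INR n * H).
Proof.
  intros H z n Hz; set (a := INR n * H) in *.
  replace (dterm H z n) with (RtoC (gauss a) * (faddeeva (z + Ci * RtoC a) + - (1) * faddeeva (Ci * RtoC a - z)))%C
    by (unfold dterm; fold a; ring).
  apply translate_pair_le; [lra | lra | destruct z; simpl in *; lra | | rewrite Cmod_opp; apply Cmod_1].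
  assert (T := Cmod_triangle (- (Ci * RtoC a - z)) (Ci * RtoC a)).
  replace (- (Ci * RtoC a - z) + Ci * RtoC a)%C with z in T by ring.
  rewrite Cmod_opp, Cmod_mult, Cmod_Ci, Cmod_R, Rabs_pos_eq in T by lra; lra.
Qed.

Lemma dterm_pole : forall H z n,
  (dterm H z n + 2 * Cexp (- z ^ 2) * osc z (INR n * H))%C
  = (RtoC (gauss (INR n * H))
     * (faddeeva (z + Ci * RtoC (INR n * H)) + faddeeva (z + Ci * RtoC (- (INR n * H)))))%C.
Proof.
  intros H z n.
  assert (P := wtrans_pair z H n); unfold wtrans in P.
  replace (- (INR n * H) * - (INR n * H)) with ((INR n * H) * (INR n * H)) in P by ring.
  assert (S := sqrt_PI_gt_1).
  assert (Q : RtoC (sqrt PI / 2) <> 0%C) by (apply RtoC_neq_0; lra).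
  apply (f_equal (fun t => (/ RtoC (sqrt PI / 2) * t)%C)) in P.
  transitivity (/ RtoC (sqrt PI / 2) * (RtoC (sqrt PI / 2) * (dterm H z n + 2 * Cexp (- z ^ 2) * osc z (INR n * H))))%C.
  - field; exact Q.
  - rewrite <- P; field; exact Q.
Qed.

Lemma dterm_pole_high : forall H z n, 0 <= H -> INR n * H <= Im z ->
  Cmod (dterm H z n + 2 * Cexp (- z ^ 2) * osc z (INR n * H)) <= 2 * gauss (INR n * H) /\
  Cmod z * Cmod (dterm H z n + 2 * Cexp (- z ^ 2) * osc z (INR n * H))
    <= (236 / 100 + INR n * H) * gauss (INR n * H).
Proof.
  intros H z n HH Hz; rewrite dterm_pole.
  assert (Ha : 0 <= INR n * H) by (apply Rmult_le_pos; [apply pos_INR | lra]).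
  set (a := INR n * H) in *.
  replace (faddeeva (z + Ci * RtoC (- a))) with (1 * faddeeva (z + Ci * RtoC (- a)))%C by ring.
  apply translate_pair_le; [lra | lra | destruct z; simpl in *; lra | | apply Cmod_1].
  assert (T := Cmod_triangle (z + Ci * RtoC (- a)) (Ci * RtoC a)).
  replace (z + Ci * RtoC (- a) + Ci * RtoC a)%C with z in T by (rewrite RtoC_opp; ring).
  rewrite (Cmod_mult Ci), Cmod_Ci, Cmod_R, Rabs_pos_eq in T by lra; lra.
Qed.

Lemma mult_exp_opp_le : forall t, t * exp (- t) <= 1 / 2.
Proof.
  intros t.
  destruct (Rle_lt_dec t 0) as [H|H].
  { assert (P := exp_pos (- t)); nra. }
  assert (E1 : exp t = exp (t / 2) * exp (t / 2)) by (rewrite <- exp_plus; f_equal; field).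
  assert (E2 := exp_ineq1_le (t / 2)).
  assert (E3 : exp t * exp (- t) = 1) by (rewrite <- exp_plus, <- exp_0; f_equal; ring).
  assert (P := exp_pos (- t)).
  assert (E4 : (1 + t / 2) * (1 + t / 2) <= exp (t / 2) * exp (t / 2)) by (apply Rmult_le_compat; lra).
  assert (2 * t <= exp t) by (assert (Q := pow2_ge_0 (1 - t / 2)); nra).
  nra.
Qed.

Lemma Cmod_le_sum : forall x y, 0 <= x -> 0 <= y -> Cmod (x, y) <= x + y.
Proof.
  intros x y Hx Hy.
  replace (x, y) with (RtoC x + Ci * RtoC y)%C by (apply injective_projections; simpl; ring).
  eapply Rle_trans; [apply Cmod_triangle|].
  rewrite Cmod_mult, Cmod_Ci, !Cmod_R, !Rabs_pos_eq by assumption; lra.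
Qed.

Lemma Cmod_pole : forall x y a,
  Cmod (2 * Cexp (- (x, y) ^ 2) * osc (x, y) a) = 2 * exp (y * y - x * x - 2 * a * y).
Proof.
  intros x y a; unfold osc; rewrite !Cmod_mult, Cmod_R, !Cmod_Cexp, Rabs_pos_eq, Rmult_assoc, <- exp_plus by lra.
  do 2 f_equal; simpl; ring.
Qed.

(** Below the diagonal the pole term exp(y^2 - x^2 - 2ay) is small for H <= a <= y, so that no
    change of formula is needed when the point passes above the height a. *)
Lemma dterm_wide : forall H x y n, 17 / 10 <= H -> gauss H <= 1 / 16 -> (1 <= n)%nat ->
  0 <= y < x -> INR n * H <= y ->
  Cmod (dterm H (x, y) n) <= 17 / 8 * gauss (INR n * H) /\
  Cmod (x, y) * Cmod (dterm H (x, y) n) <= (372 / 100 + INR n * H) * gauss (INR n * H).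
Proof.
  intros H x y n HH Hr Hn Hxy Hny.
  destruct (dterm_pole_high H (x, y) n ltac:(lra) Hny) as [B1 B2].
  assert (P := Cmod_pole x y (INR n * H)).
  assert (Ha : H <= INR n * H).
  { assert (1 <= INR n) by (apply (le_INR 1); exact Hn); nra. }
  set (a := INR n * H) in *.
  set (p := (2 * Cexp (- (x, y) ^ 2) * osc (x, y) a)%C) in *.
  set (E := gauss a) in *.
  assert (E0 : 0 < E) by apply exp_pos.
  assert (E1 : E <= 1 / 16).
  { apply Rle_trans with (2 := Hr); apply exp_le_mono; nra. }
  assert (T : Cmod (dterm H (x, y) n) <= Cmod (dterm H (x, y) n + p) + Cmod p).
  { assert (T := Cmod_triangle (dterm H (x, y) n + p) (- p)).
    replace (dterm H (x, y) n + p + - p)%C with (dterm H (x, y) n) in T by ring.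
    rewrite Cmod_opp in T; exact T. }
  assert (EY : exp (- (a * y)) <= E) by (apply exp_le_mono; nra).
  assert (EY0 := exp_pos (- (a * y))).
  assert (Pp : Cmod p <= 2 * (exp (- (x - y)) * (exp (- (a * y)) * exp (- (a * y))))).
  { rewrite P; apply Rmult_le_compat_l; [lra|]; rewrite <- !exp_plus; apply exp_le_mono; nra. }
  assert (D1 : exp (- (x - y)) <= 1) by (rewrite <- exp_0; apply exp_le_mono; lra).
  assert (D0 := exp_pos (- (x - y))).
  assert (D2 := mult_exp_opp_le (x - y)).
  assert (Y2 := mult_exp_opp_le (a * y)).
  assert (Y3 : y * exp (- (a * y)) <= 10 / 34) by nra.
  split.
  - assert (exp (- (x - y)) * (exp (- (a * y)) * exp (- (a * y))) <= E * (1 / 16)).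
    { assert (exp (- (a * y)) * exp (- (a * y)) <= E * (1 / 16)) by (apply Rmult_le_compat; lra).
      nra. }
    lra.
  - assert (Z := Cmod_le_sum x y ltac:(lra) ltac:(lra)); assert (Z0 := Cmod_ge_0 (x, y)).
    assert (Q1 : (x + y) * exp (- (x - y)) <= 2 * y + 1 / 2) by nra.
    assert (Q2 : (2 * y + 1 / 2) * exp (- (a * y)) <= 65 / 100) by lra.
    assert (Q : Cmod (x, y) * Cmod p <= 136 / 100 * E).
    { apply Rle_trans with ((x + y) * (2 * (exp (- (x - y)) * (exp (- (a * y)) * exp (- (a * y)))))).
      - apply Rmult_le_compat; [exact Z0 | apply Cmod_ge_0 | exact Z | exact Pp].
      - replace ((x + y) * (2 * (exp (- (x - y)) * (exp (- (a * y)) * exp (- (a * y))))))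
          with (2 * (((x + y) * exp (- (x - y))) * exp (- (a * y)) * exp (- (a * y)))) by ring.
        assert (W1 : (x + y) * exp (- (x - y)) * exp (- (a * y)) <= 65 / 100).
        { apply Rle_trans with ((2 * y + 1 / 2) * exp (- (a * y))); [|exact Q2].
          apply Rmult_le_compat_r; [lra | exact Q1]. }
        assert (W0 : 0 <= (x + y) * exp (- (x - y)) * exp (- (a * y))).
        { apply Rmult_le_pos; [apply Rmult_le_pos|]; lra. }
        nra. }
    assert (Cmod (x, y) * Cmod (dterm H (x, y) n) <= Cmod (x, y) * (Cmod (dterm H (x, y) n + p) + Cmod p))
      by (apply Rmult_le_compat_l; assumption).
    lra.
Qed.

Lemma Cmod_sign_pow : forall e n (c : C), Rabs e = 1 -> Cmod (RtoC (e ^ n) * c) = Cmod c.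
Proof. intros e n c He; rewrite Cmod_mult, Cmod_R, <- RPow_abs, He, pow1; ring. Qed.

(** Terms of index n with nH above y are small because both values of w are taken in the upper
    half-plane; the others occur only below the diagonal. *)
Lemma discretisation_modified : forall H e x y, 17 / 10 <= H -> gauss H <= 1 / 16 -> Rabs e = 1 ->
  0 <= x -> 0 <= y -> (y < x \/ y < H) -> forall M,
  Cmod (dsum e H (x, y) M) <= 227 / 100 * gauss H /\
  Cmod (x, y) * Cmod (dsum e H (x, y) M)
    <= (426 / 100 + 115 / 100 * H) * gauss H.
Proof.
  intros H e x y HH Hr He Hx Hy Hxy M.
  assert (B : forall n, (1 <= n)%nat ->
    Cmod (dterm H (x, y) n) <= 17 / 8 * gauss (INR n * H) /\
    Cmod (x, y) * Cmod (dterm H (x, y) n) <= (372 / 100 + INR n * H) * gauss (INR n * H)).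
  { intros n Hn.
    destruct (Rle_lt_dec y (INR n * H)) as [L|L].
    - destruct (dterm_low H (x, y) n (conj Hy L)) as [B1 B2].
      assert (P := exp_pos (- ((INR n * H) * (INR n * H)))); split; lra.
    - apply dterm_wide; try assumption; [|lra].
      assert (1 <= INR n) by (apply (le_INR 1); exact Hn).
      destruct Hxy as [Hxy|Hxy]; [lra | nra]. }
  assert (P := exp_pos (- (H * H))).
  split.
  - eapply Rle_trans; [apply (gauss_series_abs H (17 / 8)); [exact Hr | lra |]|].
    + intros n Hn; rewrite (Cmod_sign_pow e n _ He); apply B, Hn.
    + lra.
  - eapply Rle_trans; [apply (gauss_series_rel H (372 / 100)); [exact Hr | lra | lra |]|].
    + intros n Hn; rewrite (Cmod_sign_pow e n _ He); apply B, Hn.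
    + nra.
Qed.

(** The terms up to the height y contain the poles of the correction. What is left of the
    correction after these poles are removed is a geometric tail that starts above y. *)
Lemma discretisation_plain : forall H e x y, 17 / 10 <= H -> gauss H <= 1 / 16 -> e * e = 1 ->
  0 <= x <= y -> H <= y -> (1 - RtoC e * osc (x, y) H)%C <> 0%C ->
  exists L, forall M, (L <= M)%nat ->
  let X := (dsum e H (x, y) M
          + 2 * Cexp (- (x, y) ^ 2) * (RtoC e * osc (x, y) H / (1 - RtoC e * osc (x, y) H)))%C in
  Cmod X <= 415 / 100 * gauss H /\
  Cmod (x, y) * Cmod X <= (371 / 100 + 316 / 100 * H) * gauss H.
Proof.
  intros H e x y HH Hr Hee Hxy Hy Hq.
  assert (He : Rabs e = 1).
  { assert (Rabs e * Rabs e = 1) by (rewrite <- Rabs_mult, Hee; apply Rabs_R1).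
    assert (P := Rabs_pos e); nra. }
  set (z := (x, y)) in *.
  assert (HL : exists L, INR L * H <= y < INR (S L) * H).
  { destruct (INR_archimed H y ltac:(lra)) as [n Hn].
    induction n as [|n IH]; [simpl in Hn; lra|].
    destruct (Rle_lt_dec (INR n * H) y) as [A|A]; [exists n; split; lra | apply IH; lra]. }
  destruct HL as [L [HL1 HL2]]; exists L; intros M HM X.
  set (c := (2 * Cexp (- z ^ 2))%C) in *.
  set (b := fun n => if Nat.leb n L then (dterm H z n + c * osc z (INR n * H))%C else dterm H z n).
  assert (Sb : forall d, sum_n_m (fun n => RtoC (e ^ n) * b n)%C 1 (L + d)
    = (dsum e H z (L + d)
       + c * sum_n_m (fun n => RtoC (e ^ n) * osc z (INR n * H)) 1 L)%C).
  { assert (S0 : forall k, (k <= L)%nat -> sum_n_m (fun n => RtoC (e ^ n) * b n)%C 1 k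
      = (dsum e H z k
         + c * sum_n_m (fun n => RtoC (e ^ n) * osc z (INR n * H)) 1 k)%C).
    { induction k as [|k IH]; intros Hk.
      - rewrite !csum1_0; Ceq; ring.
      - rewrite !csum1_S, IH by lia; cbv beta; unfold b at 1.
        replace (Nat.leb (S k) L) with true by (symmetry; apply Nat.leb_le; exact Hk); Ceq; ring. }
    induction d as [|d IH].
    - rewrite Nat.add_0_r; apply S0; lia.
    - replace (L + S d)%nat with (S (L + d)) by lia.
      rewrite (csum1_S _ (L + d)), IH, (csum1_S (fun n => RtoC (e ^ n) * dterm H z n)%C); cbv beta; unfold b at 1.
      replace (Nat.leb (S (L + d)) L) with false by (symmetry; apply Nat.leb_gt; lia); Ceq; ring. }
  set (rem := (c * (RtoC (e ^ L) * osc z H * RtoC e * osc z (INR L * H) / (1 - RtoC e * osc z H)))%C).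
  assert (HX : X = (sum_n_m (fun n => RtoC (e ^ n) * b n) 1 M + rem)%C).
  { replace M with (L + (M - L))%nat by lia; rewrite Sb.
    unfold X, rem; replace (L + (M - L))%nat with M by lia.
    assert (G := osc_geometric e z H L Hee).
    rewrite <- G at 1; field; exact Hq. }
  assert (Bb : forall n, (1 <= n)%nat ->
    Cmod (b n) <= 2 * gauss (INR n * H) /\
    Cmod z * Cmod (b n) <= (236 / 100 + INR n * H) * gauss (INR n * H)).
  { intros n Hn; unfold b; destruct (Nat.leb n L) eqn:El.
    - apply Nat.leb_le in El; apply dterm_pole_high; [lra|].
      assert (INR n <= INR L) by (apply le_INR; exact El); simpl; nra.
    - apply Nat.leb_gt in El; apply dterm_low.
      assert (INR (S L) <= INR n) by (apply le_INR; lia); simpl; nra. }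
  assert (Ey0 := exp_pos (- (y * y))); assert (Ex0 := exp_pos (- (x * x))).
  assert (R0 := exp_pos (- (H * H))).
  assert (Eyr : gauss y <= gauss H) by (apply exp_le_mono; nra).
  assert (Hden : 255 / 256 <= Cmod (1 - RtoC e * osc z H)).
  { assert (Q : Cmod (osc z H) <= 1 / 256).
    { unfold osc, z; rewrite Cmod_Cexp.
      apply Rle_trans with (gauss H * gauss H).
      - rewrite <- exp_plus; apply exp_le_mono; simpl; nra.
      - nra. }
    assert (T := Cmod_triangle (1 - RtoC e * osc z H) (RtoC e * osc z H)).
    replace (1 - RtoC e * osc z H + RtoC e * osc z H)%C with (RtoC 1) in T by ring.
    rewrite Cmod_1, Cmod_mult, Cmod_R, He in T; lra. }
  assert (Hrem : Cmod rem <= 201 / 100 * (gauss x * gauss y)).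
  { unfold rem.
    replace (c * (RtoC (e ^ L) * osc z H * RtoC e * osc z (INR L * H) / (1 - RtoC e * osc z H)))%C
      with (RtoC (e ^ L) * (RtoC e * (c * osc z (INR (S L) * H)) / (1 - RtoC e * osc z H)))%C
      by (rewrite osc_INR; field; exact Hq).
    rewrite (Cmod_sign_pow e L _ He), Cmod_div, (Cmod_mult (RtoC e)), Cmod_R, He by exact Hq.
    unfold c, z; rewrite Cmod_pole; fold z.
    apply Rle_div_l; [lra|].
    assert (Q : exp (y * y - x * x - 2 * (INR (S L) * H) * y) <= gauss x * gauss y).
    { rewrite <- exp_plus; apply exp_le_mono; nra. }
    assert (0 < gauss x * gauss y) by (apply Rmult_lt_0_compat; assumption).
    nra. }
  assert (T := Cmod_triangle (sum_n_m (fun n => RtoC (e ^ n) * b n)%C 1 M) rem).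
  rewrite <- HX in T.
  assert (A1 : Cmod (sum_n_m (fun n => RtoC (e ^ n) * b n)%C 1 M) <= 2 * gauss H * (16 / 15)).
  { apply gauss_series_abs; [exact Hr | lra |].
    intros n Hn; rewrite (Cmod_sign_pow e n _ He); apply Bb, Hn. }
  assert (A2 : Cmod z * Cmod (sum_n_m (fun n => RtoC (e ^ n) * b n)%C 1 M)
               <= (236 / 100 + H) * gauss H * (8 / 7)).
  { apply gauss_series_rel; [exact Hr | lra | lra |].
    intros n Hn; rewrite (Cmod_sign_pow e n _ He); apply Bb, Hn. }
  assert (Ex1 : gauss x <= 1) by (rewrite <- exp_0; apply exp_le_mono; nra).
  split; [nra|].
  assert (Xe : x * gauss x <= 1 / 2).
  { assert (G := exp_ineq1_le (x * x)).
    assert (G' : exp (x * x) * gauss x = 1) by (rewrite <- exp_plus, <- exp_0; f_equal; ring).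
    assert (2 * x <= exp (x * x)) by (assert (Q := pow2_ge_0 (1 - x)); lra).
    assert (2 * x * gauss x <= exp (x * x) * gauss x) by (apply Rmult_le_compat_r; lra).
    lra. }
  assert (Ye : y * gauss y <= H * gauss H).
  { assert (G := exp_ineq1_le (y * y - H * H)).
    assert (G' : exp (y * y - H * H) * gauss y = gauss H) by (rewrite <- exp_plus; f_equal; ring).
    assert (y <= H * exp (y * y - H * H)).
    { apply Rle_trans with (H * (1 + (y * y - H * H))); [|apply Rmult_le_compat_l; lra].
      assert (0 <= (y - H) * (H * (y + H) - 1)) by (apply Rmult_le_pos; nra); nra. }
    rewrite <- G'; rewrite <- Rmult_assoc; apply Rmult_le_compat_r; lra. }
  assert (Zr : Cmod z * Cmod rem <= 201 / 100 * ((1 / 2 + H) * gauss H)).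
  { apply Rle_trans with ((x + y) * (201 / 100 * (gauss x * gauss y))).
    - apply Rmult_le_compat; [apply Cmod_ge_0 | apply Cmod_ge_0 | apply Cmod_le_sum; lra | exact Hrem].
    - replace ((x + y) * (201 / 100 * (gauss x * gauss y)))
        with (201 / 100 * ((x * gauss x) * gauss y + gauss x * (y * gauss y))) by ring.
      assert (0 <= y * gauss y) by (apply Rmult_le_pos; lra).
      nra. }
  assert (Z0 := Cmod_ge_0 z).
  assert (Cmod z * Cmod X <= Cmod z * (Cmod (sum_n_m (fun n => RtoC (e ^ n) * b n)%C 1 M) + Cmod rem))
    by (apply Rmult_le_compat_l; assumption).
  nra.
Qed.

(** * Truncation of the rational sums *)

Lemma Cmod_add_ge : forall x y s, 0 <= x -> 0 <= s ->
  s <= Cmod ((x, y) + RtoC s) /\ Cmod (x, y) <= Cmod ((x, y) + RtoC s).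
Proof.
  intros x y s Hx Hs.
  replace ((x, y) + RtoC s)%C with (x + s, y) by (apply injective_projections; simpl; ring).
  split.
  - assert (R := re_le_Cmod (x + s, y)); simpl in R; rewrite Rabs_pos_eq in R by lra; lra.
  - apply Cmod_le_components; [rewrite !Rabs_pos_eq by lra; lra | lra].
Qed.

(** Split 2z/(z^2 - s^2) into 1/(z - s) + 1/(z + s); multiplied by |z|, the first fraction is at
    most 1 + s/|z - s| and the second at most 1. *)
Lemma rat_term_le : forall x y s d, 0 <= x -> 0 < s -> 0 < d -> d <= Cmod ((x, y) - RtoC s) ->
  Cmod (2 * (x, y) * rat_term (x, y) s) <= gauss s * (/ d + / s) /\
  Cmod (x, y) * Cmod (2 * (x, y) * rat_term (x, y) s) <= gauss s * (2 + s / d).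
Proof.
  intros x y s d Hx Hs Hd Hds.
  destruct (Cmod_add_ge x y s Hx ltac:(lra)) as [P1 P2].
  set (z := (x, y)) in *.
  assert (N1 : (z - RtoC s)%C <> 0%C) by (apply Cmod_gt_0; lra).
  assert (N2 : (z + RtoC s)%C <> 0%C) by (apply Cmod_gt_0; lra).
  assert (E : (2 * z * rat_term z s)%C = (RtoC (gauss s) * (/ (z - RtoC s) + / (z + RtoC s)))%C).
  { unfold rat_term; replace (- s ^ 2) with (- (s * s)) by ring.
    replace (z ^ 2 - RtoC s ^ 2)%C with ((z - RtoC s) * (z + RtoC s))%C by ring.
    field; split; assumption. }
  rewrite E, Cmod_mult, Cmod_R, Rabs_pos_eq by (left; apply exp_pos).
  assert (T := Cmod_triangle (/ (z - RtoC s)) (/ (z + RtoC s))).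
  rewrite !Cmod_inv in T by assumption.
  assert (I1 : / Cmod (z - RtoC s) <= / d) by (apply Rinv_le_contravar; assumption).
  assert (I2 : / Cmod (z + RtoC s) <= / s) by (apply Rinv_le_contravar; assumption).
  assert (P := exp_pos (- (s * s))); assert (Z := Cmod_ge_0 z).
  split; [apply Rmult_le_compat_l; lra|].
  rewrite <- Rmult_assoc, (Rmult_comm (Cmod z)), Rmult_assoc; apply Rmult_le_compat_l; [lra|].
  assert (J1 : Cmod z * / Cmod (z - RtoC s) <= 1 + s / d).
  { assert (Q := Cmod_triangle (z - RtoC s) (RtoC s)).
    assert (Ez : (z - RtoC s + RtoC s)%C = z) by ring.
    rewrite Ez, Cmod_R, (Rabs_pos_eq s) in Q by lra.
    apply Rle_trans with ((Cmod (z - RtoC s) + s) * / Cmod (z - RtoC s)).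
    - apply Rmult_le_compat_r; [left; apply Rinv_0_lt_compat; lra | exact Q].
    - rewrite Rmult_plus_distr_r, Rinv_r by lra.
      apply Rplus_le_compat_l, Rmult_le_compat_l; lra. }
  assert (J2 : Cmod z * / Cmod (z + RtoC s) <= 1).
  { apply (Rle_div_l (Cmod z)); lra. }
  apply Rle_trans with (Cmod z * (/ Cmod (z - RtoC s) + / Cmod (z + RtoC s))).
  - apply Rmult_le_compat_l; lra.
  - lra.
Qed.

Lemma exp_PI_ge_16 : 16 <= exp PI.
Proof.
  assert (P := PI_gt_3).
  assert (E : exp (PI / 32) ^ 32 = exp PI).
  { replace PI with (PI / 32 * 32) at 2 by field.
    rewrite <- (Ropp_involutive (PI / 32)).
    replace (- - (PI / 32) * 32) with (- (INR 32 * - (PI / 32))) by (simpl; ring).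
    rewrite exp_INR_mult; reflexivity. }
  rewrite <- E.
  assert (G := exp_ineq1_le (PI / 32)).
  apply Rle_trans with ((1 + 3 / 32) ^ 32); [simpl; lra | apply pow_incr; lra].
Qed.

Lemma exp_opp_PI_le : exp (- PI) <= 1 / 16.
Proof.
  assert (E := exp_PI_ge_16).
  assert (Q : exp PI * exp (- PI) = 1) by (rewrite <- exp_plus, <- exp_0; f_equal; ring).
  assert (P := exp_pos (- PI)); nra.
Qed.

Lemma gauss_node_le : forall N h s j, 0 < h -> h * h * (INR N + 1) = PI -> INR (S (N + j)) * h <= s ->
  gauss s <= rate N * (1 / 256) ^ j.
Proof.
  intros N h s j Hh HN Hs.
  assert (E : exp (- (INR j * (2 * PI))) <= (1 / 256) ^ j).
  { rewrite exp_INR_mult; apply pow_incr; split; [left; apply exp_pos|].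
    replace (- (2 * PI)) with (- PI + - PI) by ring; rewrite exp_plus.
    assert (A := exp_opp_PI_le); assert (P := exp_pos (- PI)); nra. }
  apply Rle_trans with (rate N * exp (- (INR j * (2 * PI)))).
  - rewrite <- exp_plus; apply exp_le_mono.
    assert (Q : INR (S (N + j)) = INR N + 1 + INR j) by (rewrite S_INR, plus_INR; ring).
    rewrite Q in Hs; assert (Pn := pos_INR N); assert (Pj := pos_INR j).
    assert (0 <= (INR N + 1 + INR j) * h) by (apply Rmult_le_pos; lra).
    assert (((INR N + 1 + INR j) * h) * ((INR N + 1 + INR j) * h) <= s * s) by (apply Rmult_le_compat; lra).
    replace (((INR N + 1 + INR j) * h) * ((INR N + 1 + INR j) * h))
      with ((h * h * (INR N + 1)) * (INR N + 1) + 2 * INR j * (h * h * (INR N + 1)) + (INR j * INR j) * (h * h)) in * by ring.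
    rewrite HN in *.
    assert (0 <= (INR j * INR j) * (h * h)) by (apply Rmult_le_pos; nra).
    lra.
  - apply Rmult_le_compat_l; [left; apply exp_pos | exact E].
Qed.

(** T K is a constant plus the rational sum over the nodes s 1, ..., s K. *)
Definition rational_rule (h : R) (z : C) (s : nat -> R) (T : nat -> C) : Prop :=
  forall k, (T (S k) - T k)%C = (Ci * RtoC (h / PI) * (2 * z * rat_term z (s (S k))))%C.

Lemma rational_rule_increment : forall h z s T k, 0 < h -> rational_rule h z s T ->
  Cmod (T (S k) - T k) = h / PI * Cmod (2 * z * rat_term z (s (S k))).
Proof.
  intros h z s T k Hh HT; assert (P := PI_gt_3).
  rewrite HT, (Cmod_mult (Ci * _)), (Cmod_mult Ci), Cmod_Ci, Cmod_R, Rabs_pos_eq; [ring|].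
  apply Rlt_le, Rdiv_lt_0_compat; lra.
Qed.

Lemma rational_rule_trap : forall h z, 0 < h -> rational_rule h z (fun k => INR k * h) (trap_sum h z).
Proof.
  intros h z Hh k; unfold trap_sum; rewrite csum1_S; assert (P := PI_gt_3).
  rewrite RtoC_div by lra.
  set (A := sum_n_m _ 1 k); set (B := rat_term z (INR (S k) * h)).
  unfold Cdiv; ring.
Qed.

Lemma rational_rule_mid : forall h z, 0 < h ->
  rational_rule h z (fun k => (INR k + 1 / 2) * h) (mid_sum h z).
Proof.
  intros h z Hh k; unfold mid_sum; rewrite sum_Sn; change plus with Cplus; assert (P := PI_gt_3).
  rewrite RtoC_div by lra.
  set (A := sum_n _ k); set (B := rat_term z ((INR (S k) + 1 / 2) * h)).
  unfold Cdiv; ring.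
Qed.

(** The Gaussian weights of the omitted nodes decay with ratio exp(-2 pi) <= 1/256. The parameter q
    leaves room for a weight that grows with the index. *)
Lemma truncation_geometric : forall N h z s T (u : C) c q, 0 < h -> 0 <= c -> 0 <= q <= 2 ->
  rational_rule h z s T -> h * h * (INR N + 1) = PI -> (forall k, INR k * h <= s k) ->
  (forall j, Cmod u * Cmod (2 * z * rat_term z (s (S (N + j))))
             <= gauss (s (S (N + j))) * (c * q ^ j)) ->
  forall K, (N <= K)%nat ->
  Cmod u * Cmod (T K - T N) <= h / PI * c / (1 - q / 256) * rate N.
Proof.
  intros N h z s T u c q Hh Hc Hq HT HN Hs Hu K HK.
  assert (P := PI_gt_3); assert (r0 := exp_pos (- (PI * (INR N + 1)))).
  assert (Hp : 0 < h / PI) by (apply Rdiv_lt_0_compat; lra).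
  assert (Tel := Cmod_telescope (fun j => u * T (N + j)%nat)%C (h / PI * c * rate N) (q / 256)).
  cbv beta in Tel; rewrite Nat.add_0_r in Tel.
  replace K with (N + (K - N))%nat by lia.
  replace (Cmod u * Cmod (T (N + (K - N))%nat - T N)) with (Cmod (u * T (N + (K - N))%nat - u * T N))
    by (rewrite <- Cmod_mult; f_equal; ring).
  eapply Rle_trans; [apply Tel; [|lra|]|].
  - apply Rmult_le_pos; [apply Rmult_le_pos|]; lra.
  - intros j; replace (N + S j)%nat with (S (N + j)) by lia.
    replace (u * T (S (N + j)) - u * T (N + j)%nat)%C
      with (u * (T (S (N + j)) - T (N + j)%nat))%C by ring.
    rewrite Cmod_mult, (rational_rule_increment h z s T _ Hh HT).
    assert (G := gauss_node_le N h _ j Hh HN (Hs (S (N + j)))).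
    assert (B := Hu j).
    assert (C0 : 0 <= c * q ^ j) by (apply Rmult_le_pos; [lra | apply pow_le; lra]).
    replace (q / 256) with (1 / 256 * q) by field; rewrite Rpow_mult_distr.
    replace (h / PI * c * rate N * ((1 / 256) ^ j * q ^ j))
      with (h / PI * (rate N * (1 / 256) ^ j * (c * q ^ j))) by ring.
    rewrite <- Rmult_assoc, (Rmult_comm (Cmod u)), Rmult_assoc.
    apply Rmult_le_compat_l; [lra|].
    eapply Rle_trans; [exact B | apply Rmult_le_compat_r; assumption].
  - right; field; lra.
Qed.

Lemma node_index_ge_1 : forall n, 1 <= INR (S n).
Proof. intros n; rewrite S_INR; assert (Q := pos_INR n); lra. Qed.

Lemma truncation_abs : forall N h x y s T, 0 < h -> h * h * (INR N + 1) = PI -> 0 <= x ->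
  rational_rule h (x, y) s T ->
  (forall k, INR k * h <= s k) -> (forall k, h / 4 <= Cmod ((x, y) - RtoC (s k))) ->
  forall K, (N <= K)%nat -> Cmod (T K - T N) <= 168 / 100 * rate N.
Proof.
  intros N h x y s T Hh HN Hx HT Hs Hd K HK.
  assert (P := PI_gt_3); assert (r0 := exp_pos (- (PI * (INR N + 1)))).
  assert (H5 : 0 < 5 / h) by (apply Rdiv_lt_0_compat; lra).
  replace (Cmod (T K - T N)) with (Cmod 1 * Cmod (T K - T N)) by (rewrite Cmod_1; ring).
  eapply Rle_trans; [apply (truncation_geometric N h (x, y) s T 1 (5 / h) 1); try assumption; try lra|].
  - intros j; rewrite Cmod_1, Rmult_1_l, pow1, Rmult_1_r; set (k := S (N + j)).
    assert (Hk : h <= s k).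
    { apply Rle_trans with (2 := Hs k); assert (Q := node_index_ge_1 (N + j)); unfold k; nra. }
    destruct (rat_term_le x y (s k) (h / 4) Hx ltac:(lra) ltac:(lra) (Hd k)) as [B _].
    eapply Rle_trans; [exact B|]; apply Rmult_le_compat_l; [left; apply exp_pos|].
    assert (/ s k <= / h) by (apply Rinv_le_contravar; lra).
    replace (/ (h / 4)) with (4 / h) by (field; lra); unfold Rdiv in *; lra.
  - apply Rmult_le_compat_r; [lra|].
    assert (5 / PI <= 5 / 3) by (apply Rmult_le_compat_l; [lra | apply Rinv_le_contravar; lra]).
    replace (h / PI * (5 / h) / (1 - 1 / 256)) with (5 / PI * (256 / 255)) by (field; lra); lra.
Qed.

Lemma truncation_rel_near : forall N h x y s T, 0 < h -> h * h * (INR N + 1) = PI -> 0 <= x ->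
  rational_rule h (x, y) s T ->
  (forall k, INR k * h <= s k <= (INR k + 1 / 2) * h) -> (forall k, h / 4 <= Cmod ((x, y) - RtoC (s k))) ->
  forall K, (N <= K)%nat ->
  Cmod (x, y) * Cmod (T K - T N) <= 807 / 100 * (h * (INR N + 1) / PI) * rate N.
Proof.
  intros N h x y s T Hh HN Hx HT Hs Hd K HK.
  assert (P := PI_gt_3); assert (r0 := exp_pos (- (PI * (INR N + 1)))); assert (Pn := pos_INR N).
  eapply Rle_trans; [apply (truncation_geometric N h (x, y) s T (x, y) (8 * (INR N + 1)) 2);
    try assumption; try lra; [intros k; apply Hs|]|].
  - intros j; set (k := S (N + j)).
    assert (Hk1 := node_index_ge_1 (N + j)); fold k in Hk1.
    assert (Hk : h <= s k) by (apply Rle_trans with (2 := proj1 (Hs k)); nra).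
    destruct (rat_term_le x y (s k) (h / 4) Hx ltac:(lra) ltac:(lra) (Hd k)) as [_ B].
    eapply Rle_trans; [exact B|]; apply Rmult_le_compat_l; [left; apply exp_pos|].
    assert (s k / h <= INR k + 1 / 2) by (apply Rle_div_l; [lra | apply Hs]).
    replace (s k / (h / 4)) with (4 * (s k / h)) by (field; lra).
    (* The index exceeds N + 1 at most by the factor j + 1 <= 2^j. *)
    assert (A := INR_S_le_pow2 j); rewrite S_INR in A.
    assert (Ek : INR k = INR N + INR j + 1) by (unfold k; rewrite S_INR, plus_INR; reflexivity).
    assert (0 <= INR j) by apply pos_INR.
    assert ((INR N + 1) * (INR j + 1) <= (INR N + 1) * 2 ^ j) by (apply Rmult_le_compat_l; lra).
    assert (0 <= INR N * INR j) by (apply Rmult_le_pos; lra).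
    lra.
  - apply Rmult_le_compat_r; [lra|].
    assert (0 < h * (INR N + 1) / PI) by (apply Rdiv_lt_0_compat; nra).
    replace (h / PI * (8 * (INR N + 1)) / (1 - 2 / 256)) with (8 * (128 / 127) * (h * (INR N + 1) / PI))
      by (field; lra); lra.
Qed.

Lemma truncation_rel_far : forall N h x y s T, 0 < h -> h * h * (INR N + 1) = PI -> 0 <= x ->
  rational_rule h (x, y) s T ->
  (forall k, INR k * h <= s k) -> (forall k, 7 / 10 * s k <= Cmod ((x, y) - RtoC (s k))) ->
  forall K, (N <= K)%nat ->
  Cmod (x, y) * Cmod (T K - T N) <= 345 / 100 * (h / PI) * rate N.
Proof.
  intros N h x y s T Hh HN Hx HT Hs Hd K HK.
  assert (P := PI_gt_3); assert (r0 := exp_pos (- (PI * (INR N + 1)))).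
  eapply Rle_trans; [apply (truncation_geometric N h (x, y) s T (x, y) (24 / 7) 1);
    try assumption; try lra|].
  - intros j; rewrite pow1, Rmult_1_r; set (k := S (N + j)).
    assert (Hk : h <= s k).
    { apply Rle_trans with (2 := Hs k); assert (Q := node_index_ge_1 (N + j)); unfold k; nra. }
    destruct (rat_term_le x y (s k) (7 / 10 * s k) Hx ltac:(lra) ltac:(lra) (Hd k)) as [_ B].
    replace (2 + s k / (7 / 10 * s k)) with (24 / 7) in B by (field; lra); exact B.
  - apply Rmult_le_compat_r; [lra|].
    assert (0 < h / PI) by (apply Rdiv_lt_0_compat; lra).
    replace (h / PI * (24 / 7) / (1 - 1 / 256)) with (24 / 7 * (256 / 255) * (h / PI)) by (field; lra); lra.
Qed.

(** * Position of a point relative to the nodes *)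

Lemma frac_part_decomp : forall t, 0 <= t -> exists m : nat, t = INR m + frac_part t.
Proof.
  intros t Ht; exists (Z.to_nat (Int_part t)).
  destruct (base_fp t) as [F1 F2]; unfold frac_part in *.
  assert (0 <= Int_part t)%Z.
  { apply Z.lt_succ_r, lt_IZR; rewrite succ_IZR; lra. }
  rewrite INR_IZR_INZ, Z2Nat.id by assumption; ring.
Qed.

Lemma dist_trap_node : forall h m phi k, 0 < h -> 1 / 4 <= phi <= 3 / 4 ->
  h / 4 <= Rabs ((INR m + phi) * h - INR k * h).
Proof.
  intros h m phi k Hh Hp.
  destruct (Nat.le_gt_cases k m) as [H|H].
  - apply le_INR in H; rewrite Rabs_pos_eq; nra.
  - assert (H' : INR (S m) <= INR k) by (apply le_INR; lia).
    rewrite S_INR in H'; rewrite Rabs_left1; nra.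
Qed.

Lemma dist_mid_node : forall h m phi k, 0 < h -> 0 <= phi < 1 -> ~ (1 / 4 <= phi <= 3 / 4) ->
  h / 4 <= Rabs ((INR m + phi) * h - (INR k + 1 / 2) * h).
Proof.
  intros h m phi k Hh Hp Hn.
  assert (Hphi : phi < 1 / 4 \/ 3 / 4 < phi).
  { destruct (Rlt_le_dec phi (1 / 4)); [left; assumption|].
    destruct (Rlt_le_dec (3 / 4) phi); [right; assumption | exfalso; apply Hn; lra]. }
  destruct (Nat.lt_trichotomy k m) as [H|[H|H]].
  - assert (H' : INR (S k) <= INR m) by (apply le_INR; lia).
    rewrite S_INR in H'; rewrite Rabs_pos_eq; nra.
  - rewrite H; destruct Hphi; [rewrite Rabs_left1 | rewrite Rabs_pos_eq]; nra.
  - assert (H' : INR (S m) <= INR k) by (apply le_INR; lia).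
    rewrite S_INR in H'; rewrite Rabs_left1; nra.
Qed.

Lemma dist_diagonal : forall x y s, 0 <= x <= y -> 0 <= s -> 7 / 10 * s <= Cmod ((x, y) - RtoC s).
Proof.
  intros x y s Hxy Hs; unfold Cmod; rewrite <- (sqrt_square (7 / 10 * s)) by lra.
  apply sqrt_le_1_alt; simpl.
  assert (Q := pow2_ge_0 (2 * x - s)); nra.
Qed.

Lemma node_not_pole : forall x y s d, 0 <= x -> 0 < d -> d <= Cmod ((x, y) - RtoC s) -> 0 < x + s ->
  ((x, y) ^ 2 - RtoC s ^ 2)%C <> 0%C.
Proof.
  intros x y s d Hx Hd Hds Hs.
  replace ((x, y) ^ 2 - RtoC s ^ 2)%C with (((x, y) - RtoC s) * ((x, y) + RtoC s))%C by ring.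
  apply Cmult_neq_0.
  - apply Cmod_gt_0; lra.
  - intros E; apply (f_equal fst) in E; simpl in E; lra.
Qed.

(** On the real axis osc z H is a point of the unit circle whose angle is 2 pi phi, where phi is
    the fractional part of x/h; off the real axis its modulus is below 1. *)
Lemma one_minus_osc_neq_0 : forall e h H x y m phi, 0 < h -> h * H = PI -> 0 <= y -> Rabs e = 1 ->
  x = (INR m + phi) * h -> e * cos (2 * PI * phi) <= 0 ->
  (1 - RtoC e * osc (x, y) H)%C <> 0%C.
Proof.
  intros e h H x y m phi Hh HH Hy He Hx Hc E.
  assert (HHp : 0 < H) by exact (period_pos h H Hh HH).
  assert (F := f_equal fst E); unfold osc, Cexp in F; simpl in F.
  match type of F with context [exp ?a * cos ?b] =>
    replace a with (- (2 * H * y)) in F by ring;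
    replace b with (2 * PI * phi + INR m * (2 * PI)) in F by (rewrite Hx, <- HH; ring) end.
  rewrite cos_nat_period in F.
  assert (P := exp_pos (- (2 * H * y))).
  assert (e * (exp (- (2 * H * y)) * cos (2 * PI * phi)) <= 0).
  { replace (e * (exp (- (2 * H * y)) * cos (2 * PI * phi))) with (exp (- (2 * H * y)) * (e * cos (2 * PI * phi))) by ring.
    nra. }
  lra.
Qed.

Lemma one_minus_osc_neq_0_above : forall e H x y, 0 < H -> 0 < y -> Rabs e = 1 ->
  (1 - RtoC e * osc (x, y) H)%C <> 0%C.
Proof.
  intros e H x y HH Hy He E.
  assert (Q : Cmod (RtoC e * osc (x, y) H) < 1).
  { unfold osc; rewrite Cmod_mult, Cmod_R, He, Cmod_Cexp, Rmult_1_l, <- exp_0.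
    apply exp_increasing; simpl; nra. }
  replace (RtoC e * osc (x, y) H)%C with (1 - (1 - RtoC e * osc (x, y) H))%C in Q by ring.
  rewrite E in Q; replace (1 - 0)%C with (RtoC 1) in Q by ring.
  rewrite Cmod_1 in Q; lra.
Qed.

(** * The error in the first quadrant *)

(** From pi/4 = 4 arctan(1/5) - arctan(1/239). *)
Lemma PI_le : PI <= 32 / 10.
Proof.
  assert (M := Machin_4_5_239).
  assert (A : atan (/ 5) <= / 5).
  { destruct (MVT_gen atan 0 (/ 5) (fun x => / (1 + x ^ 2))) as [c [_ E]].
    - intros x _; auto_derive; [auto|]; unfold Rsqr; field; nra.
    - intros x _; apply continuity_pt_ex_derive; auto_derive; auto.
    - rewrite atan_0, !Rminus_0_r in E; rewrite E.
      rewrite <- (Rmult_1_l (/ 5)) at 2; apply Rmult_le_compat_r; [lra|].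
      rewrite <- Rinv_1; apply Rinv_le_contravar; nra. }
  assert (B : 0 < atan (/ 239)) by (rewrite <- atan_0; apply atan_increasing; lra).
  lra.
Qed.

Lemma sqrt_PI_le : sqrt PI <= 179 / 100.
Proof.
  rewrite <- (sqrt_square (179 / 100)) by lra.
  apply sqrt_le_1_alt; assert (P := PI_le); lra.
Qed.

Lemma step_facts : forall N, exists H m,
  0 < step N /\ step N * step N * (INR N + 1) = PI /\ H = PI / step N /\ step N * H = PI /\
  H * H = PI * (INR N + 1) /\ m = sqrt (INR N + 1) /\ 1 <= m /\ H = sqrt PI * m /\
  step N * (INR N + 1) = H /\ step N * m = sqrt PI.
Proof.
  intros N; set (h := step N); exists (PI / h), (sqrt (INR N + 1)).
  assert (Pn := pos_INR N); assert (P := PI_RGT_0).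
  assert (Hh : 0 < h) by (apply sqrt_lt_R0, Rdiv_lt_0_compat; lra).
  assert (Hhh : h * h = PI / (INR N + 1)).
  { apply sqrt_sqrt; left; apply Rdiv_lt_0_compat; lra. }
  assert (HN : h * h * (INR N + 1) = PI) by (rewrite Hhh; field; lra).
  set (m := sqrt (INR N + 1)).
  assert (Hm : m * m = INR N + 1) by (apply sqrt_sqrt; lra).
  assert (Hm1 : 1 <= m) by (unfold m; rewrite <- sqrt_1 at 1; apply sqrt_le_1_alt; lra).
  assert (Hhm : h * m = sqrt PI).
  { symmetry; apply sqrt_lem_1; [lra | apply Rmult_le_pos; lra|].
    rewrite <- HN, <- Hm; ring. }
  assert (HH : PI / h = sqrt PI * m).
  { rewrite <- Hhm, <- HN, <- Hm; field; lra. }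
  repeat split; try assumption.
  - field; lra.
  - rewrite <- HN at 1 2; replace (h * h * (INR N + 1) / h * (h * h * (INR N + 1) / h)) with ((h * h * (INR N + 1)) * (INR N + 1)) by (field; lra).
    rewrite HN; reflexivity.
  - rewrite <- HN; field; lra.
Qed.

Lemma combine_errors : forall (z D : C) a b a' b',
  (forall eta, 0 < eta -> exists E X Y : C, D = (E - X + Y)%C /\ Cmod E <= eta /\
     (Cmod X <= a /\ Cmod z * Cmod X <= b) /\ Cmod Y <= a' /\ Cmod z * Cmod Y <= b') ->
  Cmod D <= a + a' /\ Cmod z * Cmod D <= b + b'.
Proof.
  intros z D a b a' b' H; assert (Z := Cmod_ge_0 z).
  assert (T : forall E X Y : C, Cmod (E - X + Y) <= Cmod E + Cmod X + Cmod Y).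
  { intros E X Y; eapply Rle_trans; [apply Cmod_triangle|]; apply Rplus_le_compat_r.
    unfold Cminus; eapply Rle_trans; [apply Cmod_triangle|]; rewrite Cmod_opp; lra. }
  split; apply le_epsilon; intros eta He.
  - destruct (H eta He) as [E [X [Y [-> [HE [[HX _] [HY _]]]]]]].
    eapply Rle_trans; [apply T | lra].
  - assert (He' : 0 < eta / (Cmod z + 1)) by (apply Rdiv_lt_0_compat; lra).
    destruct (H _ He') as [E [X [Y [-> [HE [[_ HX] [_ HY]]]]]]].
    assert (Q : Cmod z * Cmod E <= eta).
    { apply Rle_trans with ((Cmod z + 1) * (eta / (Cmod z + 1))).
      - assert (P := Cmod_ge_0 E); nra.
      - right; field; lra. }
    apply Rle_trans with (Cmod z * (Cmod E + Cmod X + Cmod Y)).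
    + apply Rmult_le_compat_l; [exact Z | apply T].
    + lra.
Qed.

Lemma Cexp_osc_inv : forall z h H, 0 < h -> H = PI / h ->
  Cexp (- (2 * Ci * PI * z / h)) = (/ osc z H)%C.
Proof.
  intros z h H Hh HH; unfold osc.
  assert (E : (- (2 * Ci * PI * z / h))%C = (- (2 * Ci * z * RtoC H))%C).
  { rewrite HH, RtoC_div by lra; unfold Cdiv; ring. }
  rewrite E; set (u := (2 * Ci * z * RtoC H)%C).
  assert (N0 := Cexp_neq_0 u); assert (P := Cexp_opp_l u).
  transitivity (Cexp (- u) * Cexp u / Cexp u)%C; [field; exact N0|].
  rewrite P; field; exact N0.
Qed.

(** Common to the three formulas: S K is the rational sum truncated after K, V is the value of the
    approximation, -cor its pole correction, and -X M tends to the discretisation error. *)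
Lemma rule_error : forall N z (S X : nat -> C) V cor a b a' b' n0,
  V = (S N - cor)%C ->
  (forall eta n1, 0 < eta -> exists M K, (n1 <= M)%nat /\ (n1 <= K)%nat /\
     Cmod (faddeeva z + X M + cor - S K)%C <= eta) ->
  (forall M, (n0 <= M)%nat -> Cmod (X M) <= a /\ Cmod z * Cmod (X M) <= b) ->
  (forall K, (N <= K)%nat -> Cmod (S K - S N) <= a' /\ Cmod z * Cmod (S K - S N) <= b') ->
  Cmod (faddeeva z - V) <= a + a' /\ Cmod z * Cmod (faddeeva z - V) <= b + b'.
Proof.
  intros N z S X V cor a b a' b' n0 HV HX HXb HSb.
  apply combine_errors; intros eta He.
  destruct (HX eta (Nat.max N n0) He) as [M [K [HM [HK HMK]]]].
  exists (faddeeva z + X M + cor - S K)%C, (X M), (S K - S N)%C.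
  split; [rewrite HV; ring|]; split; [exact HMK|]; split; [apply HXb; lia | apply HSb; lia].
Qed.

Lemma exp_rate_le : forall N, rate N <= 1 / 16.
Proof.
  intros N; apply Rle_trans with (2 := exp_opp_PI_le); apply exp_le_mono.
  assert (P := PI_RGT_0); assert (Pn := pos_INR N); nra.
Qed.

Lemma weighted_error : forall (z D : C) A B p r M, 0 <= p ->
  Cmod D <= A * r -> Cmod z * Cmod D <= B * r -> 0 < r -> A + p * B <= M ->
  (1 + p * Cmod z) * Cmod D <= M * r.
Proof.
  intros z D A B p r M Hp H1 H2 Hr HM.
  replace ((1 + p * Cmod z) * Cmod D) with (Cmod D + p * (Cmod z * Cmod D)) by ring.
  assert (p * (Cmod z * Cmod D) <= p * (B * r)) by (apply Rmult_le_compat_l; assumption).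
  assert ((A + p * B) * r <= M * r) by (apply Rmult_le_compat_r; lra).
  lra.
Qed.

(** The weight 1 + sqrt(pi)|z| is the one of the lower bound for |w|. *)
Definition quadrant_bound (N : nat) (z : C) (V : C) : Prop :=
  Cmod (faddeeva z - V) <= 585 / 100 * rate N /\
  (1 + sqrt PI * Cmod z) * Cmod (faddeeva z - V)
    <= 27 * sqrt (INR N + 1) * rate N.

(** With m = sqrt(N+1) one has H = sqrt(pi) m, so sqrt(pi) times the second bound is linear in m;
    the numbers use 1.7 < sqrt(pi) <= 1.79 and pi <= 3.2. *)
Lemma modified_bound : forall N (z V : C),
  Cmod (faddeeva z - V) <= 227 / 100 * rate N + 168 / 100 * rate N ->
  Cmod z * Cmod (faddeeva z - V) <=
    (426 / 100 + 115 / 100 * (PI / step N)) * rate N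
    + 807 / 100 * (step N * (INR N + 1) / PI) * rate N ->
  quadrant_bound N z V.
Proof.
  intros N z V H1 H2.
  destruct (step_facts N) as [H [m [Hh [HN [HE [HH [HHH [Hm [Hm1 [HHm [HhN Hhm]]]]]]]]]]].
  assert (R0 := exp_pos (- (PI * (INR N + 1)))).
  assert (P1 := sqrt_PI_gt); assert (P2 := sqrt_PI_le); assert (P3 := sqrt_PI_sqr); assert (P4 := PI_le).
  rewrite HhN, <- HE in H2.
  split; [lra|].
  rewrite <- Hm.
  apply (weighted_error z _ (395 / 100) (426 / 100 + 115 / 100 * H + 807 / 100 * (H / PI))); try lra.
  replace (sqrt PI * (426 / 100 + 115 / 100 * H + 807 / 100 * (H / PI)))
    with (426 / 100 * sqrt PI + 115 / 100 * (sqrt PI * sqrt PI * m) + 807 / 100 * (sqrt PI * sqrt PI * m / PI))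
    by (rewrite HHm; field; apply PI_neq0).
  rewrite P3; replace (PI * m / PI) with m by (field; apply PI_neq0).
  nra.
Qed.

Lemma plain_bound : forall N (z V : C),
  Cmod (faddeeva z - V) <= 415 / 100 * rate N + 168 / 100 * rate N ->
  Cmod z * Cmod (faddeeva z - V) <=
    (371 / 100 + 316 / 100 * (PI / step N)) * rate N
    + 345 / 100 * (step N / PI) * rate N ->
  quadrant_bound N z V.
Proof.
  intros N z V H1 H2.
  destruct (step_facts N) as [H [m [Hh [HN [HE [HH [HHH [Hm [Hm1 [HHm [HhN Hhm]]]]]]]]]]].
  assert (R0 := exp_pos (- (PI * (INR N + 1)))).
  assert (P1 := sqrt_PI_gt); assert (P2 := sqrt_PI_le); assert (P3 := sqrt_PI_sqr); assert (P4 := PI_le).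
  rewrite <- HE in H2.
  split; [lra|].
  rewrite <- Hm.
  apply (weighted_error z _ (583 / 100) (371 / 100 + 316 / 100 * H + 345 / 100 * (step N / PI))); try lra.
  assert (Q : sqrt PI * (step N / PI) <= 1).
  { replace (sqrt PI * (step N / PI)) with (/ m).
    - rewrite <- Rinv_1; apply Rinv_le_contravar; lra.
    - set (p := sqrt PI) in *; rewrite <- P3, <- Hhm; field; lra. }
  replace (sqrt PI * (371 / 100 + 316 / 100 * H + 345 / 100 * (step N / PI)))
    with (371 / 100 * sqrt PI + 316 / 100 * (sqrt PI * sqrt PI * m) + 345 / 100 * (sqrt PI * (step N / PI)))
    by (rewrite HHm; ring).
  rewrite P3; nra.
Qed.

Lemma modified_rule_bound : forall N e x y s T V cor, 0 <= x -> 0 <= y -> Rabs e = 1 ->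
  (y < x \/ y < PI / step N) -> V = (T N - cor)%C -> rational_rule (step N) (x, y) s T ->
  (forall k, INR k * step N <= s k <= (INR k + 1 / 2) * step N) ->
  (forall k, step N / 4 <= Cmod ((x, y) - RtoC (s k))) ->
  (forall eta n1, 0 < eta -> exists M K, (n1 <= M)%nat /\ (n1 <= K)%nat /\
     Cmod (faddeeva (x, y) + dsum e (PI / step N) (x, y) M + cor - T K)%C <= eta) ->
  quadrant_bound N (x, y) V.
Proof.
  intros N e x y s T V cor Hx Hy He Hyx HV HT Hs Hd HX.
  destruct (step_facts N) as [H [m [Hh [HN [HE [HH [HHH [Hm [Hm1 [HHm [HhN Hhm]]]]]]]]]]].
  assert (H17 : 17 / 10 <= H) by (rewrite HHm; assert (P := sqrt_PI_gt); nra).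
  assert (Hr : exp (- (H * H)) <= 1 / 16) by (rewrite HHH; apply exp_rate_le).
  destruct (rule_error N (x, y) T (fun M => dsum e (PI / step N) (x, y) M) V cor
    (227 / 100 * rate N) ((426 / 100 + 115 / 100 * (PI / step N)) * rate N)
    (168 / 100 * rate N) (807 / 100 * (step N * (INR N + 1) / PI) * rate N) 0%nat HV HX) as [A1 A2].
  - intros M _; rewrite <- HE, <- HHH; rewrite <- HE in Hyx.
    apply (discretisation_modified H e x y); assumption.
  - intros K HK; split.
    + apply (truncation_abs N (step N) x y s T); try assumption; intros k; apply Hs.
    + apply (truncation_rel_near N (step N) x y s T); assumption.
  - apply modified_bound; assumption.
Qed.

Lemma quadrant_error : forall N x y, 0 <= x -> 0 <= y -> quadrant_bound N (x, y) (wN_quadrant N (x, y)).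
Proof.
  intros N x y Hx Hy.
  destruct (step_facts N) as [H [m [Hh [HN [HE [HH [HHH [Hm [Hm1 [HHm [HhN Hhm]]]]]]]]]]].
  assert (Hr := exp_rate_le N).
  assert (P1 := sqrt_PI_gt).
  assert (H17 : 17 / 10 <= H) by (rewrite HHm; nra).
  assert (Hr' : gauss H <= 1 / 16) by (rewrite HHH; exact Hr).
  assert (Hxh : 0 <= x / step N) by (apply Rmult_le_pos; [exact Hx | left; apply Rinv_0_lt_compat, Hh]).
  destruct (frac_part_decomp (x / step N) Hxh) as [n Hn].
  destruct (base_fp (x / step N)) as [F1 F2].
  set (phi := frac_part (x / step N)) in *.
  assert (Hxn : x = (INR n + phi) * step N) by (rewrite <- Hn; field; lra).
  assert (Dre : forall s : R, Rabs (x - s) <= Cmod ((x, y) - RtoC s))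
    by (intros s; apply (re_le_Cmod ((x, y) - RtoC s)%C)).
  assert (Ms : forall k, INR k * step N <= (INR k + 1 / 2) * step N <= (INR k + 1 / 2) * step N)
    by (intros k; nra).
  assert (Mp : forall k, 0 < (INR k + 1 / 2) * step N) by (intros k; assert (Q := pos_INR k); nra).
  assert (Hmid := rational_rule_mid (step N) (x, y) Hh).
  assert (Htrap := rational_rule_trap (step N) (x, y) Hh).
  unfold wN_quadrant, Re, Im; cbn [fst snd]; fold phi.
  rewrite <- HE.
  destruct (Rle_dec (Rmax x H) y) as [Cy|Cy].
  - (* Since y >= x, the distance of z from a node s is at least s/sqrt(2). *)
    assert (Cx : x <= y) by (assert (Q := Rmax_l x H); lra).
    assert (CH : H <= y) by (assert (Q := Rmax_r x H); lra).
    assert (Dg : forall k, 7 / 10 * ((INR k + 1 / 2) * step N) <= Cmod ((x, y) - RtoC ((INR k + 1 / 2) * step N)))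
      by (intros k; apply dist_diagonal; [lra | left; apply Mp]).
    assert (Dd : forall k, step N / 4 <= Cmod ((x, y) - RtoC ((INR k + 1 / 2) * step N)))
      by (intros k; eapply Rle_trans; [|apply Dg]; assert (Q := pos_INR k); nra).
    assert (Hq : (1 - RtoC (-1) * osc (x, y) H)%C <> 0%C).
    { apply one_minus_osc_neq_0_above; [lra | lra | rewrite Rabs_left; lra]. }
    destruct (discretisation_plain H (-1) x y H17 Hr' ltac:(ring) ltac:(lra) CH Hq) as [L HL].
    rewrite HHH in HL.
    set (cor := (2 * Cexp (- (x, y) ^ 2) * (RtoC (-1) * osc (x, y) H / (1 - RtoC (-1) * osc (x, y) H)))%C) in *.
    assert (A : Cmod (faddeeva (x, y) - wM N (x, y)) <= 415 / 100 * rate N + 168 / 100 * rate N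
       /\ Cmod (x, y) * Cmod (faddeeva (x, y) - wM N (x, y)) <= (371 / 100 + 316 / 100 * H) * rate N
            + 345 / 100 * (step N / PI) * rate N).
    { apply (rule_error N (x, y) (mid_sum (step N) (x, y))
        (fun M => dsum (-1) H (x, y) M + cor)%C _ 0%C _ _ _ _ L).
      - replace (mid_sum (step N) (x, y) N - 0)%C with (mid_sum (step N) (x, y) N) by ring; reflexivity.
      - intros eta n1 He.
        destruct (mid_expansion (step N) H (x, y) Hh HH Hy Hq) with (eta := eta) (n1 := n1) as [M [K [HM [HK HMK]]]];
          [intros k; apply (node_not_pole x y _ (step N / 4)); try lra; [apply Dd | assert (Q := Mp k); lra] | exact He |].
        exists M, K; repeat split; try assumption.
        fold cor in HMK; rewrite Cplus_0_r, Cplus_assoc; exact HMK.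
      - intros M HM; apply (HL M HM).
      - intros K HK; split.
        + apply (truncation_abs N (step N) x y _ _ Hh HN Hx Hmid); try assumption; intros k; apply Ms.
        + apply (truncation_rel_far N (step N) x y _ _ Hh HN Hx Hmid); try assumption; intros k; apply Ms. }
    apply plain_bound; rewrite <- ?HE; apply A.
  - assert (Hyx : y < x \/ y < H).
    { destruct (Rlt_le_dec y x) as [Q|Q]; [left; exact Q|].
      right; apply Rnot_le_lt; intros Q'; apply Cy, Rmax_lub; assumption. }
    destruct (sumbool_and _ _ _ _ _ _) as [[Cx [Cp1 Cp2]]|Cn].
    + (* The fractional part keeps x at distance h/4 from the nodes kh, and cos(2 pi x/h) <= 0
         excludes q = 1. *)
      assert (Dd : forall k, step N / 4 <= Cmod ((x, y) - RtoC (INR k * step N))).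
      { intros k; eapply Rle_trans; [|apply Dre]; rewrite Hxn; apply dist_trap_node; [exact Hh | lra]. }
      assert (Hq : (1 - RtoC 1 * osc (x, y) H)%C <> 0%C).
      { apply (one_minus_osc_neq_0 1 (step N) H x y n phi Hh HH Hy Rabs_R1 Hxn).
        rewrite Rmult_1_l; assert (P := PI_RGT_0); apply cos_le_0; nra. }
      set (cor := (2 * Cexp (- (x, y) ^ 2) * (RtoC 1 * osc (x, y) H / (1 - RtoC 1 * osc (x, y) H)))%C) in *.
      apply (modified_rule_bound N 1 x y (fun k => INR k * step N) (trap_sum (step N) (x, y)) _ cor);
        try assumption; rewrite <- ?HE; [apply Rabs_R1 | exact Hyx | | intros k; nra |].
      * unfold wMT; rewrite (Cexp_osc_inv (x, y) (step N) H Hh HE).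
        assert (E : (2 * Cexp (- (x, y) ^ 2) / (1 - / osc (x, y) H))%C = (- cor)%C).
        { unfold cor; assert (N0 : osc (x, y) H <> 0%C) by apply Cexp_neq_0.
          assert (N1 : (1 - osc (x, y) H)%C <> 0%C) by (intros Q; apply Hq; rewrite <- Q; ring).
          field; repeat split; try assumption.
          intros Q; apply N1.
          replace (1 - osc (x, y) H)%C with (- (osc (x, y) H - 1))%C by ring; rewrite Q; ring. }
        rewrite E; unfold trap_sum, rat_term, node; ring.
      * apply (trap_expansion (step N) H (x, y) Hh HH Hy Hq).
        intros k; apply (node_not_pole x y _ (step N / 4)); try lra; [apply Dd|].
        assert (Q := pos_INR k); nra.
    + (* Either y >= x, or x is at distance h/4 from the midpoints and cos(2 pi x/h) >= 0
         excludes q = -1. *)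
      assert (Hcase : (x <= y) \/ ~ (1 / 4 <= phi <= 3 / 4)).
      { destruct (Rlt_le_dec y x) as [Q|Q]; [right | left; exact Q].
        intros [Q1 Q2]; destruct Cn as [Cn|Cn]; [exact (Cn Q)|].
        destruct Cn as [Cn|Cn]; [exact (Cn Q1) | exact (Cn Q2)]. }
      assert (Dd : forall k, step N / 4 <= Cmod ((x, y) - RtoC ((INR k + 1 / 2) * step N))).
      { intros k; destruct Hcase as [Q|Q].
        - eapply Rle_trans; [|apply dist_diagonal; [lra | left; apply Mp]]; assert (Q' := pos_INR k); nra.
        - eapply Rle_trans; [|apply Dre]; rewrite Hxn; apply dist_mid_node; [exact Hh | lra | exact Q]. }
      assert (Hq : (1 - RtoC (-1) * osc (x, y) H)%C <> 0%C).
      { assert (Ra : Rabs (-1) = 1) by (rewrite Rabs_left; lra).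
        assert (P := PI_RGT_0).
        destruct (Rle_lt_or_eq_dec 0 y Hy) as [Y0|Y0]; [apply one_minus_osc_neq_0_above; lra|].
        destruct Hcase as [Q|Q].
        - apply (one_minus_osc_neq_0 (-1) (step N) H x y 0 0 Hh HH Hy Ra); [simpl; lra|].
          rewrite Rmult_0_r, cos_0; lra.
        - apply (one_minus_osc_neq_0 (-1) (step N) H x y n phi Hh HH Hy Ra Hxn).
          assert (0 <= cos (2 * PI * phi)); [|lra].
          destruct (Rlt_le_dec phi (1 / 4)) as [Q1|Q1]; [apply cos_ge_0; nra|].
          assert (Q2 : 3 / 4 < phi) by (apply Rnot_le_lt; intros Q2; apply Q; lra).
          replace (2 * PI * phi) with (2 * PI * (phi - 1) + INR 1 * (2 * PI)) by (simpl; ring).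
          rewrite cos_nat_period; apply cos_ge_0; nra. }
      set (cor := (2 * Cexp (- (x, y) ^ 2) * (RtoC (-1) * osc (x, y) H / (1 - RtoC (-1) * osc (x, y) H)))%C) in *.
      apply (modified_rule_bound N (-1) x y (fun k => (INR k + 1 / 2) * step N) (mid_sum (step N) (x, y)) _ cor);
        try assumption; rewrite <- ?HE; [rewrite Rabs_left; lra | exact Hyx | |].
      * unfold wMM; rewrite (Cexp_osc_inv (x, y) (step N) H Hh HE).
        assert (E : (2 * Cexp (- (x, y) ^ 2) / (1 + / osc (x, y) H))%C = (- cor)%C).
        { unfold cor; assert (N0 : osc (x, y) H <> 0%C) by apply Cexp_neq_0.
          replace (RtoC (-1)) with (- (1))%C in * by (apply injective_projections; simpl; ring).
          assert (N1 : (1 + osc (x, y) H)%C <> 0%C) by (intros Q; apply Hq; rewrite <- Q; ring).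
          field; repeat split; try assumption.
          intros Q; apply N1; rewrite <- Q; ring. }
        rewrite E; change (wM N (x, y)) with (mid_sum (step N) (x, y) N); ring.
      * apply (mid_expansion (step N) H (x, y) Hh HH Hy Hq).
        intros k; apply (node_not_pole x y _ (step N / 4)); try lra; [apply Dd|].
        assert (Q := Mp k); lra.
Qed.

(** * Extension to the plane, and the constants *)

Lemma upper_error : forall N x y, 0 <= y -> quadrant_bound N (x, y) (wN_upper N (x, y)).
Proof.
  intros N x y Hy; unfold wN_upper, Re; cbn [fst].
  destruct (Rle_dec 0 x) as [Hx|Hx]; [apply quadrant_error; assumption|].
  set (z := (x, y) : C).
  assert (Ez : (- Cconj z)%C = ((- x)%R, y)) by (apply injective_projections; simpl; ring).
  destruct (quadrant_error N (- x) y ltac:(lra) Hy) as [Q1 Q2].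
  rewrite <- Ez in Q1, Q2.
  assert (E : Cmod (faddeeva z - Cconj (wN_quadrant N (- Cconj z))) = Cmod (faddeeva (- Cconj z) - wN_quadrant N (- Cconj z))).
  { rewrite faddeeva_conj, <- Cmod_conj; f_equal.
    destruct (faddeeva z), (wN_quadrant N (- Cconj z)%C); apply injective_projections; simpl; ring. }
  unfold quadrant_bound; rewrite E; split; [exact Q1|].
  rewrite Cmod_opp, Cmod_conj in Q2; exact Q2.
Qed.

Lemma plane_error : forall N x y,
  Cmod (faddeeva (x, y) - wN N (x, y)) <= 585 / 100 * rate N.
Proof.
  intros N x y; unfold wN, Im; cbn [snd].
  destruct (Rle_dec 0 y) as [Hy|Hy]; [apply upper_error, Hy|].
  set (z := (x, y) : C).
  assert (R := faddeeva_reflect z).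
  replace (faddeeva z - (2 * Cexp (- z ^ 2) - wN_upper N (- z)))%C
    with (- (faddeeva (- z) - wN_upper N (- z)))%C by (rewrite <- R; ring).
  rewrite Cmod_opp; change (- z)%C with ((- x)%R, (- y)%R).
  apply upper_error; lra.
Qed.

Lemma rate_split : forall N, rate N = / exp PI * exp (- PI * INR N).
Proof. intros N; rewrite <- exp_Ropp, <- exp_plus; f_equal; ring. Qed.

Lemma denominator_bounds : 0 < 1 - exp (- 2 * PI + sqrt (2 * PI)) <= 1.
Proof.
  assert (P := PI_gt_3).
  assert (S : sqrt (2 * PI) < 2 * PI).
  { rewrite <- (sqrt_square (2 * PI)) at 2 by lra; apply sqrt_lt_1; nra. }
  assert (E := exp_pos (- 2 * PI + sqrt (2 * PI))).
  assert (exp (- 2 * PI + sqrt (2 * PI)) < exp 0) by (apply exp_increasing; lra).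
  rewrite exp_0 in *; lra.
Qed.

Lemma sqrt_2_bound : 141 / 100 <= sqrt 2.
Proof. rewrite <- (sqrt_square (141 / 100)) by lra; apply sqrt_le_1_alt; lra. Qed.

Lemma abs_const_large : 585 / 100 * / exp PI <= abs_const.
Proof.
  assert (P := PI_gt_3); assert (P' := PI_le); assert (S2 := sqrt_2_bound).
  assert (D := denominator_bounds); assert (E := exp_PI_ge_16); assert (E1 := exp_pos 1).
  unfold abs_const.
  assert (T1 : 0 <= 2 * (2 * exp 1 + sqrt PI) / (exp PI * sqrt (exp 1 * PI) * (1 - exp (- 2 * PI + sqrt (2 * PI))))).
  { apply Rlt_le, Rdiv_lt_0_compat.
    - assert (S := sqrt_PI_gt_1); lra.
    - repeat apply Rmult_lt_0_compat; try lra; apply sqrt_lt_R0; nra. }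
  assert (T2 : 585 / 100 * / exp PI <= 10 * sqrt 2 * (1 + 2 * PI) / (exp PI * PI ^ 2)).
  { replace (10 * sqrt 2 * (1 + 2 * PI) / (exp PI * PI ^ 2))
      with (10 * sqrt 2 * (1 + 2 * PI) / PI ^ 2 * / exp PI) by (field; lra).
    apply Rmult_le_compat_r; [left; apply Rinv_0_lt_compat; lra|].
    assert (PI ^ 2 <= 32 / 10 * PI) by nra.
    assert (141 / 10 * (1 + 2 * PI) <= 10 * sqrt 2 * (1 + 2 * PI)) by (apply Rmult_le_compat_r; lra).
    apply (proj1 (Rle_div_r (585 / 100) _ (PI ^ 2) ltac:(nra))); lra. }
  lra.
Qed.

(** The factor 81 is 27 times the inverse of 1/3 < 1 - 2/pi. *)
Lemma rel_const_large : 81 * / exp PI <= rel_const.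
Proof.
  assert (P := PI_gt_3); assert (P' := PI_le); assert (S2 := sqrt_2_bound); assert (S := sqrt_PI_gt).
  assert (D := denominator_bounds); assert (E := exp_PI_ge_16); assert (E1 := exp_pos 1).
  unfold rel_const.
  set (d := 1 - exp (- 2 * PI + sqrt (2 * PI))) in *.
  set (g := sqrt (exp 1)).
  assert (G2 : g * g = exp 1) by (apply sqrt_sqrt; lra).
  assert (G1 : 3 / 2 <= g).
  { unfold g; replace (exp 1) with (exp (1 / 2) * exp (1 / 2)) by (rewrite <- exp_plus; f_equal; field).
    rewrite sqrt_square by (left; apply exp_pos).
    assert (A := exp_ineq1_le (1 / 2)); lra. }
  assert (T1 : 31 * / exp PI <= 2 * sqrt 2 * (1 + sqrt PI) * (2 * exp 1 + sqrt PI) / (exp PI * g * d)).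
  { replace (2 * sqrt 2 * (1 + sqrt PI) * (2 * exp 1 + sqrt PI) / (exp PI * g * d))
      with (2 * sqrt 2 * (1 + sqrt PI) * (2 * exp 1 + sqrt PI) / (g * d) * / exp PI) by (field; lra).
    apply Rmult_le_compat_r; [left; apply Rinv_0_lt_compat; lra|].
    apply (proj1 (Rle_div_r 31 _ (g * d) ltac:(nra))).
    assert (A1 : 413 / 100 * g <= 2 * exp 1 + sqrt PI) by (rewrite <- G2; nra).
    assert (A2 : 76 / 10 <= 2 * sqrt 2 * (1 + sqrt PI)) by nra.
    apply Rle_trans with (76 / 10 * (413 / 100 * g)); [nra|].
    apply Rmult_le_compat; nra. }
  assert (T2 : 50 * / exp PI <= 10 * (1 + 2 * PI) * (2 * PI + sqrt 2) / (exp PI * PI ^ 2)).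
  { replace (10 * (1 + 2 * PI) * (2 * PI + sqrt 2) / (exp PI * PI ^ 2))
      with (10 * (1 + 2 * PI) * (2 * PI + sqrt 2) / PI ^ 2 * / exp PI) by (field; lra).
    apply Rmult_le_compat_r; [left; apply Rinv_0_lt_compat; lra|].
    assert (PI ^ 2 <= 32 / 10 * PI) by nra.
    assert (10 * (1 + 2 * PI) * (2 * PI + 141 / 100) <= 10 * (1 + 2 * PI) * (2 * PI + sqrt 2))
      by (apply Rmult_le_compat_l; lra).
    apply (proj1 (Rle_div_r 50 _ (PI ^ 2) ltac:(nra))); nra. }
  lra.
Qed.

Theorem theorem1p1 :
  forall N : nat,
    (forall x y : R,
       Cmod (faddeeva (x, y) - wN N (x, y))%C <= abs_const * exp (- PI * INR N)) /\
    (forall x y : R, 0 <= y ->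
       Cmod (faddeeva (x, y) - wN N (x, y))%C / Cmod (faddeeva (x, y))
         <= rel_const * sqrt (INR N + 1) * exp (- PI * INR N)).
Proof.
  intros N; assert (E0 := exp_pos (- PI * INR N)).
  split; intros x y.
  - eapply Rle_trans; [apply plane_error|].
    rewrite rate_split, <- Rmult_assoc; apply Rmult_le_compat_r; [lra | apply abs_const_large].
  - intros Hy.
    assert (L := faddeeva_lower_bound (x, y) Hy).
    destruct (upper_error N x y Hy) as [_ Q].
    assert (EwN : wN N (x, y) = wN_upper N (x, y)).
    { unfold wN, Im; cbn [snd]; destruct (Rle_dec 0 y); [reflexivity | contradiction]. }
    rewrite EwN.
    set (d := Cmod (faddeeva (x, y) - wN_upper N (x, y))) in *.
    set (w := Cmod (faddeeva (x, y))) in *.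
    set (u := 1 + sqrt PI * Cmod (x, y)) in *.
    assert (P := PI_gt_3).
    assert (Hw0 : 0 <= w) by apply Cmod_ge_0; assert (Hd0 : 0 <= d) by apply Cmod_ge_0.
    assert (L' : 1 / 3 <= u * w).
    { assert (2 / PI <= 2 / 3) by (apply Rmult_le_compat_l; [lra | apply Rinv_le_contravar; lra]); lra. }
    assert (Hw : 0 < w) by (destruct Hw0 as [Hw0|Hw0]; [exact Hw0 | rewrite <- Hw0, Rmult_0_r in L'; lra]).
    apply Rle_trans with (3 * (u * d)).
    + apply Rle_div_l; [exact Hw|].
      replace (3 * (u * d) * w) with (3 * (u * w) * d) by ring.
      assert (1 * d <= 3 * (u * w) * d) by (apply Rmult_le_compat_r; lra); lra.
    + apply Rle_trans with (3 * (27 * sqrt (INR N + 1) * rate N)); [lra|].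
      rewrite rate_split.
      replace (3 * (27 * sqrt (INR N + 1) * (/ exp PI * exp (- PI * INR N))))
        with (81 * / exp PI * (sqrt (INR N + 1) * exp (- PI * INR N))) by ring.
      rewrite (Rmult_assoc rel_const); apply Rmult_le_compat_r; [|apply rel_const_large].
      apply Rmult_le_pos; [apply sqrt_pos | lra].
Qed.
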